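(* Let $n\ge2$, let $X$ be a one-dimensional Peano continuum, $y_0\in X$, $\{x_j\}_{j\in\mathbb{N}}$ a sequence in $X$, each $(A_j,a_j)$ sequentially $(n-1)$-connected and $\pi_n$-residual, $Y=\operatorname{\bf Adj}(X,x_j,A_j,a_j)$, with generalized universal covering $p:\widetilde Y\to Y$, $\widetilde X=p^{-1}(X)$, the group $G$ and the injective homomorphism $\widetilde\Phi:\pi_n(\widetilde Y,\widetilde y_0)\to G$ as in the context. An element $g\in G$ lies in $\operatorname{Im}(\widetilde{\Phi})$ if and only if (1) the closure $\overline{\operatorname{supp}(g)}$ in $\widetilde X$ is compact, and (2) for every $j\in\mathbb{N}$, either $\operatorname{supp}(g_j)$ is finite, or $\operatorname{supp}(g_j)$ is countably infinite and there exist an enumeration $\operatorname{supp}(g_j)=\{[\alpha_1],[\alpha_2],\dots\}$ and a based map $h:(\mathbb{H}_n,b_0)\to(A_j,a_j)$ with $g(j,[\alpha_i])=[h\circ\ell_i]$ for all $i\in\mathbb{N}$.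
   Context: All spaces Hausdorff; $I=[0,1]$; Peano continuum = connected, locally path-connected compact metric space; one-dimensional = covering dimension one. $\operatorname{\bf Adj}(X,x_j,A_j,a_j)$: $Y_k$ is the adjunction space obtained from $X\sqcup A_1\sqcup\dots\sqcup A_k$ by $a_j\sim x_j$ ($j\le k$), $\rho_{k+1,k}$ collapses $A_{k+1}$ to $x_{k+1}$, and the space is $\varprojlim_kY_k\subseteq\prod_kY_k$ with underlying set $(X\sqcup\coprod_jA_j)/(a_j\sim x_j)$. Shrinking wedge: one-point union where $U$ is open iff it meets each summand in an open set and, if it contains the wedge point, contains all but finitely many summands. $\mathbb{H}_0=\{0\}\cup\{1/m\}$ based at $0$; $\mathbb{H}_k$ ($k\ge1$) is the shrinking wedge of countably many copies of $(S^k,e_k)$ with wedge point $b_0$, $\ell_i:S^k\to\mathbb{H}_k$ the $i$-th inclusion. $X$ is sequentially $m$-connected at $x$ if the set of based homotopy classes $[(\mathbb{H}_k,b_0),(X,x)]$ is a singleton for all $0\le k\le m$; $\pi_n$-residual at $x$ if $[f]\mapsto([f\circ\ell_i])_i$, $[(\mathbb{H}_n,b_0),(X,x)]\to\pi_n(X,x)^{\mathbb{N}}$, is injective. $\widetilde Y$: path-homotopy classes $[\alpha]$ of paths in $Y$ from $y_0$ with the whisker topology (basic sets $\{[\alpha\cdot\epsilon]:\epsilon(I)\subseteq U\}$, $U$ open about $\alpha(1)$), basepoint $\widetilde y_0$ = class of constant path, $p([\alpha])=\alpha(1)$; this is a simply connected generalized universal covering. $p^{-1}(x_j)=\{[\alpha]:\alpha(1)=x_j\}$.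 For $[\alpha]\in p^{-1}(x_j)$, $\mathcal{A}_{j,[\alpha]}=\{[\alpha\cdot\epsilon]:\epsilon$ a path in $A_j$ with $\epsilon(0)=a_j\}$, with canonical retraction $r_{j,[\alpha]}:\widetilde Y\to\mathcal A_{j,[\alpha]}$ constant at $[\alpha]$ off $\mathcal A_{j,[\alpha]}$; $p$ induces an identification $\pi_n(\mathcal{A}_{j,[\alpha]},[\alpha])=\pi_n(A_j,a_j)$. Let $G=\prod_{j\in\mathbb{N}}\prod_{[\alpha]\in p^{-1}(x_j)}\pi_n(A_j,a_j)$, with elements written $g=(g(j,[\alpha]))$, and $\widetilde\Phi([f])=([r_{j,[\alpha]}\circ f])_{j,[\alpha]}$ under this identification. For $g\in G$: $\operatorname{supp}(g)=\{[\alpha]\in\widetilde X: g(j,[\alpha])\neq0\text{ for some }j\}$; $g_j\in G$ agrees with $g$ at indices $(j,[\alpha])$ and is $0$ elsewhere; $\operatorname{supp}(g_j)=\{[\alpha]\in p^{-1}(x_j):g(j,[\alpha])\ne0\}$. *)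

(* Defs.v *)
From HB Require Import structures.
From mathcomp Require Import all_boot all_order all_algebra.
From mathcomp Require Import all_classical all_reals all_analysis.
From mathcomp Require Import subtype_topology.

Unset Printing Implicit Defensive.
Import Order.TTheory GRing.Theory Num.Theory.
Import numFieldNormedType.Exports.
Local Open Scope classical_set_scope.
Local Open Scope ring_scope.

Section Standard.
Variable R : realType.

Definition Iset : set R := [set t | 0 <= t <= 1].
Definition Iu : topologicalType := set_type Iset.

Definition sphere (k : nat) : set 'rV[R]_k.+1 :=
  [set v | \sum_(i < k.+1) (v ord0 i) ^+ 2 = 1].
Definition ebase (k : nat) : 'rV[R]_k.+1 :=
  \row_(i < k.+1) (if i == ord0 then 1 else 0).
Definition Sph (k : nat) : topologicalType := set_type (sphere k).
Definition sph_bp (k : nat) (s : Sph k) : Prop := set_val s = ebase k.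

Definition H0set : set R := [set 0] `|` [set (m.+1%:R)^-1 | m in [set: nat]].
Definition H0 : topologicalType := set_type H0set.
Definition H0_bp (b : H0) : Prop := set_val b = 0.

Definition based_map (T A : topologicalType) (bp : T -> Prop) (a : A)
    (f : T -> A) : Prop :=
  continuous f /\ (forall t, bp t -> f t = a).

Definition based_htpc (T A : topologicalType) (bp : T -> Prop) (a : A)
    (f g : T -> A) : Prop :=
  exists H : (T * Iu)%type -> A, continuous H /\
    (forall u (t : Iu), set_val t = 0 -> H (u, t) = f u) /\
    (forall u (t : Iu), set_val t = 1 -> H (u, t) = g u) /\
    (forall u (t : Iu), bp u -> H (u, t) = a).

Arguments based_map {T A}.
Arguments based_htpc {T A}.

Definition hclass (T A : topologicalType) (bp : T -> Prop) (a : A)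
    (f : T -> A) : set (T -> A) :=
  [set g | based_map bp a g /\ based_htpc bp a f g].

Arguments hclass {T A}.

(* carrier: the wedge point None, plus Some (i, s) = point s <> e_k of the    *)
(* i-th copy.                                                                 *)
Definition HwT (k : nat) :=
  option (nat * {s : Sph k | set_val s <> ebase k})%type.

Definition ell (k i : nat) (s : Sph k) : HwT k :=
  match pselect (set_val s <> ebase k) with
  | left H => Some (i, exist _ s H)
  | right _ => None
  end.


Definition wedge_open (k : nat) (U : set (HwT k)) : Prop :=
  (forall i, open (ell k i @^-1` U)) /\
  (U None -> exists N, forall i, (N <= i)%N -> forall s, U (ell k i s)).

HB.instance Definition _ k := gen_eqMixin (HwT k).
HB.instance Definition _ k := gen_choiceMixin (HwT k).
HB.instance Definition _ k :=
  isSubBaseTopological.Build (HwT k) (wedge_open k) id.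

Definition Hw (k : nat) : topologicalType := HwT k.
Definition Hw_bp (k : nat) (b : Hw k) : Prop := b = None.

Definition Hk (k : nat) : topologicalType :=
  match k with 0 => H0 | k'.+1 => Hw k'.+1 end.
Definition Hk_bp (k : nat) : Hk k -> Prop :=
  match k return Hk k -> Prop with
  | 0 => H0_bp
  | k'.+1 => @Hw_bp k'.+1
  end.

Definition seq_connected (m : nat) (A : topologicalType) (a : A) : Prop :=
  forall k, (k <= m)%N -> forall f g : Hk k -> A,
    based_map (@Hk_bp k) a f -> based_map (@Hk_bp k) a g ->
    based_htpc (@Hk_bp k) a f g.

Definition pin_residual (n : nat) (A : topologicalType) (a : A) : Prop :=
  forall f g : Hw n -> A,
    based_map (@Hw_bp n) a f -> based_map (@Hw_bp n) a g ->
    (forall i, based_htpc (@sph_bp n) a (f \o ell n i) (g \o ell n i)) ->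
    based_htpc (@Hw_bp n) a f g.

Definition path_in (X : topologicalType) (V : set X) (y z : X) : Prop :=
  exists gam : Iu -> X, continuous gam /\
    (forall t : Iu, set_val t = 0 -> gam t = y) /\
    (forall t : Iu, set_val t = 1 -> gam t = z) /\
    (forall t, V (gam t)).

Definition locally_path_connected (X : topologicalType) : Prop :=
  forall (x : X) (U : set X), open U -> U x ->
    exists V, [/\ open V, V x, V `<=` U &
      forall y z, V y -> V z -> path_in X V y z].

Definition covdim_le (X : topologicalType) (m : nat) : Prop :=
  forall (C : nat -> set X) (N : nat),
    (forall i, open (C i)) -> (forall x, exists2 i, (i < N)%N & C i x) ->
    exists (D : nat -> set X) (M : nat),
      [/\ forall i, open (D i),
          forall x, exists2 i, (i < M)%N & D i x,
          forall i, (i < M)%N -> exists2 j, (j < N)%N & D i `<=` C j &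
          forall (x : X) (s : seq nat), uniq s -> size s = m.+2 ->
            (forall i, i \in s -> (i < M)%N) ->
            ~ (forall i, i \in s -> D i x)].

Definition peano_continuum (X : pseudoMetricType R) : Prop :=
  [/\ hausdorff_space X, compact [set: X], connected [set: X] &
      locally_path_connected X].

Definition one_dimensional (X : topologicalType) : Prop :=
  covdim_le X 1 /\ ~ covdim_le X 0.

End Standard.

Arguments based_map {T A}.
Arguments based_htpc R {T A}.
Arguments hclass R {T A}.

(* carrier: (X + disjoint union of A_j) / (a_j ~ x_j), represented by the    *)
(* normal forms X + {j & A_j \ {a_j}}.                                       *)
Section Adj.
Variables (X : topologicalType) (A : nat -> topologicalType).
Variables (x : nat -> X) (a : forall j, A j).

Definition YT := (X + {j : nat & {c : A j | c <> a j}})%type.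

Definition iotaX (u : X) : YT := inl u.
Definition iotaY (j : nat) (c : A j) : YT :=
  match pselect (c = a j) with
  | left _ => inl (x j)
  | right H => inr (existT _ j (exist _ c H))
  end.


(* rho_k : Y -> Y_k, collapsing A_j (j >= k) to x_j; Y_k is identified with
   the image of rho_k, i.e. X together with A_0, ..., A_(k-1) *)
Definition rhoY (k : nat) (y : YT) : YT :=
  match y with
  | inl u => inl u
  | inr (existT j _) => if (j < k)%N then y else inl (x j)
  end.

Definition Ykopen (k : nat) (V : set YT) : Prop :=
  open (iotaX @^-1` V) /\ forall j, (j < k)%N -> open (iotaY j @^-1` V).

HB.instance Definition _ := gen_eqMixin YT.
HB.instance Definition _ := gen_choiceMixin YT.
(* inverse limit topology: the initial topology for all rho_k *)
HB.instance Definition _ :=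
  isSubBaseTopological.Build YT
    (fun W : set YT => exists k V, Ykopen k V /\ W = rhoY k @^-1` V) id.

Definition Adj : topologicalType := YT.
End Adj.

Section Cover.
Variable R : realType.
Variables (X : topologicalType) (A : nat -> topologicalType).
Variables (x : nat -> X) (a : forall j, A j) (y0 : X).

Local Notation Y := (Adj X A x a).

(* paths are functions R -> Y continuous on [0,1] (values off [0,1] are
   irrelevant) *)
Definition isPath (T : topologicalType) (gam : R -> T) : Prop :=
  continuous (fun t : Iu R => gam (set_val t)).

Arguments isPath {T}.

Definition concat (T : Type) (al be : R -> T) : R -> T :=
  fun t => if t <= 2^-1 then al (2 * t) else be (2 * t - 1).

Arguments concat {T}.

Definition path_htpc (al be : R -> Y) : Prop :=
  isPath al /\ isPath be /\
  exists H : R -> R -> Y,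
    continuous (fun p : (Iu R * Iu R)%type => H (set_val p.1) (set_val p.2)) /\
    (forall s, Iset R s -> H s 0 = al s /\ H s 1 = be s) /\
    (forall t, Iset R t -> H 0 t = al 0 /\ H 1 t = al 1).

Definition phclass (al : R -> Y) : set (R -> Y) := [set be | path_htpc al be].

Definition YtT :=
  {E : set (R -> Y) | exists al : R -> Y, [/\ isPath al, al 0 = (inl y0 : Y) & E = phclass al]}.

Definition whisker (al : R -> Y) (U : set Y) : set YtT :=
  [set z | exists eps : R -> Y, [/\ isPath eps, eps 0 = al 1,
      (forall t, Iset R t -> U (eps t)) &
      proj1_sig z = phclass (concat al eps)]].

HB.instance Definition _ := gen_eqMixin YtT.
HB.instance Definition _ := gen_choiceMixin YtT.
HB.instance Definition _ :=
  isSubBaseTopological.Build YtT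
    (fun W : set YtT => exists al U, [/\ isPath al, al 0 = (inl y0 : Y), open U,
        U (al 1) & W = whisker al U]) id.

Definition Ytilde : topologicalType := YtT.

Definition Yt_bp (z : Ytilde) : Prop := proj1_sig z = phclass (cst (inl y0)).

Definition ptil (z : Ytilde) : Y :=
  xget (inl y0 : Y)
    [set y | exists al : R -> Y, [/\ isPath al, proj1_sig z = phclass al & al 1 = y]].

Definition Xtilde : set Ytilde := [set z | exists u : X, ptil z = inl u].

Definition Acal (j : nat) (z : Ytilde) : set Ytilde :=
  [set w | exists al : R -> Y, [/\ isPath al, proj1_sig z = phclass al &
     exists eps : R -> A j, [/\ isPath eps, eps 0 = a j &
        proj1_sig w = phclass (concat al (@iotaY X A x a j \o eps))]]].

Definition rtil (j : nat) (z : Ytilde) (w : Ytilde) : Ytilde :=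
  if pselect (Acal j z w) then w else z.

Definition unio (j : nat) (y : Y) : A j :=
  xget (a j) [set c | @iotaY X A x a j c = y].

(* Phi~([f])(j,[al]) as an element of pi_n(A_j, a_j) (identification via p) *)
Definition Phi_comp (n : nat) (f : Sph R n -> Ytilde) (j : nat) (z : Ytilde)
    : set (Sph R n -> A j) :=
  hclass R (@sph_bp R n) (a j) (unio j \o ptil \o rtil j z \o f).

(* elements of G = prod_j prod_{[al] in p^-1(x_j)} pi_n(A_j,a_j), given as
   families g j z of homotopy classes (values off the fibres irrelevant) *)
Definition in_G (n : nat) (g : forall j, Ytilde -> set (Sph R n -> A j)) :=
  forall j z, ptil z = inl (x j) ->
    exists f, based_map (@sph_bp R n) (a j) f /\ g j z = hclass R (@sph_bp R n) (a j) f.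

Definition in_Im_Phi (n : nat) (g : forall j, Ytilde -> set (Sph R n -> A j)) :=
  exists f : Sph R n -> Ytilde,
    [/\ continuous f, (forall s, sph_bp R n s -> Yt_bp (f s)) &
        forall j z, ptil z = inl (x j) -> g j z = Phi_comp n f j z].

Definition zero_class (n j : nat) : set (Sph R n -> A j) :=
  hclass R (@sph_bp R n) (a j) (cst (a j)).

Definition supp (n : nat) (g : forall j, Ytilde -> set (Sph R n -> A j)) :
    set Ytilde :=
  [set z | exists j, ptil z = inl (x j) /\ g j z <> zero_class n j].

Definition supp_j (n : nat) (g : forall j, Ytilde -> set (Sph R n -> A j))
    (j : nat) : set Ytilde :=
  [set z | ptil z = inl (x j) /\ g j z <> zero_class n j].
End Cover.

Arguments isPath {R T}.

(* Main.v *)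
Require Import Defs.
From HB Require Import structures.
From mathcomp Require Import all_boot all_order all_algebra.
From mathcomp Require Import all_classical all_reals all_analysis.
From mathcomp Require Import subtype_topology.
From mathcomp Require Import ring lra finmap.

(** A path in Y with both ends in X is homotopic, relative to its ends, to its
    projection to X: the excursions into a fixed A_j form a map on the
    one-dimensional Hawaiian earring, which is null-homotopic because A_j is
    sequentially 1-connected. Hence the subspaces A_{j,[alpha]} are indexed
    without repetition, and near a point of the fibre over X the whisker
    topology has a countable base of uniform neighbourhoods.

    Given f : S^n -> Y~, the sets f^-1(A_{j,[alpha]} \ {[alpha]}) are open and
    pairwise disjoint for fixed j, so by compactness all but finitely many of
    them are mapped close to a_j; this gives (2). For (1), the support lies in
    the closure of the compact set f(S^n) /\ X~, and X~ is regular. Conversely,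
    compactness of the closure of the support gives a path in X~ from the base
    point which is constant, equal to the k-th point of the support, on an
    interval I_k. Composing it with the first coordinate of S^n and inserting
    the prescribed class on the slab over I_k gives the required map. *)

Import Order.TTheory GRing.Theory Num.Theory.
Import numFieldNormedType.Exports.
Local Open Scope classical_set_scope.
Local Open Scope ring_scope.

Set Implicit Arguments.
Unset Strict Implicit.
Unset Printing Implicit Defensive.

(** * Topological preliminaries *)

(** Points of the cover are handled as [ext z e], the class of a path to [z] followed by [e]. No
    lifting theorem enters: maps into the cover are defined pointwise in this form, and homotopies
    of [e] show that the choice of [e] is immaterial. An infinite support has to be visited by one
    path at pairwise disjoint times, and compactness alone provides no path. Points of $\widetilde
    X$ that are close in the whisker topology are joined by short paths, so depth-first walks
    through a binary tree of shrinking cells converge uniformly. The slabs may accumulate on the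
    sphere. Continuity at a limit of slabs rests on two kinds of smallness: for fixed [j], condition
    (2) makes all but finitely many of the inserted maps close to [a j]; for large [j], the inverse
    limit topology puts all of [A j] into a neighbourhood that contains a suitable neighbourhood of
    [x j] in [X]. Collapsing the complement of a slab is homotopic to the identity of the sphere
    relative to the base point, so every component has the prescribed class. *)

Lemma nbhs_open (T : topologicalType) (p : T) (O : set T) :
  open O -> O p -> nbhs p O.
Proof. by move=> oO Op; apply: open_nbhs_nbhs; split. Qed.

Section Subbase.
Variables (T : topologicalType) (D : set (set T)).
Hypothesis openD : forall O : set T, open O <->
  exists2 F, F `<=` finI_from D id & \bigcup_(i in F) i = O.

Lemma subbase_open B : D B -> open B.
Proof.
move=> DB; apply/openD; exists [set B]; last by rewrite bigcup_set1.
by move=> _ ->; exact: finI_from1.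
Qed.

(** A neighbourhood contains a finite intersection of subbasic sets around the point, and induction
    on that finite set applies. The adjunction space, the cover and the wedge all have their
    topology given by a subbase; their neighbourhoods are computed with this principle. *)
Lemma subbase_nbhs_ind (z : T) (P : set T -> Prop) :
  P setT -> (forall B, D B -> B z -> P B) ->
  (forall B C, P B -> P C -> P (B `&` C)) ->
  (forall B C, B `<=` C -> P B -> P C) ->
  forall O, nbhs z O -> P O.
Proof.
move=> PT PD PI PS O; rewrite nbhsE => -[V [/openD [F FD <-] [W FW Wz] VO]].
suff PW : P W by apply: PS PW => t Wt; apply: VO; exists W.
have [G GD WE] := FD _ FW; move: Wz; rewrite -WE => {WE FW V O FD F VO W}.
elim/finSet_rect: G GD => G IH GD Gz.
have [->|[B BG]] := fset_0Vmem G.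
  by apply: PS PT => t _ i /=; rewrite inE.
have -> : \bigcap_(i in [set` G]) id i =
    B `&` \bigcap_(i in [set` (G `\ B)%fset]) id i.
  rewrite predeqE => t; split=> [Gt|[Bt Gt] i /= iG].
    split; first exact: Gt.
    by move=> i /=; rewrite in_fsetD1 => /andP[_ iG]; exact: Gt.
  have [->//|iB] := eqVneq i B; apply: Gt => /=.
  by rewrite in_fsetD1 iB.
apply: PI; first by apply: PD; [exact: set_mem (GD _ BG)|exact: Gz].
apply: IH.
- by rewrite fproperD1.
- by move=> i; rewrite in_fsetD1 => /andP[_]; exact: GD.
- by move=> i /=; rewrite in_fsetD1 => /andP[_]; exact: Gz.
Qed.

Lemma subbase_continuous (S : topologicalType) (f : S -> T) :
  (forall B, D B -> open (f @^-1` B)) -> continuous f.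
Proof.
move=> fD s O.
apply: (subbase_nbhs_ind (P := fun O => nbhs s (f @^-1` O))).
- exact: filterT.
- by move=> B /fD oB Bs; apply: nbhs_open.
- by move=> B C; exact: filterI.
- by move=> B C BC; apply: filterS => t /BC.
Qed.

End Subbase.

(** * Continuity of real-valued functions, and pasting *)

Section RealContinuity.
Variables (R : realType) (T : topologicalType).
Implicit Types f g : T -> R.

Lemma contD f g : continuous f -> continuous g -> continuous (fun p => f p + g p).
Proof. by move=> cf cg p; apply: cvgD; [exact: cf|exact: cg]. Qed.

Lemma contN f : continuous f -> continuous (fun p => - f p).
Proof. by move=> cf p; apply: cvgN; exact: cf. Qed.

Lemma contM f g : continuous f -> continuous g -> continuous (fun p => f p * g p).
Proof. by move=> cf cg p; apply: cvgM; [exact: cf|exact: cg]. Qed.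

Lemma contX f k : continuous f -> continuous (fun p => f p ^+ k).
Proof.
move=> cf; elim: k => [|k IH].
  by under eq_fun do rewrite expr0; move=> p; exact: cvg_cst.
by under eq_fun do rewrite exprS; exact: contM.
Qed.

Lemma cont_min f g :
  continuous f -> continuous g -> continuous (fun p => Num.min (f p) (g p)).
Proof. by move=> cf cg p; exact: (@continuous_min R T f g p (cf p) (cg p)). Qed.

Lemma cont_max f g :
  continuous f -> continuous g -> continuous (fun p => Num.max (f p) (g p)).
Proof. by move=> cf cg p; exact: (@continuous_max R T f g p (cf p) (cg p)). Qed.

Lemma cont_cst (U : topologicalType) (u : U) : continuous (fun _ : T => u).
Proof. by move=> p; exact: cvg_cst. Qed.

Lemma cont_id : continuous (fun p : T => p).
Proof. by move=> p; exact: cvg_id. Qed.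

Lemma open_pos f : continuous f -> open [set p | 0 < f p].
Proof.
move=> cf; rewrite (_ : [set p | 0 < f p] = f @^-1` [set y | 0 < y]) //.
by move/continuousP : cf; apply; exact: open_gt.
Qed.

End RealContinuity.

Lemma cont_comp (S T U : topologicalType) (f : S -> T) (g : T -> U) :
  continuous f -> continuous g -> continuous (fun s => g (f s)).
Proof. by move=> cf cg s; apply: continuous_comp; [exact: cf|exact: cg]. Qed.

Lemma cont_fst (S T : topologicalType) : continuous (fun p : S * T => p.1).
Proof. by move=> p; exact: cvg_fst. Qed.

Lemma cont_snd (S T : topologicalType) : continuous (fun p : S * T => p.2).
Proof. by move=> p; exact: cvg_snd. Qed.

Lemma cont_pair (S T U : topologicalType) (f : S -> T) (g : S -> U) :
  continuous f -> continuous g -> continuous (fun s => (f s, g s)).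
Proof. by move=> cf cg s; apply: cvg_pair; [exact: cf|exact: cg]. Qed.

Ltac cont := repeat first
  [ assumption | exact: cont_id | exact: cont_fst | exact: cont_snd
  | exact: cont_cst
  | apply: contD | apply: contN | apply: contM | apply: contX
  | apply: cont_min | apply: cont_max | apply: cont_pair ].

(** The two closed pieces are described by one real inequality. Off the locus [c p = d p] a single
    branch is used in a whole neighbourhood; on it both branches have the same value, hence both are
    close to it. *)
Lemma paste (R : realType) (T U : topologicalType) (c d : T -> R)
    (f g : T -> U) :
  continuous c -> continuous d -> continuous f -> continuous g ->
  (forall p, c p = d p -> f p = g p) ->
  continuous (fun p => if c p <= d p then f p else g p).
Proof.
move=> cc cd cf cg fg p O nO.
suff : nbhs p [set q | O (if c q <= d q then f q else g q)] by [].
move: nO => /= nO.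
have cdc : continuous (fun p => d p - c p) by cont.
have ccd : continuous (fun p => c p - d p) by cont.
case: (ltgtP (c p) (d p)) nO => cdp nO.
- have : nbhs p [set p | 0 < d p - c p].
    by apply: nbhs_open; [exact: open_pos|rewrite /= subr_gt0].
  move=> n0; have n1 := cf p O nO; near=> q; rewrite /=.
  have : 0 < d q - c q by near: q.
  by rewrite subr_gt0 => /ltW ->; near: q.
- have : nbhs p [set p | 0 < c p - d p].
    by apply: nbhs_open; [exact: open_pos|rewrite /= subr_gt0].
  move=> n0; have n1 := cg p O nO; near=> q; rewrite /=.
  have : 0 < c q - d q by near: q.
  by rewrite subr_gt0 leNgt => ->; near: q.
- have nO' := nO; rewrite (fg _ cdp) in nO'.
  have n0 := cf p O nO; have n1 := cg p O nO'; near=> q; rewrite /=.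
  by case: ifP => _; near: q.
Unshelve. all: by end_near. Qed.

(** * Compactness in near-covering form *)

Section Compactness.

Lemma compact_fin_cover (T : topologicalType) (K : set T) (I : eqType)
    (U : I -> set T) : compact K ->
  (forall p, K p -> exists i, nbhs p (U i)) ->
  exists s : seq I, forall p, K p -> exists2 i, i \in s & U i p.
Proof.
move=> /compact_near_coveringP cK KU.
(* The filter of all sufficiently large finite lists, ordered by inclusion. *)
pose F := filter_from setT (fun s : seq I => [set s' : seq I | {subset s <= s'}]).
have FF : Filter F.
  apply: filter_from_filter; first by exists [::].
  move=> s s' _ _; exists (s ++ s') => // t st; split=> i ii; apply: st;
  by rewrite mem_cat ii ?orbT.
have [|s _ sK] := cK _ F (fun s p => exists2 i, i \in s & U i p) FF.
  move=> p Kp; have [i Ui] := KU p Kp; exists (U i, [set s : seq I | i \in s]).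
    split=> //=; exists [:: i] => // s; apply; exact: mem_head.
  by move=> [q s] /= [Uq si]; exists i.
by exists s => p Kp; apply: (sK s).
Qed.

Lemma tube (S T U : topologicalType) (K : set T) (G : S * T -> U) (V : set U)
    (s : S) : compact K -> continuous G -> open V ->
  (forall t, K t -> V (G (s, t))) ->
  \forall s' \near s, forall t, K t -> V (G (s', t)).
Proof.
move=> /compact_near_coveringP cK cG oV sV.
have := cK _ (nbhs s) (fun s' t => V (G (s', t))) _.
apply=> t /sV Vt.
have : nbhs (s, t) (G @^-1` V) by apply: cG; exact: nbhs_open.
case=> -[P Q] /= [nP nQ] PQ; exists (Q, P) => //= -[t' s'] [/= Qt Ps].
exact: (PQ (s', t')).
Qed.

End Compactness.

(** * The unit interval as a retract of the line *)

Section UnitInterval.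
Variable R : realType.

(** Paths are total functions on the line with irrelevant values off $[0,1]$. Precomposing with this
    retraction gives a representative that is continuous on the whole line, so homotopies can be
    ordinary continuous maps on [R * R]. *)
Definition clip (t : R) : R := Num.max 0 (Num.min 1 t).

Lemma cont_clip (T : topologicalType) (f : T -> R) :
  continuous f -> continuous (fun p => clip (f p)).
Proof. by move=> cf; cont. Qed.

Lemma clip01 t : 0 <= clip t <= 1.
Proof. by rewrite /clip le_max lexx /= ge_max ler01 ge_min lexx. Qed.

Lemma clip_id t : 0 <= t <= 1 -> clip t = t.
Proof. by move=> /andP[t0 t1]; rewrite /clip min_r // max_r. Qed.

Lemma clip_le0 t : t <= 0 -> clip t = 0.
Proof. by move=> t0; rewrite /clip min_r ?max_l //; lra. Qed.

Lemma clip_ge1 t : 1 <= t -> clip t = 1.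
Proof. by move=> t0; rewrite /clip min_l ?max_r //; lra. Qed.

Lemma compact01 : compact [set t : R | 0 <= t <= 1].
Proof.
rewrite (_ : [set t : R | _] = `[0, 1]%classic); first exact: segment_compact.
by rewrite predeqE => t /=; rewrite in_itv.
Qed.

Lemma Iset_mem (t : R) : 0 <= t <= 1 -> t \in Iset R.
Proof. by move=> h; exact: mem_set. Qed.

Definition toI (t : R) : Iu R := exist _ (clip t) (Iset_mem (clip01 t)).

Lemma toIE t : set_val (toI t) = clip t.
Proof. by []. Qed.

Lemma set_val_cont (T : topologicalType) (B : set T) :
  continuous (set_val : set_type B -> T).
Proof. exact: (@initial_continuous _ _ (set_val : set_type B -> T)). Qed.

Lemma set_type_cont (S T : topologicalType) (B : set T) (f : S -> set_type B) :
  continuous (fun s => set_val (f s)) -> continuous f.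
Proof. exact: (@continuous_comp_initial _ _ _ (set_val : set_type B -> T)). Qed.

Lemma toI_cont : continuous toI.
Proof. by apply: set_type_cont; apply: (@cont_clip R id); exact: cont_id. Qed.

Lemma IuP (t : Iu R) : 0 <= set_val t <= 1.
Proof. by have := set_mem (valP t). Qed.

Lemma isPathP (T : topologicalType) (al : R -> T) :
  isPath al <-> continuous (al \o clip).
Proof.
split=> [cal|cal].
  by apply: (cont_comp (f := @toI) (g := fun t : Iu R => al (set_val t))) => //;
    exact: toI_cont.
rewrite /isPath.
have -> : (fun t : Iu R => al (set_val t)) = (fun t => (al \o clip) (set_val t)).
  by apply/funext => t /=; rewrite clip_id // IuP.
by apply: cont_comp => //; exact: set_val_cont.
Qed.

End UnitInterval.

(** * Path homotopies *)

Section Paths.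
Variable R : realType.
Local Notation clip := (@clip R).
Local Notation concat := (@Defs.concat R _).

Definition revp (T : Type) (al : R -> T) : R -> T := fun t => al (1 - t).

Definition phom (T : topologicalType) (al be : R -> T) := exists H : R * R -> T,
  [/\ continuous H,
      forall s, H (s, 0) = al (clip s) /\ H (s, 1) = be (clip s) &
      forall t, H (0, t) = al 0 /\ H (1, t) = al 1].

Lemma clip0 : clip 0 = 0. Proof. by rewrite clip_id // lexx ler01. Qed.
Lemma clip1 : clip 1 = 1. Proof. by rewrite clip_id // lexx ler01. Qed.

Lemma concat0 (T : Type) (al be : R -> T) : concat al be 0 = al 0.
Proof. by rewrite /concat mulr0 invr_ge0 ler0n. Qed.

Lemma concat1 (T : Type) (al be : R -> T) : concat al be 1 = be 1.
Proof.
rewrite /concat ifF; first by congr be; lra.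
by apply/negbTE; rewrite -ltNge; lra.
Qed.

Lemma clipL s : s <= 2^-1 -> clip (2 * s) = 2 * clip s /\ clip s <= 2^-1.
Proof.
move=> s2; have [s0|s0] := leP s 0; first by rewrite !clip_le0; lra.
by rewrite !clip_id; lra.
Qed.

Lemma clipR s : 2^-1 < s -> clip (2 * s - 1) = 2 * clip s - 1 /\ 2^-1 < clip s.
Proof.
move=> s2; have [s0|s0] := leP 1 s; first by rewrite !clip_ge1; lra.
by rewrite !clip_id; lra.
Qed.

Lemma clip_clip t : clip (clip t) = clip t.
Proof. by rewrite clip_id // clip01. Qed.

Lemma concat_clip (T : Type) (al be : R -> T) s :
  concat al be (clip s) = if s <= 2^-1 then al (clip (2 * s)) else be (clip (2 * s - 1)).
Proof.
rewrite /Defs.concat; have [s2|s2] := leP s 2^-1.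
  by have [-> ->] := clipL s2.
by have [-> h] := clipR s2; rewrite ifF //; apply/negbTE; rewrite -ltNge.
Qed.

Lemma concat_cont (T : topologicalType) (al be : R -> T) :
  continuous al -> continuous be -> al 1 = be 0 -> continuous (concat al be).
Proof.
move=> ca cb ab; apply: paste.
- by cont.
- by cont.
- by apply: cont_comp => //; cont.
- by apply: cont_comp => //; cont.
- by move=> p ->; rewrite mulfV ?subrr ?pnatr_eq0.
Qed.

Lemma concat_comp (T U : Type) (f : T -> U) (al be : R -> T) :
  f \o concat al be = concat (f \o al) (f \o be).
Proof. by apply/funext => t; rewrite /Defs.concat /=; case: ifP. Qed.

Lemma revp_cont (T : topologicalType) (al : R -> T) :
  continuous al -> continuous (revp al).
Proof. by move=> ca; apply: cont_comp => //; cont. Qed.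

Variable T : topologicalType.
Implicit Types al be ga : R -> T.

Lemma phom_cont al be : phom al be -> continuous (al \o clip).
Proof.
case=> H [cH H01 _].
have -> : al \o clip = fun s => H (s, 0).
  by apply/funext => s; have [-> _] := H01 s.
by apply: cont_comp => //; cont.
Qed.

Lemma phom_ends al be : phom al be -> al 0 = be 0 /\ al 1 = be 1.
Proof.
case=> H [cH H01 He]; have [h0 h1] := He 1; rewrite -h0 -h1.
by have [_ ->] := H01 0; have [_ ->] := H01 1; rewrite clip0 clip1.
Qed.

(** The straight-line homotopy from [phi] to [psi] in the parameter line does it. As [al] is
    continuous on the whole line, [phi] and [psi] may leave $[0,1]$. *)
Lemma phom_reparam al (phi psi : R -> R) :
  continuous al -> continuous phi -> continuous psi ->
  phi 0 = psi 0 -> phi 1 = psi 1 -> phom (al \o phi) (al \o psi).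
Proof.
move=> ca cf cg e0 e1.
exists (fun p => al ((1 - p.2) * phi (clip p.1) + p.2 * psi (clip p.1))); split.
- apply: (cont_comp _ ca); apply: contD; apply: contM; cont.
    by apply: cont_comp => //; apply: cont_clip; cont.
  by apply: cont_comp => //; apply: cont_clip; cont.
- by move=> s /=; split; congr al; ring.
- by move=> t /=; rewrite clip0 clip1 -e0 -e1; split; congr al; ring.
Qed.

Lemma phom_eqI al be : continuous al ->
  (forall s, 0 <= s <= 1 -> al s = be s) -> phom al be.
Proof.
move=> ca ab; exists (fun p => al (clip p.1)); split.
- by apply: cont_comp => //; apply: cont_clip; cont.
- by move=> s /=; split=> //; rewrite ab // clip01.
- by move=> t /=; rewrite clip0 clip1.
Qed.

Lemma phom_refl al : continuous al -> phom al al.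
Proof. by move=> ca; exact: phom_eqI. Qed.

Lemma phom_sym al be : phom al be -> phom be al.
Proof.
move=> ab; have [e0 e1] := phom_ends ab.
case: ab => H [cH H01 He]; exists (fun p => H (p.1, 1 - p.2)); split.
- by apply: cont_comp => //; cont.
- by move=> s /=; rewrite subr0 subrr; have [] := H01 s.
- by move=> t /=; rewrite -e0 -e1; exact: He.
Qed.

Lemma phom_trans al be ga : phom al be -> phom be ga -> phom al ga.
Proof.
move=> ab; have [e0 e1] := phom_ends ab.
case: ab => H [cH H01 He] [K [cK K01 Ke]].
exists (fun p => if p.2 <= 2^-1 then H (p.1, 2 * p.2) else K (p.1, 2 * p.2 - 1)).
split.
- apply: paste.
  + by cont.
  + by cont.
  + by apply: cont_comp => //; cont.
  + by apply: cont_comp => //; cont.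
  + move=> [s t] /= ->; rewrite mulfV ?pnatr_eq0 // subrr.
    by have [_ ->] := H01 s; have [-> _] := K01 s.
- move=> s /=; split.
    by rewrite mulr0 invr_ge0 ler0n; have [] := H01 s.
  rewrite ifF; last by apply/negbTE; rewrite -ltNge; lra.
  by rewrite (_ : 2 * 1 - 1 = 1); [have [] := K01 s|lra].
- by move=> t /=; case: ifP => _; [exact: He|rewrite e0 e1; exact: Ke].
Qed.

Lemma phom_concat al al' be be' :
  phom al al' -> phom be be' -> al 1 = be 0 -> phom (concat al be) (concat al' be').
Proof.
case=> H [cH H01 He] [K [cK K01 Ke]] ab.
exists (fun p => if p.1 <= 2^-1 then H (2 * p.1, p.2) else K (2 * p.1 - 1, p.2)).
split.
- apply: paste.
  + by cont.
  + by cont.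
  + by apply: cont_comp => //; cont.
  + by apply: cont_comp => //; cont.
  + move=> [s t] /= ->; rewrite mulfV ?pnatr_eq0 // subrr.
    by have [_ ->] := He t; have [-> _] := Ke t.
- move=> s /=; rewrite !concat_clip; case: ifP => _.
    exact: H01.
  exact: K01.
- move=> t /=; rewrite mulr0 invr_ge0 ler0n concat0 concat1.
  rewrite ifF; last by apply/negbTE; rewrite -ltNge; lra.
  rewrite (_ : 2 * 1 - 1 = 1); last by lra.
  by have [-> _] := He t; have [_ ->] := Ke t.
Qed.

Lemma phom_concatA al be ga :
  continuous al -> continuous be -> continuous ga -> al 1 = be 0 -> be 1 = ga 0 ->
  phom (concat (concat al be) ga) (concat al (concat be ga)).
Proof.
move=> ca cb cg ab bg.
have cbg : continuous (concat be ga) by exact: concat_cont.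
have c3 : continuous (concat al (concat be ga)).
  by apply: concat_cont => //; rewrite concat0.
(* Pieces of lengths 1/4, 1/4, 1/2 are rescaled to lengths 1/2, 1/4, 1/4 by the slopes 2, 1, 1/2;
   the slopes decrease, so the reparametrization is a minimum of three lines. *)
pose phi (s : R) := Num.min (2 * s) (Num.min (s + 4^-1) ((s + 1) / 2)).
have := @phom_reparam (concat al (concat be ga)) phi id c3.
have -> : concat al (concat be ga) \o id = concat al (concat be ga) by [].
move=> h; apply: phom_trans; last first.
  apply: h.
  - by rewrite /phi; cont.
  - exact: cont_id.
  - by rewrite /phi mulr0 min_l // le_min; apply/andP; split; lra.
  - rewrite /phi min_r; last by rewrite ge_min; apply/orP; left; lra.
    by rewrite min_r; lra.
apply: phom_eqI.
  by apply: concat_cont => //; [exact: concat_cont|rewrite concat1].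
move=> s /andP[s0 s1]; rewrite /= /phi /Defs.concat.
have [s2|s2] := leP s 2^-1.
  have [s4|s4] := leP (2 * s) 2^-1.
    rewrite min_l; last by rewrite le_min; apply/andP; split; lra.
    by rewrite s4.
  rewrite min_r; last by rewrite ge_min; apply/orP; left; lra.
  rewrite min_l; last by lra.
  rewrite ifF; last by apply/negbTE; rewrite -ltNge; lra.
  rewrite ifT; last by lra.
  by congr be; lra.
rewrite min_r; last by rewrite ge_min; apply/orP; left; lra.
rewrite min_r; last by lra.
rewrite ifF; last by apply/negbTE; rewrite -ltNge; lra.
rewrite ifF; last by apply/negbTE; rewrite -ltNge; lra.
by congr ga; lra.
Qed.

Lemma phom_concat_cst al : continuous al -> phom (concat al (cst (al 1))) al.
Proof.
move=> ca; have := @phom_reparam al (fun s : R => Num.min (2 * s) 1) id ca.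
move=> h; apply: phom_trans; last first.
  apply: h.
  - by cont.
  - exact: cont_id.
  - by rewrite mulr0 min_l.
  - by rewrite mulr1 min_r //; lra.
apply: phom_eqI; first by apply: concat_cont => //; exact: cont_cst.
move=> s /andP[s0 s1]; rewrite /= /Defs.concat; have [s2|s2] := leP s 2^-1.
  by rewrite min_l //; lra.
by rewrite min_r //; lra.
Qed.

Lemma phom_concat_revp al : continuous al -> phom (concat al (revp al)) (cst (al 0)).
Proof.
move=> ca.
have := @phom_reparam al (fun s : R => Num.min (2 * s) (2 - 2 * s)) (cst 0) ca.
move=> h; apply: phom_trans; last first.
  apply: h.
  - by cont.
  - exact: cont_cst.
  - by rewrite mulr0 min_l //; lra.
  - by rewrite mulr1 subrr min_r.
apply: phom_eqI.
  by apply: concat_cont => //; [exact: revp_cont|rewrite /revp subr0].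
move=> s /andP[s0 s1]; rewrite /= /Defs.concat; have [s2|s2] := leP s 2^-1.
  by rewrite min_l //; lra.
by rewrite min_r /revp; [congr al|]; lra.
Qed.

Lemma phom_split al (c : R) : continuous al ->
  phom (concat (fun u => al (c * u)) (fun u => al (c + (1 - c) * u))) al.
Proof.
move=> ca; pose phi := concat (fun u => c * u) (fun u => c + (1 - c) * u).
have cphi : continuous phi by apply: concat_cont; cont; ring.
have -> : concat (fun u => al (c * u)) (fun u => al (c + (1 - c) * u)) = al \o phi.
  by rewrite /phi concat_comp.
rewrite -[X in phom _ X]/(al \o id).
apply: phom_reparam => //; first exact: cont_id.
  by rewrite /phi concat0 mulr0.
by rewrite /phi concat1; ring.
Qed.

End Paths.

(** * The adjunction space *)

Arguments rhoY : simpl never.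

Section AdjunctionSpace.
Variables (X : topologicalType) (A : nat -> topologicalType).
Variables (x : nat -> X) (a : forall j, A j).
Hypothesis hX : hausdorff_space X.
Hypothesis hA : forall j, hausdorff_space (A j).
Local Notation Y := (Adj X A x a).

Definition inX (u : X) : Y := iotaX X A a u.
Definition inA (j : nat) (c : A j) : Y := iotaY X A x a j c.
Arguments inA : clear implicits.
Definition pX (y : Y) : X :=
  match (y : YT X A a) with inl u => u | inr (existT j _) => x j end.
Local Notation uA j := (unio X A x a j).

Lemma openY (O : set Y) : open O <->
  exists2 F, F `<=` finI_from
    [set W : set Y | exists k V, Ykopen X A x a k V /\ W = rhoY X A x a k @^-1` V] id
    & \bigcup_(i in F) i = O.
Proof. by split; exact. Qed.

Lemma T1_open (T : topologicalType) (p : T) : hausdorff_space T -> open [set q | q <> p].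
Proof.
move=> hT; have := @accessible_closed_set1 T (hausdorff_accessible hT) p.
by move=> /closed_openC; congr open.
Qed.

Lemma inA_bp j : inA j (a j) = inX (x j).
Proof. by rewrite /inA /iotaY; case: pselect. Qed.

Lemma pX_inA j c : pX (inA j c) = x j.
Proof. by rewrite /inA /iotaY; case: pselect. Qed.

Lemma inX_inj u v : inX u = inX v -> u = v.
Proof. by case. Qed.

Lemma Y_case (y : Y) :
  (exists u, y = inX u) \/ exists j c, c <> a j /\ y = inA j c.
Proof.
case: y => [u|[j [c cn]]]; first by left; exists u.
right; exists j, c; split=> //; rewrite /inA /iotaY; case: pselect => // cn'.
by rewrite (Prop_irrelevance cn cn').
Qed.

Lemma inA_inX j c u : inA j c = inX u -> c = a j /\ u = x j.
Proof. by rewrite /inA /iotaY; case: pselect => // ca [->]. Qed.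

Lemma inA_inA j j' c c' : inA j c = inA j' c' -> c <> a j -> j = j' /\ c' <> a j'.
Proof.
rewrite /inA /iotaY; case: pselect => // cn; case: pselect => // c'n.
by case=> e _ _; split.
Qed.

Lemma inA_inj j : injective (inA j).
Proof.
move=> c c'; rewrite /inA /iotaY; case: pselect => [->|cn].
  by case: pselect => [->|].
case: pselect => // c'n [] e.
by have := eq_from_Tagged e.
Qed.

Lemma uA_inA j c : uA j (inA j c) = c.
Proof.
rewrite /unio; case: xgetP => [c' _ /inA_inj //|/(_ c)]; by case.
Qed.

Lemma uA_notin j y : (forall c, inA j c <> y) -> uA j y = a j.
Proof. by move=> h; rewrite /unio; case: xgetP => // c' _ /h. Qed.

Lemma uA_inX j u : uA j (inX u) = a j.
Proof.
have [->|n] := pselect (u = x j); first by rewrite -inA_bp uA_inA.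
by apply: uA_notin => c /inA_inX [_ /n].
Qed.

Lemma uA_inA' j j' c : j <> j' -> uA j (inA j' c) = a j.
Proof.
move=> jj'; have [->|n] := pselect (c = a j'); first by rewrite inA_bp uA_inX.
by apply: uA_notin => c' /esym h; case: (inA_inA h n) => /esym/jj'.
Qed.

Lemma uA_neq j y : uA j y <> a j -> inA j (uA j y) = y.
Proof.
move=> h; have [[c <-]|n] := pselect (exists c, inA j c = y); first by rewrite uA_inA.
by case: h; apply: uA_notin => c e; apply: n; exists c.
Qed.

Lemma rhoY_inX k u : rhoY X A x a k (inX u) = inX u.
Proof. by []. Qed.

Lemma rhoY_lt k j c : (j < k)%N -> rhoY X A x a k (inA j c) = inA j c.
Proof. by rewrite /rhoY /inA /iotaY; case: pselect => //= n ->. Qed.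

Lemma rhoY_ge k j c : (k <= j)%N -> rhoY X A x a k (inA j c) = inX (x j).
Proof. by rewrite /rhoY /inA /iotaY; case: pselect => //= n; rewrite ltnNge => ->. Qed.

Lemma subY k V : Ykopen X A x a k V -> open (rhoY X A x a k @^-1` V : set Y).
Proof. by move=> kV; apply: (subbase_open openY); exists k, V. Qed.

Lemma Y_continuous (S : topologicalType) (f : S -> Y) :
  (forall k V, Ykopen X A x a k V -> open (f @^-1` (rhoY X A x a k @^-1` V))) ->
  continuous f.
Proof.
by move=> h; apply: (subbase_continuous openY) => _ [k [V [kV ->]]]; exact: h.
Qed.

Lemma inX_cont : continuous inX.
Proof. by apply: Y_continuous => k V [oV _]. Qed.

Lemma inA_cont j : continuous (inA j).
Proof.
apply: Y_continuous => k V [oV oA]; have [jk|kj] := ltnP j k.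
  rewrite (_ : _ @^-1` _ = iotaY X A x a j @^-1` V); first exact: oA.
  by rewrite predeqE => c /=; rewrite rhoY_lt.
have [Vx|Vx] := pselect (V (inX (x j))).
  rewrite (_ : _ @^-1` _ = setT); first exact: openT.
  by rewrite predeqE => c /=; rewrite rhoY_ge.
rewrite (_ : _ @^-1` _ = set0); first exact: open0.
by rewrite predeqE => c /=; rewrite rhoY_ge.
Qed.

Lemma pX_cont : continuous pX.
Proof.
apply/continuousP => O oO.
rewrite (_ : pX @^-1` O = rhoY X A x a 0 @^-1` (pX @^-1` O)).
  by apply: subY; split.
by rewrite predeqE => -[u|[j c]].
Qed.

(** The last clause reflects the inverse limit: a subbasic set pulled back along [rhoY k] sees [A j]
    with [k <= j] only through [x j], hence contains all of it as soon as it contains [x j]. *)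
Lemma nbhs_inX u W : nbhs (inX u) W ->
  [/\ nbhs u (inX @^-1` W), forall j, x j = u -> nbhs (a j) (inA j @^-1` W) &
      exists k V, nbhs u V /\ forall j, (k <= j)%N -> V (x j) -> forall c, W (inA j c)].
Proof.
move=> nW; split.
- exact: inX_cont.
- by move=> j xj; apply: inA_cont; rewrite inA_bp xj.
move: W nW; pose P (W : set Y) := exists k V, nbhs u V /\
    forall j, (k <= j)%N -> V (x j) -> forall c, W (inA j c).
apply: (@subbase_nbhs_ind _ _ openY _ P).
- by exists 0%N, setT; split=> //; exact: filterT.
- move=> _ [k [V [[oV _] ->]]] /= Vu; exists k, (inX @^-1` V); split.
    exact: nbhs_open.
  by move=> j kj Vx c /=; rewrite rhoY_ge.
- move=> B C [k [V [nV VB]]] [k' [V' [nV' VC]]].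
  exists (maxn k k'), (V `&` V'); split; first exact: filterI.
  move=> j; rewrite geq_max => /andP[kj k'j] [? ?] c; split.
    exact: VB.
  exact: VC.
- by move=> B C BC [k [V [nV VB]]]; exists k, V; split=> // j ? ? c; exact/BC/VB.
Qed.

(** Converse of the previous description. Only the finitely many [A j] with [j < k] need individual
    care; those attached elsewhere than at [u] are avoided by shrinking around [u], since points of
    [X] are closed. *)
Lemma nbhs_inXI u W :
  nbhs u (inX @^-1` W) -> (forall j, x j = u -> nbhs (a j) (inA j @^-1` W)) ->
  (exists k V, nbhs u V /\ forall j, (k <= j)%N -> V (x j) -> forall c, W (inA j c)) ->
  nbhs (inX u) W.
Proof.
move=> n1 n2 [k [V0 [nV0 V0W]]].
pose N i := [set v : X | x i <> u -> v <> x i].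
have oN i : open (N i).
  have [e|e] := pselect (x i = u).
    rewrite (_ : N i = setT); first exact: openT.
    by rewrite predeqE => v; split=> // _ /(_ e).
  rewrite (_ : N i = [set v | v <> x i]); first exact: T1_open.
  by rewrite predeqE => v; split=> [/(_ e)|h _].
have [VX [oVX VXu VXW VX0 VXN]] : exists VX, [/\ open VX, VX u,
    VX `<=` inX @^-1` W, VX `<=` V0 & forall j, (j < k)%N -> x j <> u -> ~ VX (x j)].
  exists ((inX @^-1` W)^° `&` (V0^° `&` \big[setI/setT]_(i < k) N i)); split.
  - apply: openI; first exact: open_interior.
    apply: openI; first exact: open_interior.
    by elim/big_ind: _ => [|? ?|i _]; [exact: openT|exact: openI|exact: oN].
  - split; first exact: n1.
    split; first exact: nV0.
    by elim/big_ind: _ => [//|? ?|i _ h /esym]; [split|exact: h].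
  - by move=> v [/interior_subset].
  - by move=> v [_ [/interior_subset]].
  - move=> j jk xju [_ [_]]; rewrite (bigD1 (Ordinal jk)) //= => -[/(_ xju)] /=.
    by case.
(* [V] consists of [VX] and of the interior of the trace of [W] on each [A j] attached at [u]. The
   other [A j] with [j < k] do not meet it, because [VX] avoids their attaching points. *)
pose V : set Y := [set y | (exists2 v, y = inX v & VX v) \/
  exists j c, [/\ y = inA j c, x j = u & (inA j @^-1` W)^° c]].
have kV : Ykopen X A x a k V.
  split.
    rewrite (_ : iotaX X A a @^-1` V = VX) // predeqE => v; split; last first.
      by move=> Vv; left; exists v.
    case=> [[v' /inX_inj -> //]|[j [c [/esym/inA_inX [_ ->] -> _]]]] //.
  move=> j jk; have [xju|xju] := pselect (x j = u).
    rewrite (_ : _ @^-1` _ = (inA j @^-1` W)^°); first exact: open_interior.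
    rewrite predeqE => c; split; last by move=> ?; right; exists j, c.
    case=> [[v /inA_inX [-> _] _]|[j' [c' [e xj' Wc']]]]; first exact: n2.
    have [->|cn] := pselect (c = a j); first exact: n2.
    by have [jj' _] := inA_inA e cn; subst j'; move/inA_inj : e => ->.
  rewrite (_ : _ @^-1` _ = set0); first exact: open0.
  rewrite predeqE => c; split=> //.
  case=> [[v /inA_inX [_ ->]]|[j' [c' [e xj' Wc']]]]; first exact: VXN.
  have [ca|cn] := pselect (c = a j).
    move: e; rewrite ca -/(inA j (a j)) inA_bp => /esym/inA_inX [_ e].
    by rewrite e in xju.
  by have [jj' _] := inA_inA e cn; subst j'.
have : nbhs (inX u) (rhoY X A x a k @^-1` V : set Y).
  by apply: nbhs_open; [exact: subY|left; exists u].
apply: filterS => y; case: (Y_case y) => [[v ->]|[j [c [cn ->]]]] /=.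
  rewrite rhoY_inX => -[[v' /inX_inj -> /VXW //]|[j [c [/esym/inA_inX [_ ->]]]]].
  by move=> -> _; exact: VXW.
have [jk|kj] := ltnP j k.
  rewrite rhoY_lt // => -[[v /inA_inX [] //]|[j' [c' [e xj' Wc']]]].
  by have [jj' _] := inA_inA e cn; subst j'; move/inA_inj : e => ->; exact: interior_subset Wc'.
rewrite rhoY_ge // => h; apply: V0W => //; case: h.
  by case=> v /inX_inj -> /VX0.
by case=> j' [c' [/esym/inA_inX [_ ->] -> _]]; exact: VX0.
Qed.

Lemma open_inA j (O : set (A j)) : open O -> ~ O (a j) -> open (inA j @` O).
Proof.
move=> oO Oa; rewrite (_ : _ @` _ = rhoY X A x a j.+1 @^-1` (inA j @` O)).
  apply: subY; split.
    rewrite (_ : _ @^-1` _ = set0); first exact: open0.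
    by rewrite predeqE => v; split=> // -[c Oc /inA_inX [ca _]]; apply: Oa; rewrite -ca.
  move=> j' _; have [<-|jj'] := pselect (j = j').
    rewrite (_ : _ @^-1` _ = O) // predeqE => c.
    by split=> [[c' Oc' /inA_inj <-]|Oc] //; exists c.
  rewrite (_ : _ @^-1` _ = set0); first exact: open0.
  rewrite predeqE => c; split=> // -[c' Oc' e].
  have [ca|cn] := pselect (c' = a j); first by apply: Oa; rewrite -ca.
  by case: (inA_inA e cn).
rewrite predeqE => y; split=> [[c Oc <-]|[c Oc]] /=.
  by exists c; rewrite ?rhoY_lt.
have cn : c <> a j by move=> ca; apply: Oa; rewrite -ca.
case: (Y_case y) => [[v ->]|[j' [c' [c'n ->]]]].
  by rewrite rhoY_inX => /inA_inX [].
have [jk|kj] := ltnP j' j.+1.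
  by rewrite rhoY_lt // => <-; exists c.
by rewrite rhoY_ge // => /inA_inX [].
Qed.

Lemma nbhs_inA j c W : c <> a j -> nbhs c (inA j @^-1` W) -> nbhs (inA j c) W.
Proof.
move=> cn; rewrite nbhsE => -[V [oO Oc] OW].
have := @open_inA j (V `&` [set q | q <> a j]).
move=> h; apply: (@filterS _ _ _ (inA j @` (V `&` [set q | q <> a j]))).
  by move=> _ [c' [Oc' _] <-]; exact: OW.
apply: nbhs_open; last by exists c.
by apply: h => [|[_]//]; apply: openI => //; exact: T1_open.
Qed.

(** [uA j] is the retraction onto [A j] that collapses everything else to [a j]. At a point of [X]
    the tail clause of [nbhs_inXI] holds from [j.+1] on, as every later space is collapsed. *)
Lemma uA_cont j : continuous (uA j).
Proof.
move=> y V; case: (Y_case y) => [[u ->]|[j' [c [cn ->]]]].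
  rewrite uA_inX => nV; apply: nbhs_inXI.
  - apply: nearW => v; rewrite /= uA_inX; exact: nbhs_singleton.
  - move=> j' _; have [<-|jj'] := pselect (j = j').
      by apply: filterS nV => c /=; rewrite uA_inA.
    by apply: nearW => v; rewrite /= uA_inA' //; exact: nbhs_singleton.
  - exists j.+1, setT; split; first exact: filterT.
    move=> j' jj' _ c /=; rewrite uA_inA'; first exact: nbhs_singleton.
    by move=> e; rewrite e ltnn in jj'.
have [jj'|jj'] := pselect (j = j').
  subst j'; rewrite uA_inA => nV; apply: nbhs_inA => //.
  by apply: filterS nV => c' /=; rewrite uA_inA.
rewrite uA_inA' // => nV; apply: nbhs_inA => //.
by apply: nearW => v; rewrite /= uA_inA' //; exact: nbhs_singleton.
Qed.

Definition UA j : set Y := [set y | uA j y <> a j].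

Lemma UA_open j : open (UA j).
Proof.
exact: (iffLR (continuousP _) (@uA_cont j) _ (@T1_open _ (a j) (@hA j))).
Qed.

Lemma UA_inA j c : c <> a j -> UA j (inA j c).
Proof. by move=> cn; rewrite /UA /= uA_inA. Qed.

Lemma UA_inX j u : ~ UA j (inX u).
Proof. by rewrite /UA /= uA_inX. Qed.

Lemma UA_UA j j' y : UA j y -> UA j' y -> j = j'.
Proof.
move=> U U'; apply: contrapT => jj'; apply: U'.
by rewrite -(uA_neq U) uA_inA' // => /esym.
Qed.

Lemma notUA y : (forall j, ~ UA j y) -> y = inX (pX y).
Proof.
case: (Y_case y) => [[u ->] //|[j [c [cn ->]]]] /(_ j); case; exact: UA_inA.
Qed.

(** Elsewhere in [X] the projection [pX] separates the point from [x j], and the other open sets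
    [UA j'] are disjoint from [UA j]. Hence a path can enter $A_j\setminus\{a_j\}$ only through
    [x j]. *)
Lemma closure_UA j y : closure (UA j) y -> ~ UA j y -> y = inX (x j).
Proof.
move=> cy ny; case: (Y_case y) => [[u e]|[j' [c [cn e]]]]; subst y.
  apply: contrapT => nu; have ux : u <> x j by move=> e; apply: nu; rewrite e.
  have [|z [/uA_neq <- /=]] := cy (pX @^-1` [set v | v <> x j]).
    apply: nbhs_open => //; exact: (iffLR (continuousP _) pX_cont _ (@T1_open _ (x j) hX)).
  by rewrite pX_inA.
have [|z [/[dup] Uz /uA_neq e /=]] := cy (UA j').
  by apply: nbhs_open; [exact: UA_open|exact: UA_inA].
by move=> Uz'; case: ny; rewrite (UA_UA Uz Uz'); exact: UA_inA.
Qed.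

Lemma inA_uA j y : closure (UA j) y -> inA j (uA j y) = y.
Proof.
have [Uy _|Uy cy] := pselect (UA j y); first exact: uA_neq.
by rewrite (closure_UA cy Uy) uA_inX inA_bp.
Qed.

End AdjunctionSpace.
Arguments inA {X A x a}.
Arguments inX {X A x a}.

(** * Whiskers *)

Section Cover.
Variable R : realType.
Variables (X : topologicalType) (A : nat -> topologicalType).
Variables (x : nat -> X) (a : forall j, A j) (y0 : X).
Local Notation Y := (Adj X A x a).
Local Notation Yt := (Ytilde R X A x a y0).
Local Notation phclass := (phclass R X A x a).
Local Notation concat := (@Defs.concat R _).
Local Notation ptil := (ptil R X A x a y0).
Local Notation whisker := (whisker R X A x a y0).
Local Notation clip := (@clip R).
Implicit Types (al be e d : R -> Y) (z w : Yt) (U : set Y).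

Lemma path_htpcP al be : path_htpc R X A x a al be <-> phom al be.
Proof.
split=> [[_ [_ [H [cH [H01 He]]]]]|h].
  exists (fun p => H (clip p.1) (clip p.2)); split.
  - apply: (cont_comp (f := fun p : R * R => (toI p.1, toI p.2))) cH.
    by apply: cont_pair; apply: cont_comp; first [exact: toI_cont | cont].
  - move=> s /=; rewrite clip0 clip1; exact: H01 (clip01 s).
  - move=> t /=; rewrite clip0 clip1; exact: He (clip01 t).
split; first exact/isPathP/(phom_cont h).
split; first exact/isPathP/(phom_cont (phom_sym h)).
case: h => H [cH H01 He]; exists (fun s t => H (s, t)); split.
2: split.
- apply: (cont_comp (f := fun p : Iu R * Iu R => (set_val p.1, set_val p.2))) cH.
  by apply: cont_pair; apply: cont_comp; first [exact: set_val_cont | cont].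
- by move=> s sI; have := H01 s; rewrite (clip_id sI).
- by move=> t _; exact: He.
Qed.

(** One of the functions must be a path: all functions that are not paths have the same, empty,
    class. *)
Lemma phclassP al be : isPath al -> phclass al = phclass be <-> phom al be.
Proof.
move=> pal; have haa : phom al al.
  have /isPathP ca := pal; apply: (@phom_trans _ _ _ (al \o clip)).
    apply: phom_sym; apply: phom_eqI => // s s01.
    by rewrite /= clip_id.
  by apply: phom_eqI => // s s01; rewrite /= clip_id.
split=> [e|h]; last first.
  rewrite predeqE => ga; split=> /path_htpcP h'; apply/path_htpcP.
    exact: phom_trans (phom_sym h) h'.
  exact: phom_trans h h'.
have : phclass al al by apply/path_htpcP.
by rewrite e => /path_htpcP/phom_sym.
Qed.

Lemma phom_clip al : isPath al -> phom al (al \o clip).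
Proof.
move=> /isPathP ca; apply: phom_sym; apply: phom_eqI => // s s01.
by rewrite /= clip_id.
Qed.

Lemma Yt_eq z w : proj1_sig z = proj1_sig w -> z = w.
Proof. by case: z w => [E hE] [F hF] /= e; subst F; rewrite (Prop_irrelevance hE hF). Qed.

Lemma Yt_rep z : exists al,
  [/\ continuous al, al 0 = inX y0 & proj1_sig z = phclass al].
Proof.
case: z => E [al [pal al0 e]]; exists (al \o clip); split.
- exact/isPathP.
- by rewrite /= clip0.
- by rewrite /= e; apply/phclassP => //; exact: phom_clip.
Qed.

Definition rep z : R -> Y := sval (cid (Yt_rep z)).

Lemma rep_cont z : continuous (rep z).
Proof. by rewrite /rep; case: cid => al []. Qed.

Lemma rep0 z : rep z 0 = inX y0.
Proof. by rewrite /rep; case: cid => al []. Qed.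

Lemma repE z : proj1_sig z = phclass (rep z).
Proof. by rewrite /rep; case: cid => al []. Qed.

Lemma isPath_cont al : continuous al -> isPath al.
Proof. by move=> ca; apply/isPathP; apply: cont_comp => //; apply: cont_clip; cont. Qed.

Lemma ptilE z al : isPath al -> proj1_sig z = phclass al -> ptil z = al 1.
Proof.
move=> pal e; rewrite /Defs.ptil; case: xgetP.
  move=> y _ [be [pbe e' <-]]; have /phclassP : phclass al = phclass be by rewrite -e.
  by move=> /(_ pal)/phom_ends[].
by move=> /(_ (al 1)); case; exists al.
Qed.

Lemma rep1 z : rep z 1 = ptil z.
Proof. by rewrite (ptilE (isPath_cont (@rep_cont z)) (repE z)). Qed.

Definition cls al : Yt :=
  match pselect (isPath al /\ al 0 = inX y0) with
  | left h => exist _ (phclass al) (ex_intro _ al (And3 h.1 h.2 erefl))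
  | right _ => exist _ (phclass (cst (inX y0))) (ex_intro _ (cst (inX y0))
      (And3 (isPath_cont (@cont_cst _ Y (inX y0))) erefl erefl))
  end.

Lemma clsE al : isPath al -> al 0 = inX y0 -> proj1_sig (cls al) = phclass al.
Proof. by move=> h1 h2; rewrite /cls; case: pselect => // -[]. Qed.

(** This is $[\alpha\cdot e]$ for $z=[\alpha]$, formed with a chosen representative of [z]. By the
    lemmas below it depends on [e] only up to homotopy, turns concatenation into iteration and is
    undone by [revp]; whiskers and the sets [Acal] are rewritten in terms of it. *)
Definition ext z e : Yt := cls (concat (rep z) e).

Lemma extE z e : continuous e -> e 0 = ptil z ->
  proj1_sig (ext z e) = phclass (concat (rep z) e).
Proof.
move=> ce e0; apply: clsE; last by rewrite concat0 rep0.
by apply/isPath_cont/concat_cont; rewrite ?rep1 //; exact: rep_cont.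
Qed.

Lemma phom_rep z al : isPath al -> proj1_sig z = phclass al -> phom (rep z) al.
Proof.
move=> pal e; apply/phclassP; first exact/isPath_cont/rep_cont.
by rewrite -repE.
Qed.

Lemma extP z e al : continuous e -> e 0 = ptil z -> isPath al ->
  proj1_sig z = phclass al -> proj1_sig (ext z e) = phclass (concat al e).
Proof.
move=> ce e0 pal zal; rewrite extE //; apply/phclassP.
  by apply/isPath_cont/concat_cont; rewrite ?rep1 //; exact: rep_cont.
by apply: phom_concat; rewrite ?rep1 //; [exact: phom_rep|exact: phom_refl].
Qed.

Lemma ext_hom z e d : continuous e -> continuous d -> e 0 = ptil z -> phom e d ->
  ext z e = ext z d.
Proof.
move=> ce cd e0 h; apply: Yt_eq; rewrite !extE //; last by have [<-] := phom_ends h.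
apply/phclassP; first by apply/isPath_cont/concat_cont; rewrite ?rep1 //; exact: rep_cont.
by apply: phom_concat; rewrite ?rep1 //; exact/phom_refl/rep_cont.
Qed.

Lemma ptil_ext z e : continuous e -> e 0 = ptil z -> ptil (ext z e) = e 1.
Proof.
move=> ce e0; rewrite (@ptilE _ (concat (rep z) e)) ?concat1 ?extE //.
by apply/isPath_cont/concat_cont; rewrite ?rep1 //; exact: rep_cont.
Qed.

Lemma ext_ext z e d : continuous e -> continuous d -> e 0 = ptil z -> d 0 = e 1 ->
  ext (ext z e) d = ext z (concat e d).
Proof.
move=> ce cd e0 de; apply: Yt_eq.
have cr := @rep_cont z.
have cre : continuous (concat (rep z) e) by apply: concat_cont; rewrite ?rep1.
have ced : continuous (concat e d) by apply: concat_cont.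
rewrite (@extP _ d (concat (rep z) e)) ?extE ?concat0 ?ptil_ext //.
- apply/phclassP; last by apply: phom_concatA; rewrite ?rep1.
  by apply/isPath_cont/concat_cont; rewrite ?concat1.
- exact: isPath_cont.
Qed.

Lemma ext_cst z : ext z (cst (ptil z)) = z.
Proof.
have cr := @rep_cont z.
apply: Yt_eq; rewrite extE //; last exact: cont_cst.
rewrite -rep1 [RHS]repE; apply/phclassP; last exact: phom_concat_cst.
by apply/isPath_cont/concat_cont => //; exact: cont_cst.
Qed.

Lemma ext_null z e : continuous e -> e 0 = ptil z -> phom e (cst (ptil z)) -> ext z e = z.
Proof.
move=> ce e0 h; rewrite -[RHS]ext_cst; apply: ext_hom => //; exact: cont_cst.
Qed.

Lemma ext_revp z e : continuous e -> e 0 = ptil z -> ext (ext z e) (revp e) = z.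
Proof.
move=> ce e0; have cr := revp_cont ce.
rewrite ext_ext //; last by rewrite /revp subr0.
apply: ext_null.
- by apply: concat_cont => //; rewrite /revp subr0.
- by rewrite concat0.
- by rewrite -e0; exact: phom_concat_revp.
Qed.

Lemma ext_revp_eq z w e : continuous e -> e 0 = ptil z -> w = ext z e ->
  z = ext w (revp e) /\ revp e 0 = ptil w.
Proof.
move=> ce e0 ->; rewrite ext_revp // ptil_ext //; split=> //.
by rewrite /revp subr0.
Qed.

Lemma whiskerP al U z w : isPath al -> proj1_sig z = phclass al ->
  whisker al U w <-> exists e, [/\ continuous e, e 0 = ptil z,
    forall t, 0 <= t <= 1 -> U (e t) & w = ext z e].
Proof.
move=> pal zal; split=> [[e [pe e0 eU we]]|[e [ce e0 eU ->]]]; last first.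
  exists e; split=> //; first exact: isPath_cont.
    by rewrite e0 (ptilE pal zal).
  exact: extP.
have /isPathP cec := pe.
have ce0 : (e \o clip) 0 = ptil z by rewrite /= clip0 e0 (ptilE pal zal).
exists (e \o clip); split=> //.
  by move=> t _; apply: eU; exact: clip01.
apply: Yt_eq; rewrite we (extP cec ce0 pal zal); apply/esym/phclassP; last first.
  apply: phom_sym; apply: phom_concat; [|exact: phom_clip|by rewrite e0].
  by apply/phclassP.
have h : phom (concat (al \o clip) (e \o clip)) (concat al (e \o clip)).
  apply: phom_concat; [exact/phom_sym/phom_clip|exact: phom_refl|].
  by rewrite /= clip0 clip1 e0.
exact/isPathP/(phom_cont (phom_sym h)).
Qed.

Lemma openYt (O : set Yt) : open O <->
  exists2 F, F `<=` finI_from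
    [set W : set Yt | exists al U, [/\ isPath al, al 0 = inX y0, open U,
        U (al 1) & W = whisker al U]] id
    & \bigcup_(i in F) i = O.
Proof. by split; exact. Qed.

(** A basic whisker set that is based at another class and contains [z] through a path [e] in [U]
    also contains every whisker at [z] inside [U], by concatenation with [e]. So the whiskers based
    at [z] form a neighbourhood base. *)
Lemma nbhs_Yt z (O : set Yt) : nbhs z O <-> exists U, [/\ open U, U (ptil z) &
  forall e, continuous e -> e 0 = ptil z -> (forall t, 0 <= t <= 1 -> U (e t)) ->
    O (ext z e)].
Proof.
split.
  pose P (O : set Yt) := exists U, [/\ open U, U (ptil z) &
  forall e, continuous e -> e 0 = ptil z -> (forall t, 0 <= t <= 1 -> U (e t)) ->
    O (ext z e)].
  move: O; apply: (@subbase_nbhs_ind _ _ openYt z P).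
  - by exists setT; split=> //; exact: openT.
  - move=> _ [al [U [pal al0 oU Ual ->]]].
    have ca := clsE pal al0.
    move=> /(whiskerP _ _ pal ca) [e [ce e0 eU ze]].
    exists U; split=> //.
      by rewrite ze ptil_ext //; apply: eU; rewrite lexx ler01.
    move=> d cd d0 dU; apply/(whiskerP _ _ pal ca); exists (concat e d).
    have de : d 0 = e 1 by rewrite d0 ze ptil_ext.
    split=> //.
    + exact: concat_cont.
    + by rewrite concat0.
    + move=> t t01; rewrite /Defs.concat; case: leP => t2.
        by apply: eU; move: t01; lra.
      by apply: dU; move: t01; lra.
    + by rewrite ze ext_ext.
  - move=> B C [U [oU Uz UB]] [V [oV Vz VC]]; exists (U `&` V); split=> //.
      exact: openI.
    move=> e ce e0 eUV; split; [apply: UB|apply: VC] => // t /eUV[]//.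
  - move=> B C BC [U [oU Uz UB]]; exists U; split=> // e ce e0 eU.
    by apply: BC; exact: UB.
move=> [U [oU Uz UO]]; apply: (@filterS _ _ _ (whisker (rep z) U)).
  move=> w /(whiskerP _ _ (isPath_cont (@rep_cont z)) (repE z)) [e [ce e0 eU ->]].
  exact: UO.
apply: nbhs_open.
  apply: (subbase_open openYt); exists (rep z), U.
  split=> //; [exact/isPath_cont/rep_cont|exact: rep0|by rewrite rep1].
apply/(whiskerP _ _ (isPath_cont (@rep_cont z)) (repE z)).
exists (cst (ptil z)); split=> //; [exact: cont_cst|by rewrite ext_cst].
Qed.

Lemma ptil_cont : continuous ptil.
Proof.
move=> z V; rewrite nbhsE => -[W [oW Wz] WV]; apply/nbhs_Yt; exists W.
split=> // e ce e0 eW; rewrite /= ptil_ext //; apply: WV; apply: eW.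
by rewrite lexx ler01.
Qed.

Definition Yt0 : Yt := cls (cst (inX y0)).

Lemma Yt0E : proj1_sig Yt0 = phclass (cst (inX y0)).
Proof. by rewrite clsE //; apply: isPath_cont; exact: cont_cst. Qed.

Lemma Yt_bpP z : Yt_bp R X A x a y0 z <-> z = Yt0.
Proof.
split=> [h|->]; last exact: Yt0E.
by apply: Yt_eq; rewrite h Yt0E.
Qed.

Lemma ptil_Yt0 : ptil Yt0 = inX y0.
Proof. by rewrite (@ptilE _ (cst (inX y0))) ?Yt0E //; apply: isPath_cont; exact: cont_cst. Qed.

Lemma AcalP j z w : ptil z = inX (x j) -> Acal R X A x a y0 j z w <->
  exists e : R -> A j, [/\ continuous e, e 0 = a j & w = ext z (inA j \o e)].
Proof.
move=> pz; split=> [[al [pal zal [e [pe e0 wE]]]]|[e [ce e0 ->]]]; last first.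
  exists (rep z); split; [exact/isPath_cont/rep_cont|exact: repE|].
  exists e; split=> //; first by apply/isPathP; apply: cont_comp => //; apply: cont_clip; cont.
  by rewrite extE //=; [apply: cont_comp => //; exact: inA_cont|rewrite e0 inA_bp].
have /isPathP cec := pe.
exists (e \o clip); split=> //; first by rewrite /= clip0.
have cic : continuous (inA j \o (e \o clip) : R -> Y).
  by apply: (cont_comp cec); exact: inA_cont.
have i0 : (inA j \o (e \o clip)) 0 = ptil z by rewrite /= clip0 e0 inA_bp.
apply: Yt_eq; rewrite wE (extP cic i0 pal zal).
have al1 : al 1 = inX (x j) by rewrite -pz (ptilE pal zal).
have pie : isPath (inA j \o e : R -> Y).
  by apply/isPathP; apply: (cont_comp cec); exact: inA_cont.
have h : phom (concat al (inA j \o e)) (concat al (inA j \o (e \o clip))).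
  apply: phom_concat; [exact/phclassP|exact: (phom_clip pie)|by rewrite al1 /= e0 inA_bp].
by apply/phclassP => //; apply/isPathP/(phom_cont h).
Qed.

End Cover.

(** * Maps on the Hawaiian earring *)

Section Pieces.
Variables (S A0 : topologicalType) (a0 : A0) (u : S -> A0).
Variables (L : eqType) (lab : S -> L).
Hypothesis cu : continuous u.
Hypothesis olab : forall l, open [set s | u s <> a0 /\ lab s = l].

(** Used twice: for a loop in [A j], labelled by the components of the set where it differs from
    [a j], and for a map from the sphere, labelled by the point of the fibre over [x j] at which
    [A j] is attached. *)
Definition piece l s : A0 := if lab s == l then u s else a0.

Lemma piece_neq l s : piece l s <> a0 -> u s <> a0 /\ lab s = l.
Proof. by rewrite /piece; case: eqP. Qed.

(** Where [u] differs from [a0] the label is locally constant. Where [u] equals [a0], continuity of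
    [u] suffices: nearby values of the piece are values of [u] or [a0] itself. *)
Lemma piece_cont l : continuous (piece l).
Proof.
move=> s V nV; suff : nbhs s (piece l @^-1` V) by [].
have [us|us] := pselect (u s = a0).
  have Va : nbhs a0 V by move: nV; rewrite /piece us if_same.
  have : nbhs s (u @^-1` V) by apply: cu; rewrite us.
  apply: filterS => s' /= Vs'; rewrite /piece; case: eqP => // _.
  exact: nbhs_singleton Va.
have no : nbhs s [set s' | u s' <> a0 /\ lab s' = lab s].
  exact: nbhs_open (olab (lab s)) (conj us erefl).
move: nV; rewrite /piece; case: eqP => [<-|ne] nV.
  have nu : nbhs s (u @^-1` V) by exact: cu.
  by move: no nu; apply: filterS2 => s' /= [_ ->]; rewrite eqxx.
move: no; apply: filterS => s' /= [_ ->]; case: eqP => // _.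
exact: nbhs_singleton nV.
Qed.

(** [K] is covered by the preimage of [V] and the open label sets, and a finite subcover involves
    finitely many labels. This smallness makes maps on a shrinking wedge continuous at the wedge
    point. *)
Lemma piece_small (K : set S) (V : set A0) : compact K -> open V -> V a0 ->
  exists ls : seq L, forall s, K s -> ~ V (u s) -> lab s \in ls.
Proof.
move=> cK oV Va.
pose U (o : option L) := if o is Some l then [set s | u s <> a0 /\ lab s = l]
  else u @^-1` V.
have [|s sP] := @compact_fin_cover _ K _ U cK.
  move=> s _; have [Vs|Vs] := pselect (V (u s)).
    exists None; apply: nbhs_open => //.
    by move/continuousP : cu; apply.
  exists (Some (lab s)); apply: nbhs_open; first exact: olab.
  by split=> // us; apply: Vs; rewrite us.
exists (pmap id s) => p Kp Vp; have [[l|] ls //= [_ ->]] := sP p Kp.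
by rewrite mem_pmap; apply/mapP; exists (Some l).
Qed.

End Pieces.

Lemma rV_cont (R : realType) (T : topologicalType) n (f : T -> 'rV[R]_n) :
  (forall i, continuous (fun t => f t ord0 i)) -> continuous f.
Proof.
move=> cf t V [P nP PV].
suff : nbhs t (f @^-1` V) by [].
have : \forall s \near t, forall i, P ord0 i (f s ord0 i).
  apply: filter_forall => i.
  have h : nbhs t ((fun t => f t ord0 i) @^-1` P ord0 i) by apply: (cf i t (P ord0 i)); exact: nP.
  exact: h.
by apply: filterS => s Ps; apply: PV => i j; rewrite (ord1 i).
Qed.

Lemma coord_cont (R : realType) (T : topologicalType) n (f : T -> 'rV[R]_n) i :
  continuous f -> continuous (fun t => f t ord0 i).
Proof. by move=> cf; exact: cont_comp cf (@coord_continuous R 1 n ord0 i). Qed.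

(** * Maps out of a shrinking wedge of spheres *)

Section Wedge.
Variables (R : realType) (k : nat).

Definition mkS (v : 'rV[R]_k.+1) (vS : sphere R k v) : Sph R k := exist _ v (mem_set vS).

Lemma SphP (s : Sph R k) : \sum_(i < k.+1) (set_val s ord0 i) ^+ 2 = 1.
Proof. exact: (set_mem (valP s)). Qed.

Lemma sphere_ebase : sphere R k (ebase R k).
Proof.
rewrite /sphere /= big_ord_recl !mxE eqxx expr1n big1 ?addr0 // => i _.
by rewrite mxE /= expr0n.
Qed.

Definition Se : Sph R k := mkS sphere_ebase.

Lemma openHw (O : set (Hw R k)) : open O <->
  exists2 F, F `<=` finI_from (@wedge_open R k) id & \bigcup_(i in F) i = O.
Proof. by split; exact. Qed.

Lemma ellE i s : set_val s <> ebase R k -> exists h, ell R k i s = Some (i, exist _ s h).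
Proof. by rewrite /ell; case: pselect => // h _; exists h. Qed.

Lemma ell_e i s : sph_bp R k s -> ell R k i s = None.
Proof. by rewrite /ell /sph_bp; case: pselect. Qed.

Lemma ell_cont i : continuous (ell R k i : Sph R k -> Hw R k).
Proof. by apply: (subbase_continuous openHw) => B [+ _]; apply. Qed.

Lemma wedge_cont (A0 : topologicalType) (h : Hw R k -> A0) :
  (forall i, continuous (fun s => h (ell R k i s))) ->
  (forall V, open V -> V (h None) -> exists N, forall i, (N <= i)%N ->
     forall s, V (h (ell R k i s))) -> continuous h.
Proof.
move=> ch hs; apply/continuousP => V oV.
apply: (subbase_open openHw); split; last exact: hs.
by move=> i; have /continuousP := ch i; apply.
Qed.

Definition wmap (A0 : Type) (a0 : A0) (m : nat -> Sph R k -> A0) (w : Hw R k) : A0 :=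
  if w is Some (i, s) then m i (sval s) else a0.

Lemma wmap_ell (A0 : Type) (a0 : A0) m i s :
  (sph_bp R k s -> m i s = a0) -> wmap a0 m (ell R k i s) = m i s.
Proof.
move=> me; have [e|ne] := pselect (set_val s = ebase R k); last first.
  by have [h ->] := ellE i ne.
by rewrite ell_e // me.
Qed.

Lemma wmap_cont (A0 : topologicalType) (a0 : A0) m :
  (forall i, continuous (m i)) -> (forall i s, sph_bp R k s -> m i s = a0) ->
  (forall V, open V -> V a0 -> exists N, forall i, (N <= i)%N -> forall s, V (m i s)) ->
  continuous (wmap a0 m).
Proof.
move=> cm me ms; apply: wedge_cont.
  move=> i; rewrite (_ : (fun s => _) = m i); first exact: cm.
  by apply/funext => s; apply: wmap_ell => /me.
move=> V oV Va; have [N NV] := ms V oV Va; exists N => i Ni s.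
by rewrite wmap_ell => [|/me //]; exact: NV.
Qed.

End Wedge.
Arguments Se {R k}.

(** * The circle as a quotient of the interval *)

Section Circle.
Variable R : realType.

(** A parametrization of the circle without trigonometry: the first coordinate runs linearly from 1
    to -1 on $[0,1/2]$ and back, and the second is the square root with the matching sign. *)
Definition cx (t : R) : R := if t <= 2^-1 then 1 - 4 * t else 4 * t - 3.
Definition cy (t : R) : R :=
  if t <= 2^-1 then Num.sqrt (1 - (1 - 4 * t) ^+ 2)
  else - Num.sqrt (1 - (4 * t - 3) ^+ 2).
Definition cvec (t : R) : 'rV[R]_2 :=
  \row_(i < 2) if i == ord0 then cx t else cy t.

Lemma cvec_sphere t : sphere R 1 (cvec (clip t)).
Proof.
have /andP[t0 t1] := clip01 t.
rewrite /sphere /= big_ord_recl big_ord1 !mxE /= /cx /cy; case: leP => t2.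
  by rewrite sqr_sqrtr; [ring|nra].
by rewrite sqrrN sqr_sqrtr; [ring|nra].
Qed.

Definition circ (t : R) : Sph R 1 := mkS (cvec_sphere t).

Lemma sqrt_cont (T : topologicalType) (f : T -> R) :
  continuous f -> continuous (fun t => Num.sqrt (f t)).
Proof. by move=> cf; apply: (cont_comp cf); exact: sqrt_continuous. Qed.

Lemma circ_cont : continuous circ.
Proof.
apply: set_type_cont; apply: (cont_comp (f := @clip R) (g := cvec)).
  by apply: (@cont_clip _ _ id); exact: cont_id.
apply: rV_cont => i; rewrite (_ : (fun t => _) = if i == ord0 then cx else cy); last first.
  by apply/funext => t; rewrite mxE; case: ifP.
case: ifP => _; apply: paste; try by [cont].
- by move=> t; lra.
- by apply: sqrt_cont; cont.
- by apply: contN; apply: sqrt_cont; cont.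
- move=> t ->; rewrite (_ : 4 * 2^-1 = 2); last by lra.
  rewrite (_ : 1 - (1 - 2) ^+ 2 = 0 :> R); last by ring.
  rewrite (_ : 1 - (2 - 3) ^+ 2 = 0 :> R); last by ring.
  by rewrite sqrtr0 oppr0.
Qed.

Lemma cxy01 t : t <= 0 \/ 1 <= t -> cx (clip t) = 1 /\ cy (clip t) = 0.
Proof.
case=> h; rewrite ?(clip_le0 h) ?(clip_ge1 h) /cx /cy; case: leP => h2; try lra;
  split; try lra.
  by rewrite (_ : 1 - (1 - 4 * 0) ^+ 2 = 0 :> R) ?sqrtr0 //; ring.
by rewrite (_ : 1 - (4 * 1 - 3) ^+ 2 = 0 :> R) ?sqrtr0 ?oppr0 //; ring.
Qed.

Lemma circ_e t : t <= 0 \/ 1 <= t -> sph_bp R 1 (circ t).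
Proof.
move=> /cxy01[ex ey]; rewrite /sph_bp.
have -> : set_val (circ t) = cvec (clip t) by [].
by apply/rowP => i; rewrite !mxE; case: ifP.
Qed.

(** The parameter is recovered from the first coordinate, separately on the upper and the lower half
    circle. Both formulas give 1/2 at $(-1,0)$; at the base point they give 0 and 1, where [m] has
    the same value [a0]. *)
Lemma circle_loop (A0 : topologicalType) (a0 : A0) (m : R -> A0) :
  continuous m -> (forall t, t <= 0 \/ 1 <= t -> m t = a0) ->
  exists m' : Sph R 1 -> A0, [/\ continuous m', forall t, m' (circ t) = m t,
    forall s, sph_bp R 1 s -> m' s = a0 & forall s, exists t, m' s = m t].
Proof.
move=> cm m01.
pose X0 (s : Sph R 1) := set_val s ord0 ord0.
pose Y0 (s : Sph R 1) := set_val s ord0 (lift ord0 ord0).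
have cX : continuous X0 by apply: coord_cont; exact: set_val_cont.
have cY : continuous Y0 by apply: coord_cont; exact: set_val_cont.
have XY s : X0 s ^+ 2 + Y0 s ^+ 2 = 1.
  by have := SphP s; rewrite big_ord_recl big_ord1.
pose m' s := if 0 <= Y0 s then m ((1 - X0 s) / 4) else m ((3 + X0 s) / 4).
exists m'; split.
- apply: paste; [by cont|by cont|by apply: cont_comp => //; cont|
    by apply: cont_comp => //; cont|].
  move=> s Ys; have := XY s; rewrite -Ys expr0n /= addr0 => /eqP.
  rewrite sqrf_eq1 => /orP[] /eqP ->.
    by rewrite !m01 //; [right|left]; lra.
  by congr m; lra.
- move=> t; rewrite -[LHS]/(if 0 <= cvec (clip t) ord0 (lift ord0 ord0) then _ else _).
  rewrite /X0 (_ : set_val (circ t) = cvec (clip t)) // !mxE /=.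
  have [t01|t01] := pselect (t <= 0 \/ 1 <= t).
    have [-> ->] := cxy01 t01; rewrite lexx !m01 //; left; lra.
  have {t01} [t0 t1] : 0 < t /\ t < 1.
    by split; rewrite ltNge; apply/negP => h; apply: t01; [left|right].
  rewrite clip_id; last by lra.
  rewrite /cx /cy; have [t2|t2] := leP t 2^-1.
    by rewrite sqrtr_ge0; congr m; lra.
  rewrite ifF; first by congr m; lra.
  apply/negbTE; rewrite -ltNge oppr_lt0 sqrtr_gt0; nra.
- move=> s e; rewrite /m' /X0 /Y0 e !mxE /= lexx m01 //; left; lra.
- by move=> s; rewrite /m'; case: ifP => _; eexists.
Qed.

End Circle.

(** * The components of the set where a loop leaves its base point *)

Section Components.
Variables (R : realType) (A0 : topologicalType) (a0 : A0) (u : R -> A0).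
Hypothesis hA0 : hausdorff_space A0.
Hypothesis cu : continuous u.
Hypothesis u01 : forall s, s <= 0 \/ 1 <= s -> u s = a0.

(** [clo s] and [chi s] are the ends of the component of the set [u <> a0] that contains [s]. *)
Definition clo s := sup [set r | r <= s /\ u r = a0].
Definition chi s := inf [set r | s <= r /\ u r = a0].

Lemma nz_open : open [set s | u s <> a0].
Proof. exact: (iffLR (continuousP _) cu _ (@T1_open _ a0 hA0)). Qed.

Lemma nz01 s : u s <> a0 -> 0 < s /\ s < 1.
Proof.
move=> us; split; rewrite ltNge; apply/negP => h; apply: us; apply: u01.
  by left.
by right.
Qed.

Lemma nz_ball s : u s <> a0 -> exists2 d, 0 < d & forall r, `|s - r| < d -> u r <> a0.
Proof.
move=> us; have := nbhs_open nz_open us.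
by move=> /nbhs_ballP[d /= d0 dP]; exists d => // r; exact: dP.
Qed.

Lemma clo_sup s : u s <> a0 -> has_sup [set r | r <= s /\ u r = a0].
Proof.
move=> us; have [s0 s1] := nz01 us; split.
  by exists 0; split; [exact: ltW|apply: u01; left].
by exists s => r [].
Qed.

Lemma chi_inf s : u s <> a0 -> has_inf [set r | s <= r /\ u r = a0].
Proof.
move=> us; have [s0 s1] := nz01 us; split.
  by exists 1; split; [exact: ltW|apply: u01; right].
by exists s => r [].
Qed.

Lemma clo_ub s r : u s <> a0 -> r <= s -> u r = a0 -> r <= clo s.
Proof. by move=> us rs ur; apply: (sup_upper_bound (clo_sup us)). Qed.

Lemma chi_lb s r : u s <> a0 -> s <= r -> u r = a0 -> chi s <= r.
Proof. by move=> us rs ur; apply: ge_inf => //; exact: (chi_inf us).2. Qed.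

Lemma u_clo s : u s <> a0 -> u (clo s) = a0.
Proof.
move=> us; apply: contrapT => /nz_ball[d d0 dP].
have [r [rs ur] cr] := sup_adherent d0 (clo_sup us).
have rc := clo_ub us rs ur.
apply: (dP r) => //; rewrite -/(clo s) in cr; rewrite ger0_norm; lra.
Qed.

Lemma u_chi s : u s <> a0 -> u (chi s) = a0.
Proof.
move=> us; apply: contrapT => /nz_ball[d d0 dP].
have [r [rs ur] cr] := inf_adherent d0 (chi_inf us).
have rc := chi_lb us rs ur.
apply: (dP r) => //; rewrite -/(chi s) in cr; rewrite ler0_norm; lra.
Qed.

Lemma clo_lt s : u s <> a0 -> clo s < s.
Proof.
move=> us; rewrite lt_neqAle; apply/andP; split.
  by apply/eqP => e; apply: (us); rewrite -e; exact: u_clo.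
apply: ge_sup; first exact: (clo_sup us).1.
by move=> r [].
Qed.

Lemma chi_gt s : u s <> a0 -> s < chi s.
Proof.
move=> us; rewrite lt_neqAle; apply/andP; split.
  by apply/eqP => e; apply: (us); rewrite e u_chi.
apply: lb_le_inf; first exact: (chi_inf us).1.
by move=> r [].
Qed.

Lemma comp_nz s r : u s <> a0 -> clo s < r < chi s -> u r <> a0.
Proof.
move=> us /andP[r1 r2] ur; have [rs|sr] := leP r s.
  by have := clo_ub us rs ur; lra.
by have := chi_lb us (ltW sr) ur; lra.
Qed.

Lemma comp_eq s r : u s <> a0 -> clo s < r < chi s -> clo r = clo s /\ chi r = chi s.
Proof.
move=> us h; have ur := comp_nz us h; case/andP: h => r1 r2.
split; apply/eqP; rewrite eq_le; apply/andP; split.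
- rewrite leNgt; apply/negP => lr; apply: (@comp_nz s (clo r)) (u_clo ur) => //.
  by rewrite lr; have := clo_lt ur; lra.
- by apply: clo_ub (u_clo us) => //; lra.
- by apply: chi_lb (u_chi us) => //; lra.
- rewrite leNgt; apply/negP => lr; apply: (@comp_nz s (chi r)) (u_chi ur) => //.
  by rewrite lr; have := chi_gt ur; lra.
Qed.

Definition rat_between (l h : R) : rat := xget 0 [set q : rat | l < ratr q < h].

Lemma rat_betweenP l h : l < h -> l < ratr (rat_between l h) < h.
Proof.
move=> lh; rewrite /rat_between; case: xgetP => [q _ //|].
have [q] := rat_in_itvoo lh.
by rewrite in_itv /= => lqh /(_ q).
Qed.

(** A component is named by the code of a rational number in it. The rational is chosen from the two
    ends alone, so it is the same for all points of the component, and it lies in no other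
    component. *)
Definition cidx s : nat := choice.pickle (rat_between (clo s) (chi s)).

Lemma cidx_eq s r : u s <> a0 -> clo s < r < chi s -> cidx r = cidx s.
Proof. by move=> us /(comp_eq us)[e1 e2]; rewrite /cidx e1 e2. Qed.

Lemma cidx_inj s r : u s <> a0 -> u r <> a0 -> cidx s = cidx r ->
  clo s = clo r /\ chi s = chi r.
Proof.
move=> us ur /(pcan_inj (@choice.pickleK rat)).
have hs := rat_betweenP (lt_trans (clo_lt us) (chi_gt us)).
have hr := rat_betweenP (lt_trans (clo_lt ur) (chi_gt ur)).
move=> e; rewrite e in hs.
have [e1 e2] := comp_eq us hs; have [e3 e4] := comp_eq ur hr.
by split; [rewrite -e1 e3|rewrite -e2 e4].
Qed.

Lemma cidx_open i : open [set s | u s <> a0 /\ cidx s = i].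
Proof.
rewrite openE => s [us <-].
have : nbhs s `]clo s, chi s[%classic.
  apply: nbhs_open; first exact: interval_open.
  by rewrite /= in_itv /= clo_lt // chi_gt.
apply: filterS => r; rewrite /= in_itv /= => h; split; first exact: comp_nz h.
exact: cidx_eq.
Qed.

Lemma cidx_near s : u s <> a0 -> \forall r \near s, u r <> a0 /\ cidx r = cidx s.
Proof.
move=> us; have us' : [set r | u r <> a0 /\ cidx r = cidx s] s by split.
exact: (nbhs_open (@cidx_open (cidx s)) us').
Qed.

Lemma comp_ex i : exists cd : R * R, cd.1 < cd.2 /\
  forall r, u r <> a0 -> cidx r = i -> clo r = cd.1 /\ chi r = cd.2.
Proof.
have [[s [us si]]|n] := pselect (exists s, u s <> a0 /\ cidx s = i).
  exists (clo s, chi s); split=> /=; first exact: lt_trans (clo_lt us) (chi_gt us).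
  by move=> r ur ri; apply: cidx_inj => //; rewrite ri si.
exists (0, 1); split=> /= [|r ur ri]; first exact: ltr01.
by case: n; exists r.
Qed.

(* The coding of the components of [u <> a0] by natural numbers turns [u] into
   a map on the one-dimensional Hawaiian earring, continuous at the wedge point
   because [u] is uniformly close to [a0] on all but finitely many components. *)
Lemma earring_factor : exists (G : R -> Hw R 1) (h : Hw R 1 -> A0),
  [/\ continuous G, based_map (Hw_bp R 1) a0 h, forall s, h (G s) = u s &
      forall s, u s = a0 -> G s = None].
Proof.
have /choice [cd cdP] := comp_ex.
pose p i := piece a0 u cidx i.
pose m i t := p i ((cd i).1 + t * ((cd i).2 - (cd i).1)).
have cp i : continuous (p i) by apply: piece_cont => // l; exact: cidx_open.
have cm i : continuous (m i) by apply: (cont_comp (g := p i)) => //; cont.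
have pout i r : r <= (cd i).1 \/ (cd i).2 <= r -> p i r = a0.
  move=> h; apply: contrapT => n.
  have [ur ri] := @piece_neq _ _ a0 u _ cidx i r n.
  have [_ /(_ r ur ri)[e1 e2]] := cdP i.
  by have := clo_lt ur; have := chi_gt ur; case: h; lra.
have m01 i t : t <= 0 \/ 1 <= t -> m i t = a0.
  by have [cdi _] := cdP i; case=> ht; apply: pout; [left|right]; nra.
have /choice [m' m'P] : forall i, exists m' : Sph R 1 -> A0,
    [/\ continuous m', forall t, m' (circ t) = m i t,
    forall s, sph_bp R 1 s -> m' s = a0 & forall s, exists t, m' s = m i t].
  by move=> i; apply: circle_loop => //; exact: m01.
pose nrm i s := (s - (cd i).1) / ((cd i).2 - (cd i).1).
(* The component is stretched to the unit interval, wrapped once around the circle and placed in the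
   copy with its number. *)
pose G s : Hw R 1 := if pselect (u s = a0) then None else ell R 1 (cidx s) (circ (nrm (cidx s) s)).
have G0 s : u s = a0 -> G s = None by move=> us; rewrite /G; case: pselect.
have G1 s : u s <> a0 -> G s = ell R 1 (cidx s) (circ (nrm (cidx s) s)).
  by move=> us; rewrite /G; case: pselect.
pose h : Hw R 1 -> A0 := wmap a0 m'.
have hell i s : h (ell R 1 i s) = m' i s.
  by rewrite /h wmap_ell //; case: (m'P i) => _ _ mb _; exact: mb.
have cG i : continuous (fun s => ell R 1 i (circ (nrm i s)) : Hw R 1).
  apply: (cont_comp (f := fun s => circ (nrm i s))); last exact: ell_cont.
  by apply: (cont_comp (f := nrm i)); [rewrite /nrm; cont|exact: circ_cont].
exists G, h; split.
- apply: (subbase_continuous (@openHw R 1)) => B Bo.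
  have oB : open (B : set (Hw R 1)) by apply: (subbase_open (@openHw R 1)).
  have near_i s i : B (G s) -> \forall r \near s, u r <> a0 -> cidx r = i -> B (G r).
    move=> Bs; have [[r0 [ur0 ri0]]|n] := pselect (exists r, u r <> a0 /\ cidx r = i); last first.
      by apply: (@nearW _ (nbhs s)) => r ur ri; case: n; exists r.
    have [us|us] := pselect (u s <> a0 /\ cidx s <> i).
      have no := cidx_near us.1.
      by move: no; apply: filterS => r /= [ur e] _ ri; case: us => _; rewrite -e.
    have Bi : B (ell R 1 i (circ (nrm i s))).
      have [e|e] := pselect (u s = a0).
        have BN : B None by rewrite G0 in Bs.
        rewrite ell_e //; apply: circ_e.
        have [cdi cdr] := cdP i; have [e1 e2] := cdr r0 ur0 ri0.
        have di : 0 < (cd i).2 - (cd i).1 by lra.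
        rewrite /nrm ler_pdivlMr // ler_pdivrMr // mul0r mul1r.
        have [h1|h1] := leP s (cd i).1; first by left; lra.
        have [h2|h2] := leP (cd i).2 s; first by right; lra.
        by case: (@comp_nz r0 s) => //; rewrite e1 e2 h1 h2.
      have si : cidx s = i by apply: contrapT => ne; apply: us.
      by rewrite G1 // si in Bs.
    have no : nbhs s ((fun s => ell R 1 i (circ (nrm i s)) : Hw R 1) @^-1` B).
      by apply: nbhs_open => //; exact: (iffLR (continuousP _) (cG i)).
    move: no; apply: filterS => r /= Br ur ri.
    by rewrite G1 // ri.
  rewrite openE => s Bs; rewrite /interior.
  have [us|us] := pselect (u s = a0); last first.
    have no := cidx_near us.
    by move: no (near_i s (cidx s) Bs); apply: filterS2 => r /= [ur e]; apply.
  have BN : B None by rewrite /= G0 in Bs.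
  (* [B] contains all copies from [N] on; the finitely many remaining components are handled by
     [near_i]. *)
  have [N NB] := Bo.2 BN.
  have : \forall r \near s, forall i : 'I_N, u r <> a0 -> cidx r = i -> B (G r).
    apply: (@filter_forall R 'I_N (fun i r => u r <> a0 -> cidx r = i -> B (G r)) (nbhs s)).
    by move=> i; exact: near_i.
  apply: filterS => r rN; have [ur|ur] := pselect (u r = a0).
    by rewrite /= G0.
  have [iN|Ni] := ltnP (cidx r) N; first exact: (rN (Ordinal iN)).
  by rewrite /= G1 //; exact: NB.
- split; last by move=> w ->.
  apply: wmap_cont.
  + by move=> i; have [] := m'P i.
  + by move=> i; have [] := m'P i.
  + move=> V oV Va.
    have [ls lsP] := piece_small cu cidx_open (@compact01 R) oV Va.
    exists (\max_(i <- ls) i).+1 => i Ni s; have [_ _ _ /(_ s)[t ->]] := m'P i.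
    apply: contrapT => nV; have mt : m i t <> a0 by move=> e; apply: nV; rewrite e.
    have [ur ri] := @piece_neq _ _ a0 u _ cidx _ _ mt; have [r0 r1] := nz01 ur.
    have il : i \in ls.
      rewrite -ri; apply: lsP; first by rewrite /= !ltW.
      by move: nV; rewrite /m /p /piece ri eqxx.
    by move: Ni; rewrite ltnNge => /negP; apply; exact: leq_bigmax_seq.
- move=> s; have [us|us] := pselect (u s = a0); first by rewrite G0.
  rewrite G1 // hell.
  have [_ -> _ _] := m'P (cidx s); rewrite /m /nrm divfK.
    by rewrite addrC subrK /p /piece eqxx.
  by have [cdi _] := cdP (cidx s); apply/eqP; lra.
- exact: G0.
Qed.

End Components.

(** * Paths in the adjunction space *)

(** The supremum of the parameters outside [B] is itself outside, because [B] is open. *)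
Lemma last_out (R : realType) (B : set R) : open B -> ~ B 0 -> B 1 ->
  exists s, [/\ 0 <= s < 1, ~ B s & forall r, s < r <= 1 -> B r].
Proof.
move=> oB n0 B1; pose E := [set r : R | 0 <= r <= 1 /\ ~ B r].
have sE : has_sup E.
  split; first by exists 0; split=> //; rewrite lexx ler01.
  by exists 1 => r [/andP[]].
have ub r : E r -> r <= sup E by exact: (sup_upper_bound sE).
set s := sup E in ub.
have s0 : 0 <= s by apply: ub; split=> //; rewrite lexx ler01.
have s1 : s <= 1 by apply: ge_sup => [|r [/andP[]]//]; exact: sE.1.
have nBs : ~ B s.
  move=> Bs; have := nbhs_open oB Bs.
  move=> /nbhs_ballP[d /= d0 dP].
  have [r [r01 nr] sr] := sup_adherent d0 sE; rewrite -/s in sr.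
  have rs := ub r (conj r01 nr).
  by apply: nr; apply: dP; rewrite /ball /= ger0_norm; lra.
exists s; split=> // [|r /andP[sr r1]].
  by rewrite s0 lt_neqAle s1 andbT; apply/eqP => e1; rewrite e1 in nBs.
apply: contrapT => n; have := ub r; rewrite leNgt sr => h.
by suff : false by []; apply: h; split=> //; rewrite r1 andbT; lra.
Qed.

Section Deformation.
Variable R : realType.
Variables (X : topologicalType) (A : nat -> topologicalType).
Variables (x : nat -> X) (a : forall j, A j) (y0 : X).
Hypothesis hX : hausdorff_space X.
Hypothesis hA : forall j, hausdorff_space (A j).
Hypothesis scA : forall j, seq_connected R 1 (A j) (a j).
Local Notation Y := (Adj X A x a).
Local Notation Yt := (Ytilde R X A x a y0).
Local Notation concat := (@Defs.concat R _).
Local Notation ptil := (ptil R X A x a y0).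
Local Notation clip := (@clip R).
Local Notation uA j := (unio X A x a j).
Implicit Types (e d : R -> Y) (z w : Yt) (U : set Y).

(** Parameters with [u s = a j] go to the wedge point in the factorization, hence do not move during
    the homotopy. Clipping the time reduces all times to the compact interval, as the tube lemma
    requires. *)
Lemma earring_null j (u : R -> A j) : continuous u ->
  (forall s, s <= 0 \/ 1 <= s -> u s = a j) ->
  exists K : R * R -> A j, [/\ continuous K, forall s, K (s, 0) = u s,
    forall s, K (s, 1) = a j, forall s t, u s = a j -> K (s, t) = a j &
    forall s t, K (s, t) = K (s, clip t)].
Proof.
move=> cu u01; have [G [h [cG bh hG GN]]] := earring_factor (hA (j:=j)) cu u01.
have bc : based_map (Hw_bp R 1) (a j) (cst (a j) : Hw R 1 -> A j).
  by split=> //; exact: cont_cst.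
have [H [cH [H0 [H1 Hb]]]] := @scA j 1%N (leqnn 1) h (cst (a j)) bh bc.
exists (fun p => H (G p.1, toI p.2)); split.
- apply: (cont_comp (f := fun p : R * R => (G p.1, toI p.2))) cH.
  by apply: cont_pair; apply: cont_comp => //; try exact: toI_cont; cont.
- by move=> s /=; rewrite H0 // toIE clip0.
- by move=> s /=; rewrite H1 // toIE clip1.
- by move=> s t us /=; rewrite Hb // GN.
- move=> s t /=; congr (H (_, _)); apply: val_inj => /=.
  by rewrite clip_clip.
Qed.

Lemma deform e : continuous e -> e 0 = inX (pX (e 0)) -> e 1 = inX (pX (e 1)) ->
  phom e (inX \o @pX X A x a \o e).
Proof.
move=> ce e0 e1; pose e' := e \o clip.
have ce' : continuous e' by apply: cont_comp => //; apply: cont_clip; cont.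
pose u j s := uA j (e' s).
have cu j : continuous (u j) by apply: (cont_comp ce'); exact: uA_cont.
have u01 j s : s <= 0 \/ 1 <= s -> u j s = a j.
  by rewrite /u /e' /=; case=> h; [rewrite (clip_le0 h) e0|rewrite (clip_ge1 h) e1]; exact: uA_inX.
pose KP j (K : R * R -> A j) := [/\ continuous K, forall s, K (s, 0) = u j s,
    forall s, K (s, 1) = a j, forall s t, u j s = a j -> K (s, t) = a j &
    forall s t, K (s, t) = K (s, clip t)].
have exK j : exists K, @KP j K by apply: earring_null; [exact: cu|exact: u01].
pose K j := sval (cid (exK j)).
have KPj j : KP j (K j) by rewrite /K; case: cid.
(* All excursions are contracted simultaneously, those into [A j] by [K j], while points of [X]
   stay. The choice of [j] is forced, as the sets [UA j] are disjoint. *)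
pose H (p : R * R) : Y := match pselect (exists j, UA j (e' p.1)) with
  | left h => inA (sval (cid h)) (K (sval (cid h)) p) | right _ => e' p.1 end.
have HU j p : UA j (e' p.1) -> H p = inA j (K j p).
  move=> U; rewrite /H; case: pselect => [h|[]]; last by exists j.
  by case: cid => i Ui /=; rewrite (UA_UA U Ui).
have HN p : (forall j, ~ UA j (e' p.1)) -> H p = e' p.1.
  by move=> n; rewrite /H; case: pselect => // h; have [j Uj] := h; case: (n j).
have uUA j s : ~ UA j (e' s) -> u j s = a j by move=> h; apply: contrapT => /h.
have cH : continuous H.
  move=> [s t] W nW; suff : nbhs (s, t) (H @^-1` W) by [].
  have near1 (P : R -> Prop) : (\forall r \near s, P r) -> nbhs (s, t) [set p : R * R | P p.1].
    by move=> nP; apply: (@cont_fst R R (s, t)).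
  have [[j Uj]|nU] := pselect (exists j, UA j (e' s)).
    have [cK _ _ _ _] := KPj j.
    have n1 : nbhs (s, t) [set p : R * R | UA j (e' p.1)].
      apply: (near1 (fun r => UA j (e' r))); apply: (nbhs_open (O := e' @^-1` UA j)) => //.
      by apply: (iffLR (continuousP _) ce'); exact: UA_open.
    have n2 : nbhs (s, t) ((fun p => inA j (K j p) : Y) @^-1` W).
      have cKj : continuous (fun p => inA j (K j p) : Y).
        by apply: (cont_comp cK); exact: inA_cont.
      by apply: cKj; rewrite -(HU j (s, t) Uj).
    by move: n1 n2; apply: filterS2 => p /= Up; rewrite (HU j p Up).
  have nU' j : ~ UA j (e' s) by move=> h; apply: nU; exists j.
  set v := pX (e' s); have es : e' s = inX v by exact: notUA.
  (* Infinitely many [A j] may be entered near [s]. From [k] on, those attached in [V] lie in [W] as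
     a whole; the finitely many others are treated one at a time in [q3]. *)
  move: nW; rewrite HN // es => nW; have [nX nA [k [V [nV VW]]]] := nbhs_inX nW.
  have q1 : \forall r \near s, W (e' r) by apply: ce'; rewrite es.
  have q2 : \forall r \near s, V (pX (e' r)).
    by apply: (cont_comp ce' (@pX_cont X A x a)); rewrite -/v.
  have q3 : \forall r \near s, forall j : 'I_k, UA j (e' r) -> forall t', W (inA j (K j (r, t'))).
    apply: (@filter_forall R 'I_k (fun j r => UA j (e' r) ->
      forall t', W (inA j (K j (r, t')))) (nbhs s)) => j; have [xv|xv] := pselect (x j = v).
      have [cK _ _ K4 K5] := KPj j.
      have pr t' : 0 <= t' <= 1 -> (inA j @^-1` W : set (A j))^° (K j (s, t')).
        by move=> _; rewrite K4 ?uUA //; exact: nA.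
      (* At the parameter [s] the homotopy [K j] is constant at [a j], so the tube lemma keeps it
         near [a j] for all times at once. *)
      have tb := tube (@compact01 R) cK (@open_interior _ (inA j @^-1` W : set (A j))) pr.
      move: tb; apply: (@filterS _ (nbhs s)) => r rP _ t'; rewrite K5.
      exact: interior_subset (rP _ (clip01 t')).
    have : \forall r \near s, pX (e' r) <> x j.
      have := iffLR (continuousP _) (cont_comp ce' (@pX_cont X A x a)) _ (@T1_open _ (x j) hX).
      by move=> o; apply: (nbhs_open o) => /= h; apply: xv.
    apply: (@filterS _ (nbhs s)) => r rx /uA_neq er; case: rx; rewrite -er; exact: pX_inA.
  have : nbhs (s, t) [set p : R * R | (W (e' p.1) /\ V (pX (e' p.1))) /\
     forall j : 'I_k, UA j (e' p.1) -> forall t', W (inA j (K j (p.1, t')))].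
    apply: (near1 (fun r => (W (e' r) /\ V (pX (e' r))) /\
     forall j : 'I_k, UA j (e' r) -> forall t', W (inA j (K j (r, t'))))).
    by apply: filterI => //; apply: filterI.
  apply: filterS => -[r t'] /= [[r1 r2] r3].
  have [[j Uj]|nUr] := pselect (exists j, UA j (e' r)); last first.
    by rewrite HN // => j h; apply: nUr; exists j.
  rewrite (HU j) //; have [jk|kj] := ltnP j k; first exact: (r3 (Ordinal jk)).
  by apply: VW => //; have <- : pX (e' r) = x j by rewrite -(uA_neq Uj) pX_inA.
exists H; split=> // [s|t].
  have [[j Uj]|nU] := pselect (exists j, UA j (e' s)).
    have [_ K0 K1 _ _] := KPj j.
    rewrite !(HU j) // K0 K1; split; first exact: uA_neq.
    by rewrite inA_bp /= -[e (clip s)](uA_neq Uj) pX_inA.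
  have nU' j : ~ UA j (e' s) by move=> h; apply: nU; exists j.
  by rewrite !HN //; split=> //; exact: notUA.
rewrite !HN /e' /= ?clip0 ?clip1 //.
- by move=> j; rewrite e1; exact: UA_inX.
- by move=> j; rewrite e0; exact: UA_inX.
Qed.

Lemma ext_deform z e : continuous e -> e 0 = ptil z -> e 0 = inX (pX (e 0)) ->
  e 1 = inX (pX (e 1)) -> ext z e = ext z (inX \o @pX X A x a \o e).
Proof.
move=> ce e0 h0 h1; apply: ext_hom => //; last exact: deform.
apply: (cont_comp (f := fun t => pX (e t))); last exact: inX_cont.
exact: cont_comp ce (@pX_cont X A x a).
Qed.

(** The projection of such a loop to [X] is constant, so [deform] contracts the loop in the
    adjunction space. *)
Lemma ext_inA_loop z j (c : R -> A j) : ptil z = inX (x j) -> continuous c ->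
  c 0 = a j -> c 1 = a j -> ext z (inA j \o c) = z.
Proof.
move=> pz cc c0 c1; have ci : continuous (inA j \o c : R -> Y).
  by apply: (cont_comp cc); exact: inA_cont.
rewrite ext_deform //= ?c0 ?c1 ?inA_bp //.
rewrite (_ : _ \o _ = cst (ptil z)) ?ext_cst //.
by apply/funext => t; rewrite /= pX_inA pz.
Qed.

Lemma ext_inA_eq z j (c c' : R -> A j) : ptil z = inX (x j) ->
  continuous c -> continuous c' -> c 0 = a j -> c' 0 = a j -> c 1 = c' 1 ->
  ext z (inA j \o c) = ext z (inA j \o c').
Proof.
move=> pz cc cc' c0 c0' c1.
have ci : continuous (inA j \o c : R -> Y) by apply: (cont_comp cc); exact: inA_cont.
have ci' : continuous (inA j \o c' : R -> Y) by apply: (cont_comp cc'); exact: inA_cont.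
have e0 : (inA j \o c) 0 = ptil z by rewrite /= c0 inA_bp.
have e0' : (inA j \o c') 0 = ptil z by rewrite /= c0' inA_bp.
have h1 : revp (inA j \o c') 0 = (inA j \o c) 1 by rewrite /revp /= subr0 c1.
have cr : continuous (revp (inA j \o c') : R -> Y) by exact: revp_cont.
have : ext (ext z (inA j \o c)) (revp (inA j \o c')) = z.
  rewrite ext_ext // -(concat_comp (inA j) c (revp c')).
  apply: ext_inA_loop => //.
  - apply: concat_cont => //; first exact: revp_cont.
    by rewrite /revp subr0.
  - by rewrite concat0.
  - by rewrite concat1 /revp subrr.
move=> h; rewrite -{2}h.
have p0 : revp (inA j \o c') 0 = ptil (ext z (inA j \o c)) by rewrite ptil_ext.
have := ext_revp cr p0; rewrite (_ : revp (revp _) = inA j \o c') //.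
by apply/funext => t; rewrite /revp /=; congr (inA j (c' _)); ring.
Qed.

(** The common endpoint projects to [c 1 = c' 1]. Going back from it along [c] leads to [z] and, by
    [ext_inA_eq], equally well to [z']. *)
Lemma ext_inA_inj z z' j (c c' : R -> A j) :
  ptil z = inX (x j) -> ptil z' = inX (x j) ->
  continuous c -> continuous c' -> c 0 = a j -> c' 0 = a j ->
  ext z (inA j \o c) = ext z' (inA j \o c') -> z = z'.
Proof.
move=> pz pz' cc cc' c0 c0' e.
have ci : continuous (inA j \o c : R -> Y) by apply: (cont_comp cc); exact: inA_cont.
have ci' : continuous (inA j \o c' : R -> Y) by apply: (cont_comp cc'); exact: inA_cont.
have e0 : (inA j \o c) 0 = ptil z by rewrite /= c0 inA_bp.
have e0' : (inA j \o c') 0 = ptil z' by rewrite /= c0' inA_bp.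
have c1 : c 1 = c' 1.
  by have := congr1 ptil e; rewrite !ptil_ext //=; exact: inA_inj.
rewrite -(ext_revp ci e0) e (ext_inA_eq pz' cc' cc c0' c0 (esym c1)).
by apply: ext_revp => //; rewrite pz' /= c0 inA_bp.
Qed.

Lemma Acal_eq j z z' w : ptil z = inX (x j) -> ptil z' = inX (x j) ->
  Acal R X A x a y0 j z w -> Acal R X A x a y0 j z' w -> z = z'.
Proof.
move=> pz pz' /(AcalP _ pz)[c [cc c0 e]] /(AcalP _ pz')[c' [cc' c0' e']].
by apply: (ext_inA_inj pz pz' cc cc' c0 c0'); rewrite -e.
Qed.

(** [e] is cut at its last parameter outside $A_j\setminus\{a_j\}$. By [closure_UA] it is at [x j]
    there, and afterwards it runs in [A j]. The last clause holds because [d] is an initial part of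
    [e]. *)
Lemma last_exit j e : continuous e -> ~ UA j (e 0) -> UA j (e 1) ->
  exists (d : R -> Y) (c : R -> A j), [/\ continuous d /\ continuous c,
    d 0 = e 0 /\ (d 1 = inX (x j)), c 0 = a j /\ inA j (c 1) = e 1,
    phom e (concat d (inA j \o c)) &
    forall U, (forall t, 0 <= t <= 1 -> U (e t)) -> forall t, 0 <= t <= 1 -> U (d t)].
Proof.
move=> ce n0 U1.
have oU : open (e @^-1` UA j) by apply: (iffLR (continuousP _) ce); exact: UA_open.
have [s [/andP[s0 ls1] nUs aft]] := last_out oU n0 U1.
have s1 := ltW ls1.
have cl r : s <= r <= 1 -> closure (UA j) (e r).
  move=> /andP[]; rewrite le_eqVlt => /orP[/eqP <- _|sr r1]; last first.
    by apply: subset_closure; apply: aft; rewrite sr r1.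
  move=> W nW; have : nbhs s (e @^-1` W) by exact: ce.
  move=> /nbhs_ballP[d /= d0 dP].
  pose q := Num.min (s + d / 2) 1.
  have sq : s < q by rewrite /q lt_min ls1 andbT; lra.
  have qd : q <= s + d / 2 by rewrite /q ge_min lexx.
  exists (e q); split; first by apply: aft; rewrite sq /q ge_min lexx orbT.
  by apply: dP; rewrite /ball /= ler0_norm; lra.
have es : e s = inX (x j).
  by apply: closure_UA => //; apply: cl; rewrite lexx s1.
pose d t := e (s * t).
pose e2 t := e (s + (1 - s) * clip t).
pose c t := uA j (e2 t).
have cd : continuous d by apply: cont_comp => //; cont.
have cclip : continuous clip by apply: (@cont_clip _ _ id); exact: cont_id.
have ce2 : continuous e2 by apply: cont_comp => //; cont.
have cc : continuous c by apply: (cont_comp ce2); exact: uA_cont.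
have icE : (inA j \o c) = e2.
  apply/funext => t; rewrite /= /c; apply: inA_uA => //; apply: cl.
  by have /andP[t0 t1] := clip01 t; apply/andP; split; nra.
have e20 : e2 0 = inX (x j) by rewrite /e2 clip0 mulr0 addr0.
have e21 : e2 1 = e 1 by rewrite /e2 clip1; congr e; lra.
exists d, c; split=> //.
- by rewrite /d mulr0 mulr1.
- rewrite /c e20 uA_inX; split=> //.
  by rewrite -[e 1]e21; exact: (congr1 (fun f : R -> Y => f 1) icE).
- rewrite icE; apply: phom_sym; apply: phom_trans (phom_split s ce).
  apply: phom_eqI; first by apply: concat_cont => //; rewrite e20 /d mulr1.
  move=> t /andP[t0 t1]; rewrite /Defs.concat; case: leP => // t2.
  by rewrite /e2 clip_id //; lra.
- by move=> U eU t /andP[t0 t1]; apply: eU; apply/andP; split; nra.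
Qed.

End Deformation.

(** * Spheres *)

Section Sphere.
Variables (R : realType) (k : nat).
Local Notation V := 'rV[R]_k.+1.
Local Notation S := (Sph R k).

Definition nrm2 (v : V) : R := \sum_(i < k.+1) (v ord0 i) ^+ 2.

Lemma nrm2_cont (T : topologicalType) (f : T -> V) :
  continuous f -> continuous (fun t => nrm2 (f t)).
Proof.
move=> cf; rewrite /nrm2; elim: (index_enum _) => [|i r IH].
  by under eq_fun do rewrite big_nil; exact: cont_cst.
under eq_fun do rewrite big_cons; apply: contD => //.
by apply: contX; exact: coord_cont.
Qed.

Lemma nrm2_ge0 v : 0 <= nrm2 v.
Proof. by apply: sumr_ge0 => i _; exact: sqr_ge0. Qed.

Lemma nrm2Z (c : R) v : nrm2 (c *: v) = c ^+ 2 * nrm2 v.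
Proof. by rewrite /nrm2 mulr_sumr; apply: eq_bigr => i _; rewrite mxE exprMn. Qed.

Lemma nrm2S (s : S) : nrm2 (set_val s) = 1.
Proof. exact: SphP. Qed.

Lemma toS_subproof v : nrm2 v != 0 -> sphere R k ((Num.sqrt (nrm2 v))^-1 *: v).
Proof.
move=> v0; rewrite /sphere /= -/(nrm2 _) nrm2Z exprVn sqr_sqrtr ?nrm2_ge0 //.
by rewrite mulVf.
Qed.

Definition toS v : S :=
  match boolP (nrm2 v != 0) with
  | AltTrue h => mkS (toS_subproof h)
  | AltFalse _ => Se
  end.

Lemma toSE v : nrm2 v != 0 -> set_val (toS v) = (Num.sqrt (nrm2 v))^-1 *: v.
Proof. by move=> h; rewrite /toS; case: {-}_ / boolP => //; rewrite h. Qed.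

Lemma toS_val (s : S) : toS (set_val s) = s.
Proof.
apply: val_inj; have := @toSE (set_val s); rewrite nrm2S oner_neq0 => /(_ isT).
by rewrite sqrtr1 invr1 scale1r.
Qed.

Lemma toS_cont_at v : nrm2 v != 0 -> {for v, continuous toS}.
Proof.
move=> v0.
have cn : continuous (fun w : V => nrm2 w) by apply: nrm2_cont; exact: cont_id.
have nv : nbhs v [set w | nrm2 w != 0].
  have /nbhs_open h : open [set w | 0 < nrm2 w] by exact: open_pos.
  have : nbhs v [set w | 0 < nrm2 w] by apply: h; rewrite /= lt_def v0 nrm2_ge0.
  by apply: filterS => w /= /lt0r_neq0.
pose F (w : V) : V := (Num.sqrt (nrm2 w))^-1 *: w.
have cF : {for v, continuous F}.
  move=> W [P nP PW].
  suff : nbhs v (F @^-1` W) by [].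
  have : \forall w \near v, forall i, P ord0 i (F w ord0 i).
    apply: (@filter_forall V 'I_k.+1 (fun i w => P ord0 i (F w ord0 i)) (nbhs v)) => i.
    have ci : {for v, continuous (fun w : V => F w ord0 i)}.
      rewrite (_ : (fun w => _) = fun w : V => (Num.sqrt (nrm2 w))^-1 * w ord0 i); last first.
        by apply/funext => w; rewrite /F mxE.
      have cs : {for v, continuous (fun w : V => Num.sqrt (nrm2 w) : R^o)} by exact: (sqrt_cont cn).
      have s0 : Num.sqrt (nrm2 v) != 0 by rewrite gt_eqF // sqrtr_gt0 lt_def v0 nrm2_ge0.
      have ci : {for v, continuous (fun w : V => w ord0 i : R^o)} by exact: coord_continuous.
      have cv := @continuousV R V (fun w : V => Num.sqrt (nrm2 w)) v s0 cs.
      exact: (@continuousM R V _ (fun w : V => w ord0 i) v cv ci).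
    exact: (ci (P ord0 i) (nP ord0 i)).
  by apply: filterS => w Pw; apply: PW => i j; rewrite (ord1 i).
move=> W [_ [[B oB <-] Bv] BW].
have nB : nbhs v (F @^-1` B).
  apply: cF; apply: nbhs_open => //; move: Bv; rewrite /= toSE //.
suff : nbhs v (toS @^-1` W) by [].
move: nB nv; apply: filterS2 => w /= Bw w0; apply: BW => /=.
by rewrite toSE.
Qed.

Lemma toS_cont (T : topologicalType) (f : T -> V) : continuous f ->
  (forall t, nrm2 (f t) != 0) -> continuous (fun t => toS (f t)).
Proof.
move=> cf f0 t; apply: continuous_comp; first exact: cf.
exact: toS_cont_at.
Qed.

Definition inner (v w : V) : R := \sum_(i < k.+1) v ord0 i * w ord0 i.

Lemma nrm2_comb (c d : R) v w :
  nrm2 (c *: v + d *: w) = c ^+ 2 * nrm2 v + d ^+ 2 * nrm2 w + 2 * c * d * inner v w.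
Proof.
rewrite /nrm2 /inner !mulr_sumr -!big_split /=; apply: eq_bigr => i _.
by rewrite !mxE; ring.
Qed.

Lemma inner_e v : inner (ebase R k) v = v ord0 ord0.
Proof.
rewrite /inner big_ord_recl !mxE eqxx mul1r big1 ?addr0 // => i _.
by rewrite mxE /= mul0r.
Qed.

Lemma comb_cont (T : topologicalType) (c d : T -> R) (f g : T -> V) :
  continuous c -> continuous d -> continuous f -> continuous g ->
  continuous (fun t => c t *: f t + d t *: g t).
Proof.
move=> cc cd cf cg; apply: rV_cont => i.
rewrite (_ : (fun t => _) = fun t => c t * f t ord0 i + d t * g t ord0 i); last first.
  by apply/funext => t; rewrite !mxE.
by apply: contD; apply: contM => //; exact: coord_cont.
Qed.

(** The path is the normalized segment from [s] to [s']; the tube lemma gives one neighbourhood of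
    [s] that works for all parameters of the segment. *)
Lemma sph_local (s : S) (W : set S) : open W -> W s ->
  \forall s' \near s, exists p : R -> S,
    [/\ continuous p, p 0 = s, p 1 = s' & forall t, W (p t)].
Proof.
move=> oW Ws.
pose G (p : S * R) : V := (1 - clip p.2) *: set_val s + clip p.2 *: set_val p.1.
have ccl : continuous (fun p : S * R => clip p.2) by apply: cont_clip; exact: cont_snd.
have cG : continuous G.
  apply: comb_cont.
  - by cont.
  - exact: ccl.
  - exact: cont_cst.
  - by apply: (cont_comp (f := fst)); [exact: cont_fst|exact: set_val_cont].
pose B : set V := [set v | 0 < nrm2 v] `&` (toS @^-1` W)^°.
have oB : open B.
  apply: openI; last exact: open_interior.
  by apply: open_pos; apply: nrm2_cont; exact: cont_id.
have Gs t : 0 <= t <= 1 -> B (G (s, t)).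
  move=> t01; have -> : G (s, t) = set_val s by rewrite /G /= -scalerDl subrK scale1r.
  split; first by rewrite /= nrm2S.
  suff : nbhs (set_val s) (toS @^-1` W) by [].
  apply: toS_cont_at; first by rewrite nrm2S oner_neq0.
  by apply: nbhs_open => //; rewrite toS_val.
have := tube (@compact01 R) cG oB Gs; apply: filterS => s' Bs'.
have Bs t : B (G (s', t)).
  have -> : G (s', t) = G (s', clip t) by rewrite /G /= clip_clip.
  exact: Bs' (clip01 t).
exists (fun t => toS (G (s', t))); split.
- apply: toS_cont; last by move=> t; have [/lt0r_neq0] := Bs t.
  by apply: (cont_comp (f := fun t : R => (s', t))) cG; cont.
- by rewrite /G /= clip0 subr0 scale0r addr0 scale1r toS_val.
- by rewrite /G /= clip1 subrr scale0r add0r scale1r toS_val.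
- by move=> t; have [_ /interior_subset] := Bs t.
Qed.

(** A normalized segment joins any two points that are not antipodal. The antipode of the base point
    is reached through the second basis vector, which exists as [0 < k]. *)
Lemma sph_path (s : S) : (0 < k)%N -> exists p : R -> S,
  [/\ continuous p, p 0 = Se & p 1 = s].
Proof.
move=> k0; set s0 := set_val s ord0 ord0.
have seg (v w : S) : -1 < inner (set_val v) (set_val w) -> exists p : R -> S,
    [/\ continuous p, p 0 = v & p 1 = w].
  move=> vw.
  pose G t : V := (1 - clip t) *: set_val v + clip t *: set_val w.
  have ccl : continuous (fun t : R => clip t) by apply: (@cont_clip _ _ id); exact: cont_id.
  have cG : continuous G by apply: comb_cont; cont.
  exists (fun t => toS (G t)); split.
  - apply: toS_cont => // t; rewrite /G nrm2_comb !nrm2S.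
    have /andP[] := clip01 t; move: (clip t) (inner _ _) vw => c b vw t0 t1.
    (* The squared norm on the segment as a sum of two nonnegative terms; for [b] above -1 they do
       not vanish together. *)
    have -> : (1 - c) ^+ 2 * 1 + c ^+ 2 * 1 + 2 * (1 - c) * c * b =
      (1 - 4 * (c * (1 - c))) + 2 * (c * (1 - c) * (1 + b)) by ring.
    have d0 : 0 <= c * (1 - c) by apply: mulr_ge0; lra.
    have d1 : c * (1 - c) <= 4^-1 by have := sqr_ge0 (1 - 2 * c); nra.
    have [e|ne] := eqVneq (c * (1 - c)) 0; first by rewrite e; apply: lt0r_neq0; lra.
    have : 0 < c * (1 - c) * (1 + b) by apply: mulr_gt0; [rewrite lt_def ne|lra].
    by move=> ?; apply: lt0r_neq0; lra.
  - by rewrite /G clip0 subr0 scale0r addr0 scale1r toS_val.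
  - by rewrite /G clip1 subrr scale0r add0r scale1r toS_val.
have e1P : sphere R k (\row_(i < k.+1) ((i == 1%N :> nat)%:R : R)).
  rewrite /sphere /= (bigD1 (inord 1)) //= mxE inordK // expr1n big1 ?addr0 // => i i1.
  rewrite mxE; case: eqP => [ii|_]; last by rewrite expr0n.
  by case/eqP: i1; apply/val_inj; rewrite /= ii inordK.
pose e1 := mkS e1P.
have [p [cp p0 p1]] : exists p : R -> S, [/\ continuous p, p 0 = Se & p 1 = e1].
  by apply: seg; rewrite inner_e mxE /=; lra.
have [[]|sn] := pselect (-1 < s0).
  by move=> h; apply: seg; rewrite inner_e.
have tail : s0 ^+ 2 + \sum_(i < k) (set_val s ord0 (lift ord0 i)) ^+ 2 = 1.
  by rewrite -(SphP s) [RHS]big_ord_recl.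
have [q [cq q0 q1]] : exists p : R -> S, [/\ continuous p, p 0 = e1 & p 1 = s].
  apply: seg.
  have t0 : \sum_(i < k) (set_val s ord0 (lift ord0 i)) ^+ 2 = 0.
    apply/eqP; rewrite eq_le; apply/andP; split; last first.
      by apply: sumr_ge0 => i _; exact: sqr_ge0.
    by move: sn => /negP; rewrite -leNgt; nra.
  have z i : set_val s ord0 (lift ord0 i) = 0.
    apply/eqP; rewrite -sqrf_eq0; apply/eqP.
    by apply: (psumr_eq0P _ t0) => // *; exact: sqr_ge0.
  rewrite /inner big_ord_recl /= mxE /= mul0r add0r big1; first by lra.
  by move=> i _; rewrite z mulr0.
exists (@Defs.concat R _ p q); split.
- by apply: concat_cont => //; rewrite p1 q0.
- by rewrite concat0.
- by rewrite concat1.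
Qed.

Lemma sphere_compact : compact [set: S].
Proof.
have cS : compact (sphere R k).
  apply: bounded_closed_compact.
    exists 1; split=> // M M1 v vS /=.
    rewrite /Num.norm /= mx_normrE; apply/bigmax_leP; split=> [|[i j] _ /=]; first by lra.
    rewrite (ord1 i) -ler_sqr ?nnegrE ?normr_ge0 //; last by lra.
    rewrite real_normK ?num_real //; apply: (@le_trans _ _ 1); last by nra.
    rewrite -vS (bigD1 j) //= lerDl; apply: sumr_ge0 => l _; exact: sqr_ge0.
  rewrite (_ : sphere R k = nrm2 @^-1` [set 1]); last by rewrite predeqE.
  apply: closed_comp => [v _|]; last exact: closed_eq.
  by apply: (nrm2_cont (f := id)); exact: cont_id.
move=> F FF FT.
have [|v [vS clv]] := cS (fmap (set_val : S -> V) F) _.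
  by apply: (@filterS _ F _ setT) => // s _; exact: SphP.
exists (mkS vS); split=> // P Q FP [_ [[B oB <-] Bv] BQ].
have [|_ [[s Ps <-] Bs]] := clv (set_val @` P) B _ (nbhs_open oB Bv).
  by apply: (@filterS _ F _ P) => // s Ps; exists s.
by exists s; split=> //; exact: BQ.
Qed.

(** Finite $1/(m+1)$-nets for all [m] are listed in one sequence by coding pairs. This yields the
    countability of the supports. *)
Lemma sph_dense : exists q : nat -> S, forall O : set S, open O -> O !=set0 -> exists i, O (q i).
Proof.
have fin (m : nat) : exists ls : seq S, forall s : S, exists2 s' : S, s' \in ls &
    ball (set_val s') (m.+1%:R^-1 : R) (set_val s).
  have [|ls lsP] := @compact_fin_cover S [set: S] S
    (fun s' => [set s | ball (set_val s') (m.+1%:R^-1 : R) (set_val s)]) sphere_compact _.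
    move=> s _; exists s; apply: (@set_val_cont _ (sphere R k)).
    by apply: nbhsx_ballx; rewrite invr_gt0.
  by exists ls => s; case: (lsP s I) => s' s'l ss'; exists s'.
have /choice [ls lsP] := fin.
exists (fun i => let mi := odflt (0%N, 0%N) (choice.unpickle i) in nth Se (ls mi.1) mi.2).
move=> O [B oB <-] [s /= Bs].
have := nbhs_open oB Bs => /nbhs_ballP[d /= d0 dB].
have [m md] : exists m : nat, (m.+1%:R^-1 : R) < d.
  exists (Num.trunc d^-1); rewrite invf_plt ?posrE //.
  by rewrite truncnS_gt.
have [s' s'l bs] := lsP m s.
exists (choice.pickle (m, index s' (ls m))); rewrite choice.pickleK /= nth_index //.
by apply: dB; apply: ball_sym; apply: le_ball bs; exact: ltW.
Qed.

End Sphere.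

(** * Elements of the image *)

Lemma inj_notin_seq (T : eqType) (e : nat -> T) (ls : seq T) : injective e ->
  exists N, forall i, (N <= i)%N -> e i \notin ls.
Proof.
move=> ei; elim: ls => [|l ls [N NP]]; first by exists 0%N.
have [[i il]|n] := pselect (exists i, e i = l).
  exists (maxn N i.+1) => i'; rewrite geq_max => /andP[Ni ii].
  rewrite inE negb_or NP // andbT -il; apply/eqP => /ei e'.
  by rewrite e' ltnn in ii.
exists N => i Ni; rewrite inE negb_or NP // andbT; apply/eqP => e'.
by apply: n; exists i.
Qed.

Section Image.
Variable R : realType.
Variables (X : pseudoMetricType R) (A : nat -> topologicalType).
Variables (x : nat -> X) (a : forall j, A j) (y0 : X).
Hypothesis hX : hausdorff_space X.
Hypothesis hA : forall j, hausdorff_space (A j).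
Hypothesis scA : forall j, seq_connected R 1 (A j) (a j).
Local Notation Y := (Adj X A x a).
Local Notation Yt := (Ytilde R X A x a y0).
Local Notation concat := (@Defs.concat R _).
Local Notation ptil := (ptil R X A x a y0).
Local Notation Acal := (Acal R X A x a y0).
Local Notation Xt := (Xtilde R X A x a y0).
Local Notation uA j := (unio X A x a j).
Implicit Types (e d : R -> Y) (z w : Yt) (U : set Y).

(** Whiskers at [z] are restricted to paths whose projection to [X] stays in a set [B] with closure
    in the trace of [U]. A point [w] of their closure is reached from [z] by such a path and then
    the reverse of a whisker at [w]. That whisker may use [U], because [ptil w] is a point of [X] in
    the closure of [B]. *)
Lemma Xt_regular z (O : set Yt) : Xt z -> nbhs z O ->
  exists P, [/\ open P, P z & forall w, closure P w -> Xt w -> O w].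
Proof.
move=> [u pz] /nbhs_Yt[U [oU Uz UO]].
have nU : nbhs u (inX @^-1` U : set X).
  by apply: inX_cont; rewrite -[inX u]pz; exact: nbhs_open.
have [B nB BU] := @uniform_regular X u _ nU.
pose U' := U `&` ((@pX X A x a) @^-1` B^°).
have oU' : open U'.
  apply: openI => //; apply: (iffLR (continuousP _) (@pX_cont X A x a)).
  exact: open_interior.
have U'z : U' (ptil z) by split=> //; rewrite pz; exact: nB.
pose Q : set Yt := [set w | exists e, [/\ continuous e, e 0 = ptil z,
  forall t, 0 <= t <= 1 -> U' (e t) & w = ext z e]].
have nQ : nbhs z Q by apply/nbhs_Yt; exists U'; split=> // e *; exists e.
exists Q^°; split; [exact: open_interior|exact: nQ|].
move=> w /(closure_subset (@interior_subset _ Q)) clw [v pw].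
have Bv : closure B v.
  move=> W nW; have [|_ [[e [ce e0 eU ->]] /=]] := clw ((@pX X A x a \o ptil) @^-1` W).
    apply: (cont_comp (@ptil_cont R X A x a y0) (@pX_cont X A x a)).
    by rewrite pw.
  rewrite ptil_ext // => We; exists (pX (e 1)); split=> //.
  have [_ /interior_subset] := eU 1 (introT andP (conj ler01 (lexx 1))).
  exact.
have Uw : U (ptil w) by rewrite pw; exact: BU.
have [|_ [[e [ce e0 eU ->]] [d [cd d0 dU we]]]] := clw
    [set w' | exists e, [/\ continuous e, e 0 = ptil w,
      forall t, 0 <= t <= 1 -> U (e t) & w' = ext w e]].
  by apply/nbhs_Yt; exists U; split=> // e *; exists e.
have [wE r0] := ext_revp_eq cd d0 we.
rewrite wE; have cr := revp_cont cd.
rewrite ptil_ext // in r0.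
rewrite ext_ext //; apply: UO.
- by apply: concat_cont.
- by rewrite concat0.
- move=> t t01; rewrite /Defs.concat; case: leP => t2.
    have h : 0 <= 2 * t <= 1 by move: t01; lra.
    by have [] := eU _ h.
  by apply: dU; move: t01; lra.
Qed.

Lemma Xt_closed : closed Xt.
Proof.
rewrite (_ : Xt = ~` \bigcup_j (ptil @^-1` UA j)).
  apply: open_closedC; apply: bigcup_open => j _.
  by apply: (iffLR (continuousP _) (@ptil_cont R X A x a y0)); exact: UA_open.
rewrite predeqE => z; split=> [[u pz] [j _]|n]; first by rewrite /= pz; exact: UA_inX.
exists (pX (ptil z)); apply: notUA => j Uj; apply: n; by exists j.
Qed.

Lemma closure_Xt_compact (C : set Yt) : compact C -> C `<=` Xt ->
  compact (closure C `&` Xt).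
Proof.
move=> cC CX F FF FB.
(* Members of [F] may miss [C], but their open neighbourhoods meet it whenever the member meets
   [closure C]; the traces on [C] generate [GG]. *)
pose GG := filter_from [set P : set Yt | exists2 Q, F Q & open P /\ Q `<=` P]
  (fun P => C `&` P).
have GF : Filter GG.
  apply: filter_from_filter.
    by exists setT; exists setT; [exact: filterT|split=> //; exact: openT].
  move=> P P' [Q FQ [oP QP]] [Q' FQ' [oP' QP']]; exists (P `&` P').
    exists (Q `&` Q'); first exact: filterI.
    by split; [exact: openI|move=> w [/QP ? /QP' ?]].
  by move=> w [Cw [Pw P'w]].
have PG : ProperFilter GG.
  apply: filter_from_proper => // P [Q FQ [oP QP]].
  have [w [Qw [clw _]]] := filter_ex (filterI FQ FB).
  have [w' [Cw' Pw']] := clw P (nbhs_open oP (QP w Qw)).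
  by exists w'.
have GC : GG C.
  exists setT; last by move=> w [].
  by exists setT; [exact: filterT|split=> //; exact: openT].
have [p [Cp clp]] := cC GG PG GC.
exists p; split; first by split; [exact: subset_closure|exact: CX].
(* If [Q] and [N] were disjoint, the complement of [closure P] would be an open neighbourhood of a
   member of [F], so its trace would belong to [GG], which clusters at [p]. *)
move=> Q N FQ nN; have [P [oP Pp PN]] := Xt_regular (CX _ Cp) nN.
apply: contrapT => QN.
have [|w [[Cw clPw] Pw]] := clp (C `&` ~` closure P) P _ (nbhs_open oP Pp).
  exists (~` closure P) => //; exists (Q `&` (closure C `&` Xt)); first exact: filterI.
  split; first by apply: closed_openC; exact: closed_closure.
  move=> w [Qw [clw Xw]] clPw; apply: QN; exists w; split=> //; exact: PN.
by apply: clPw; exact: subset_closure.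
Qed.

(** A representative of [w] is cut by [last_exit]; its first part represents [z]. *)
Lemma Acal_ex j w : UA j (ptil w) -> exists z, ptil z = inX (x j) /\ Acal j z w.
Proof.
move=> Uw; have cr := @rep_cont R X A x a y0 w.
have n0 : ~ UA j (rep w 0) by rewrite rep0; exact: UA_inX.
have U1 : UA j (rep w 1) by rewrite rep1.
have [d [c [[cd cc] [d0 d1] [c0 c1] h _]]] := last_exit hX hA cr n0 U1.
have d0' : d 0 = inX y0 by rewrite d0 rep0.
have pd := isPath_cont cd.
have pz : ptil (cls y0 d) = inX (x j) by rewrite (ptilE pd (clsE pd d0')).
exists (cls y0 d); split=> //; apply/(AcalP _ pz); exists c; split=> //.
have cic : continuous (inA j \o c : R -> Y) by apply: (cont_comp cc); exact: inA_cont.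
have ic0 : (inA j \o c) 0 = ptil (cls y0 d) by rewrite /= c0 inA_bp.
apply: Yt_eq; rewrite (extP cic ic0 pd (clsE pd d0')) repE.
by apply/phclassP => //; exact: isPath_cont.
Qed.

(** A whisker at [w] inside [UA j] is a path in [A j], so it merely prolongs the path in [A j] that
    leads from [z] to [w]. *)
Lemma Acal_open j z w : ptil z = inX (x j) -> UA j (ptil w) -> Acal j z w ->
  \forall w' \near w, UA j (ptil w') /\ Acal j z w'.
Proof.
move=> pz Uw /(AcalP _ pz)[c [cc c0 wE]].
have cic : continuous (inA j \o c : R -> Y).
  by apply: (cont_comp cc); exact: inA_cont.
have ic0 : (inA j \o c) 0 = ptil z by rewrite /= c0 inA_bp.
have pw : ptil w = inA j (c 1) by rewrite wE ptil_ext.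
apply/nbhs_Yt; exists (UA j); split=> //; first exact: UA_open.
move=> e ce e0 eU; split.
  by rewrite ptil_ext //; apply: eU; rewrite ler01 lexx.
pose e' t := uA j (e (clip t)).
have cec : continuous (fun t => e (clip t)).
  by apply: cont_comp => //; apply: (@cont_clip _ _ id); exact: cont_id.
have ce' : continuous e' by apply: (cont_comp cec); exact: uA_cont.
have e'0 : e' 0 = c 1 by rewrite /e' clip0 e0 pw uA_inA.
apply/(AcalP _ pz); exists (concat c e'); split.
- exact: concat_cont.
- by rewrite concat0.
- rewrite concat_comp -ext_ext //.
  + rewrite -wE; apply: ext_hom => //.
      by apply: (cont_comp ce'); exact: inA_cont.
    apply: phom_eqI => // s s01; rewrite /= /e' clip_id // uA_neq //.
    exact: eU.
  + by apply: (cont_comp ce'); exact: inA_cont.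
  + by rewrite /= e'0.
Qed.

Lemma rtil_in j z w : Acal j z w -> rtil R X A x a y0 j z w = w.
Proof. by move=> h; rewrite /rtil; case: pselect. Qed.

Lemma rtil_out j z w : ~ Acal j z w -> rtil R X A x a y0 j z w = z.
Proof. by move=> h; rewrite /rtil; case: pselect. Qed.

(** * From a map of the sphere to the two conditions *)

Section Forward.
Variables (n : nat) (f : Sph R n -> Yt).
Hypothesis n0 : (0 < n)%N.
Hypothesis cf : continuous f.
Hypothesis f_bp : forall s, sph_bp R n s -> f s = @Yt0 R X A x a y0.

Let u j s := uA j (ptil (f s)).
(** The point over [x j] from which [f s] is reached within [A j]. Where [u j] differs from [a j] it
    exists, is unique by [Acal_eq], and is locally constant. *)
Let lab j s : Yt := xget (@Yt0 R X A x a y0) [set z | ptil z = inX (x j) /\ Acal j z (f s)].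
Let m j z := piece (a j) (u j) (lab j) z.

Let cu j : continuous (u j).
Proof.
apply: (cont_comp (f := fun s => ptil (f s))); last exact: uA_cont.
exact: cont_comp cf (@ptil_cont R X A x a y0).
Qed.

Let labP j s : u j s <> a j -> ptil (lab j s) = inX (x j) /\ Acal j (lab j s) (f s).
Proof.
move=> /Acal_ex[z zP]; rewrite /lab; case: xgetP => [z' _ //|/(_ z)]; by case.
Qed.

Let lab_uniq j s z : u j s <> a j -> ptil z = inX (x j) -> Acal j z (f s) -> lab j s = z.
Proof.
move=> us pz Az; have [pl Al] := labP us.
exact: (Acal_eq hX hA scA pl pz Al Az).
Qed.

Let olab j z : open [set s | u j s <> a j /\ lab j s = z].
Proof.
rewrite openE => s [us ls]; have [pl Al] := labP us.
have no : nbhs s (f @^-1` [set w | UA j (ptil w) /\ Acal j (lab j s) w]).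
  by apply: cf; exact: Acal_open.
move: no; rewrite /interior; apply: filterS => s' [us' As']; split=> //.
by rewrite -ls; exact: lab_uniq.
Qed.

Let m_cont j z : continuous (m j z).
Proof. by apply: piece_cont; [exact: cu|exact: olab]. Qed.

Let m_bp j z s : sph_bp R n s -> m j z s = a j.
Proof.
by move=> /f_bp fs; rewrite /m /piece /u fs ptil_Yt0 uA_inX; case: ifP.
Qed.

Let PhiE j z : ptil z = inX (x j) ->
  uA j \o ptil \o rtil R X A x a y0 j z \o f = m j z.
Proof.
move=> pz; apply/funext => s; rewrite /= /m /piece.
have [As|nAs] := pselect (Acal j z (f s)).
  rewrite rtil_in // -/(u j s).
  have [->|us] := pselect (u j s = a j); first by rewrite if_same.
  by rewrite (lab_uniq us pz As) eqxx.
rewrite rtil_out // pz uA_inX.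
have [->|us] := pselect (u j s = a j); first by rewrite if_same.
by case: eqP => // e; have [_] := labP us; rewrite e.
Qed.

Let supp_lab (g : forall j, Yt -> set (Sph R n -> A j)) j z :
  (forall j z, ptil z = inX (x j) -> g j z = Phi_comp R X A x a y0 n f j z) ->
  supp_j R X A x a y0 n g j z -> exists s, u j s <> a j /\ lab j s = z.
Proof.
move=> gE [pz gz]; apply: contrapT => h; apply: gz.
rewrite (gE _ _ pz) /Phi_comp PhiE //; congr (hclass R _ _ _).
apply/funext => s; apply: contrapT => ms; apply: h.
by exists s; exact: piece_neq ms.
Qed.

(** On a path in the sphere from the base point to [s0], let [w0] be the image of the last point
    outside [O]. It lies over [x j] and is a limit of points of [Acal j z]. A whisker from [w0] to
    such a point, inside [U], is cut where it finally enters [A j]; the first part leads to [z], so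
    its reverse shows that [w0] lies in the given neighbourhood of [z]. *)
Let lab_closure j s0 : u j s0 <> a j ->
  closure [set f s | s in [set s | Xt (f s)]] (lab j s0).
Proof.
move=> us0; set z := lab j s0; have [pz Az] := labP us0.
have [p [cp p0 p1]] := sph_path s0 n0.
pose O := [set s | u j s <> a j /\ lab j s = z].
have oO : open (p @^-1` O) by apply: (iffLR (continuousP _) cp); exact: olab.
have nO0 : ~ (p @^-1` O) 0.
  by rewrite /= p0 => -[]; rewrite /u f_bp // ptil_Yt0 uA_inX.
have O1 : (p @^-1` O) 1 by rewrite /= p1.
have [r0 [/andP[r00 r01] nO aft]] := last_out oO nO0 O1.
pose w0 := f (p r0).
have cfp : continuous (f \o p) by exact: cont_comp.
have hit W : nbhs w0 W -> exists2 r, O (p r) & W (f (p r)).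
  move=> nW; have nr : nbhs r0 ((f \o p) @^-1` W) by exact: cfp.
  move: nr => /nbhs_ballP[d /= d0 dP].
  pose q := Num.min (r0 + d / 2) 1.
  have sq : r0 < q by rewrite /q lt_min r01 andbT; lra.
  have qd : q <= r0 + d / 2 by rewrite /q ge_min lexx.
  exists q; first by apply: aft; rewrite sq /q ge_min lexx orbT.
  by apply: dP; rewrite /ball /= ler0_norm; lra.
(* Otherwise the label would be constant near the parameter [r0], hence equal to [z], and [p r0]
   would lie in [O]. *)
have nU : ~ UA j (ptil w0).
  move=> Uw; have [pl Al] := labP (s := p r0) Uw.
  have [r [ur lr] [_ Ar]] := hit _ (Acal_open pl Uw Al).
  apply: nO; split=> //; rewrite -lr; apply/esym; exact: lab_uniq.
have pw0 : ptil w0 = inX (x j).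
  apply: closure_UA => // W nW.
  have [r [ur _] Wr] := hit _ (ptil_cont nW).
  by exists (ptil (f (p r))).
move=> W nW; have [U [oU Uz UW]] := iffLR (nbhs_Yt _ _) nW.
have [|r [ur lr] [e [ce e0 eU fe]]] := hit
    [set w' | exists e, [/\ continuous e, e 0 = ptil w0,
      forall t, 0 <= t <= 1 -> U (e t) & w' = ext w0 e]].
  by apply/nbhs_Yt; exists U; split=> // [|e *]; [rewrite pw0 -pz|exists e].
have [_ Ar] := labP ur; rewrite lr in Ar.
have [c [cc c0 fc]] := iffLR (AcalP _ pz) Ar.
have Ue1 : UA j (e 1) by rewrite -(ptil_ext ce e0) -fe.
have Ue0 : ~ UA j (e 0) by rewrite e0.
have [d [c' [[cd cc'] [d0 d1] [c'0 c'1] h dU]]] := last_exit hX hA ce Ue0 Ue1.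
have cic : continuous (inA j \o c' : R -> Y) by apply: (cont_comp cc'); exact: inA_cont.
have ic0 : (inA j \o c') 0 = d 1 by rewrite /= c'0 inA_bp.
have d0' : d 0 = ptil w0 by rewrite d0.
have zE : z = ext w0 d.
  apply: (ext_inA_inj hX hA scA pz _ cc cc' c0 c'0); first by rewrite ptil_ext.
  rewrite -fc fe ext_ext //; apply: ext_hom => //.
  exact: concat_cont.
have [w0E rv0] := ext_revp_eq cd d0' zE.
exists w0; split; first by exists (p r0) => //; exists (x j).
rewrite w0E; apply: UW => //; first exact: revp_cont.
by move=> t /andP[t0 t1]; apply: (dU U eU); apply/andP; split; lra.
Qed.

Lemma image_fwd (g : forall j, Yt -> set (Sph R n -> A j)) :
  (forall j z, ptil z = inX (x j) -> g j z = Phi_comp R X A x a y0 n f j z) ->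
  compact (closure (supp R X A x a y0 n g) `&` Xt) /\
    forall j,
      finite_set (supp_j R X A x a y0 n g j) \/
      exists e : nat -> Yt,
        [/\ injective e, range e = supp_j R X A x a y0 n g j &
          exists h : Hw R n -> A j,
            based_map (Hw_bp R n) (a j) h /\
            forall i, g j (e i) = hclass R (sph_bp R n) (a j) (h \o ell R n i)].
Proof.
move=> gE; split.
  pose C := [set f s | s in [set s | Xt (f s)]].
  have cC : compact C.
    apply: (continuous_compact (f := f)).
      by apply: continuous_subspaceT; exact: cf.
    apply: (subclosed_compact (B := setT)) => //; last exact: sphere_compact.
    by apply: closed_comp => [s _|]; [exact: cf|exact: Xt_closed].
  have CX : C `<=` Xt by move=> _ [s Xs <-].
  apply: (subclosed_compact _ (closure_Xt_compact cC CX)).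
    by apply: closedI; [exact: closed_closure|exact: Xt_closed].
  apply: setSI; rewrite [X in _ `<=` X](iffLR (closure_id _) (@closed_closure _ C)).
  apply: closure_subset => z [j zj].
  have [|s [us <-]] := supp_lab gE (j := j) (z := z); first exact: zj.
  exact: lab_closure.
move=> j; have [fin|infin] := pselect (finite_set (supp_j R X A x a y0 n g j)).
  by left.
right; have [q qP] := @sph_dense R n.
have cS : countable (supp_j R X A x a y0 n g j).
  apply: (@sub_countable _ _ _ [set lab j (q i) | i in [set: nat]]).
    apply: subset_card_le => z /(supp_lab gE)[s [us ls]].
    have [i [_ li]] := qP _ (@olab j z) (ex_intro _ s (conj us ls)).
    by exists i.
  exact: card_image_le.
have [e] : exists e : nat -> Yt, injective e /\ range e = supp_j R X A x a y0 n g j.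
  have /card_bijP[b [b' bK b'K]] := card_esym (eq_card_nat cS infin).
  exists (fun i => set_val (b (exist _ i (mem_set I)))); split.
    by move=> i i' /val_inj/(can_inj bK) [].
  rewrite predeqE => z; split=> [[i _ <-]|sz]; first exact: (set_mem (valP (b _))).
  exists (set_val (b' (exist _ z (mem_set sz)))) => //.
  rewrite (_ : exist _ _ _ = b' (exist _ z (mem_set sz))) ?b'K //.
  exact: val_inj.
case=> ei er; exists e; split=> //.
have ms i : supp_j R X A x a y0 n g j (e i) by rewrite -er; exists i.
have hE i : wmap (a j) (fun i => m j (e i)) \o ell R n i = m j (e i).
  by apply/funext => s; apply: wmap_ell; exact: m_bp.
(* The pieces of [f] in the order of [e]. By [piece_small] and injectivity of [e], a neighbourhood
   of [a j] contains all but finitely many of them. *)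
exists (wmap (a j) (fun i => m j (e i))); split.
  split; last by move=> w ->.
  apply: wmap_cont => [i|i s|V oV Va]; [exact: m_cont|exact: m_bp|].
  have [ls lsP] := piece_small (@cu j) (@olab j) (@sphere_compact R n) oV Va.
  have [N NP] := inj_notin_seq ls ei.
  exists N => i Ni s; apply: contrapT => nV; have := NP i Ni => /negP; apply.
  have mt : m j (e i) s <> a j by move=> h; apply: nV; rewrite h.
  have [us <-] := piece_neq mt; apply: lsP => // Vu; apply: nV.
  by rewrite /m /piece; case: ifP.
move=> i; rewrite hE gE; last exact: (ms i).1.
by rewrite /Phi_comp PhiE //; exact: (ms i).1.
Qed.

End Forward.

End Image.

(** * A walk through a compact set *)

Section LoopTree.
Variables (R : realType) (T : topologicalType) (S : set T).
(** [E] plays the role of a countable base of a uniformity on [S], where composition costs one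
    index, and [link] is uniform local path connectedness. It is applied to $\widetilde X$ with the
    relations [near_by]. *)
Variable E : nat -> T -> T -> Prop.
Hypothesis ErS : forall m z w, E m z w -> S z.
Hypothesis Er : forall m z, S z -> E m z z.
Hypothesis Es : forall m z w, E m z w -> E m w z.
Hypothesis Et : forall m z w v, E m.+1 z w -> E m.+1 w v -> E m z v.
Hypothesis nbE : forall z O, S z -> nbhs z O -> exists m, forall w, E m z w -> O w.
Hypothesis nbS : forall z m, S z -> nbhs z [set w | S w -> E m z w].
Hypothesis link : forall m z w, E m z w -> exists P : R -> T,
  [/\ continuous P, P 0 = z, P 1 = w & forall s t, E m (P s) (P t)].
Variables (K : set T) (r0 : T) (d : nat -> T).
Hypothesis cK : compact K.
Hypothesis KS : K `<=` S.
Hypothesis Kr0 : K r0.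
Hypothesis Kd : forall k, K (d k).
Hypothesis KE0 : forall z w, K z -> K w -> E 0 z w.
Local Notation concat := (@Defs.concat R _).

Let Em m z w : E m.+1 z w -> E m z w.
Proof. by move=> zw; apply: (Et zw (Er _ (ErS (Es zw)))). Qed.

Let Ele m m' z w : (m <= m')%N -> E m' z w -> E m z w.
Proof.
elim: m' => [|m' IH]; first by rewrite leqn0 => /eqP ->.
rewrite leq_eqVlt => /orP[/eqP -> //|]; rewrite ltnS => mm' /Em; exact: IH.
Qed.

Definition small m (B : set T) := forall z w, B z -> B w -> E m z w.

(** Finite covers by [m]-small sets, for all [m], are put into one sequence by coding pairs.
    Splitting [K] successively along this sequence makes the parts [m]-small below some depth, for
    every [m]. *)
Lemma small_cover : exists B : nat -> set T, forall m, exists M, forall z, K z ->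
  exists i, [/\ (i < M)%N, B i z & small m (B i)].
Proof.
have fin m : exists ls : seq T, forall z, K z -> exists2 c, c \in ls & E m.+1 c z.
  have [|ls lsP] := @compact_fin_cover T K T (fun c => [set w | S w -> E m.+1 c w]) cK.
    by move=> z Kz; exists z; apply: nbS; exact: KS.
  by exists ls => z Kz; case: (lsP z Kz) => c cl cz; exists c => //; exact: cz (KS Kz).
have /choice [ls lsP] := fin.
exists (fun i => let mk := odflt (0%N, 0%N) (choice.unpickle i) in
  [set w | E mk.1.+1 (nth r0 (ls mk.1) mk.2) w]).
move=> m; exists (\max_(k < size (ls m)) choice.pickle (m, k : nat)).+1 => z Kz.
have [c cl cz] := lsP m z Kz.
have ci : (index c (ls m) < size (ls m))%N by rewrite index_mem.
exists (choice.pickle (m, index c (ls m))); rewrite choice.pickleK /= nth_index //.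
split=> //; first by rewrite ltnS; exact: (leq_bigmax (Ordinal ci)).
by move=> w v cw cv; apply: Et (Es cw) cv.
Qed.

Let B := sval (cid small_cover).

(** The head of a word is the latest choice, and the depth is the index of the set that splits the
    cell. An empty part is replaced by the whole cell, so that every cell has a representative. *)
Fixpoint cell (w : seq bool) : set T :=
  if w is b :: w' then
    let C := if b then cell w' `&` B (size w') else cell w' `\` B (size w') in
    if pselect (C !=set0) then C else cell w'
  else K.

Lemma cell_sub b w : cell (b :: w) `<=` cell w.
Proof.
by rewrite /=; case: b; case: pselect => h //=.
Qed.

Lemma cell_K w : cell w `<=` K.
Proof. by elim: w => [//|b w IH] z /cell_sub/IH. Qed.

Lemma cell_neq0 w : cell w !=set0.
Proof. by elim: w => [|b w IH] /=; [exists r0|case: pselect => h //=]. Qed.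

Lemma cell_child w z : cell w z -> exists b, cell (b :: w) z.
Proof.
move=> wz; have [Bz|Bz] := pselect (B (size w) z).
  by exists true => /=; case: pselect => h //=; by case: h; exists z; split.
by exists false => /=; case: pselect => h //=; by case: h; exists z; split.
Qed.

Lemma cell_word i z : K z -> exists w, size w = i /\ cell w z.
Proof.
move=> Kz; elim: i => [|i [w [wi wz]]]; first by exists [::].
by have [b bz] := cell_child wz; exists (b :: w); split; rewrite //= wi.
Qed.

Lemma cell_dicho w i : (i < size w)%N -> cell w `<=` B i \/ cell w `<=` ~` B i.
Proof.
elim: w => [//|b w IH]; rewrite /= ltnS leq_eqVlt => /orP[/eqP ->|iw].
  case: b {IH}; case: pselect => n /=.
  - by left=> z [].
  - by right=> z wz Bz; apply: n; exists z.
  - by right=> z [].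
  - by left=> z wz; apply: contrapT => Bz; apply: n; exists z.
have [h|h] := IH iw; [left|right] => z /(@cell_sub b); exact: h.
Qed.

Lemma cell_small m : exists M, forall w, (M <= size w)%N -> small m (cell w).
Proof.
have [M MP] := (svalP (cid small_cover)) m; exists M => w Mw.
have [z wz] := cell_neq0 w.
have [i [iM Bz sB]] := MP z (cell_K wz).
have [h|/(_ z wz)//] := cell_dicho (leq_trans iM Mw).
by move=> v v' /h Bv /h Bv'; exact: sB.
Qed.

(** A cell of depth [k.+1] prefers [d k]; so each [d k] represents a cell of a depth that determines
    [k]. *)
Definition rr (w : seq bool) : T :=
  if w is _ :: w' then
    if pselect (cell w (d (size w'))) then d (size w') else xget r0 (cell w)
  else r0.

Lemma cell_rr w : cell w (rr w).
Proof.
case: w => [//|b w]; rewrite /rr; case: pselect => h; first exact: h.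
exact: (xgetPex r0 (cell_neq0 (b :: w))).
Qed.

Lemma edge_ex (bw : bool * seq bool) : exists P : R -> T,
  [/\ continuous P, P 0 = rr bw.2, P 1 = rr (bw.1 :: bw.2) &
   forall m, (m <= size bw.2)%N -> small m (cell bw.2) -> forall s t, E m (P s) (P t)].
Proof.
case: bw => b w /=.
(* The path to the child is as small as the cell permits: it uses the greatest [m], bounded by the
   depth, for which the cell is [m]-small. The bound ensures that a greatest one exists. *)
pose p m := `[< (m <= size w)%N /\ small m (cell w) >].
have p0 : exists m, p m.
  by exists 0%N; apply/asboolP; split=> // z v /cell_K Kz /cell_K Kv; exact: KE0.
have pb m : p m -> (m <= size w)%N by move=> /asboolP[].
case: (ex_maxnP p0 pb) => m /asboolP[mw sm] mmax.
have [P [cP P0 P1 PE]] := link (sm _ _ (cell_rr w) (cell_sub (cell_rr (b :: w)))).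
exists P; split=> // m' m'w sm' s t; apply: Ele (PE s t).
by apply: mmax; apply/asboolP.
Qed.

Let P b w : R -> T := sval (cid (edge_ex (b, w))).

Let P_cont b w : continuous (P b w).
Proof. by rewrite /P; case: cid => ? []. Qed.
Let P0 b w : P b w 0 = rr w.
Proof. by rewrite /P; case: cid => ? []. Qed.
Let P1 b w : P b w 1 = rr (b :: w).
Proof. by rewrite /P; case: cid => ? []. Qed.
Let PE b w m s t : (m <= size w)%N -> small m (cell w) -> E m (P b w s) (P b w t).
Proof. by move=> mw sm; have [_ _ _ h] := svalP (cid (edge_ex (b, w))); exact: h. Qed.

Let PS b w s : S (P b w s).
Proof.
apply: (ErS (m := 0) (w := P b w s)); apply: PE => // z v /cell_K Kz /cell_K Kv.
exact: KE0.
Qed.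

(** A pause on the first quarter, then for each child a trip out along [Q], around by [G] and back.
    Which branch a parameter belongs to does not depend on [G]; this allows walks of different
    depths to be compared. *)
Definition step (r : T) (Q G : bool -> R -> T) : R -> T :=
  concat (concat (cst r) (concat (Q false) (concat (G false) (revp (Q false)))))
         (concat (Q true) (concat (G true) (revp (Q true)))).

Lemma stepP r Q t :
  [\/ forall G, step r Q G t = r,
      exists b s, forall G, step r Q G t = Q b s |
      exists b s, forall G, step r Q G t = G b s].
Proof.
rewrite /step /Defs.concat /revp; case: (t <= _).
  case: (2 * t <= _); first by constructor 1.
  case: (_ <= _); first by constructor 2; exists false; eexists.
  case: (_ <= _); first by constructor 3; exists false; eexists.
  by constructor 2; exists false; eexists.
case: (_ <= _); first by constructor 2; exists true; eexists.
case: (_ <= _); first by constructor 3; exists true; eexists.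
by constructor 2; exists true; eexists.
Qed.

Fixpoint walk (m : nat) (w : seq bool) : R -> T :=
  if m is m'.+1 then step (rr w) (P^~ w) (fun b => walk m' (b :: w))
  else cst (rr w).

Lemma walk01 m w : walk m w 0 = rr w /\ walk m w 1 = rr w.
Proof.
case: m => [//|m]; rewrite /= /step !concat0 !concat1.
by rewrite /revp subrr P0.
Qed.

Lemma walk_cont m w : continuous (walk m w).
Proof.
elim: m w => [|m IH] w /=; first exact: cont_cst.
have loop b : continuous (concat (P b w) (concat (walk m (b :: w)) (revp (P b w)))).
  have [w0 w1] := walk01 m (b :: w).
  have cr : continuous (revp (P b w)) by apply: revp_cont.
  apply: concat_cont => //.
    by apply: concat_cont; rewrite ?w1 /revp ?subr0 ?P1.
  by rewrite concat0 w0 P1.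
apply: concat_cont => //.
  by apply: concat_cont; [exact: cont_cst|exact: loop|rewrite concat0 P0].
by rewrite !concat1 concat0 /revp subrr !P0.
Qed.

Lemma walk_S m w t : S (walk m w t).
Proof.
elim: m w t => [|m IH] w t /=; first by apply: KS; exact: cell_K (cell_rr w).
have [h|[b [s h]]|[b [s h]]] := stepP (rr w) (P^~ w) t; rewrite h //.
by apply: KS; exact: cell_K (cell_rr w).
Qed.

(** Smallness passes to all descendant cells, and an edge is [E M]-close to the representative it
    starts from. So the relations need not be composed along the tree. *)
Lemma walk_near M m w t : (M <= size w)%N -> small M (cell w) ->
  exists2 z, cell w z & E M z (walk m w t).
Proof.
elim: m w t => [|m IH] w t Mw sM /=.
  by exists (rr w); [exact: cell_rr|apply: Er; apply: KS; exact: cell_K (cell_rr w)].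
have [h|[b [s h]]|[b [s h]]] := stepP (rr w) (P^~ w) t; rewrite h.
- by exists (rr w); [exact: cell_rr|apply: Er; apply: KS; exact: cell_K (cell_rr w)].
- by exists (rr w); [exact: cell_rr|rewrite -(P0 b w); exact: PE].
- have [||z wz zE] := IH (b :: w) s; first by rewrite (leq_trans Mw) /=.
    by move=> z v /cell_sub wz /cell_sub wv; exact: sM.
  by exists z => //; exact: cell_sub wz.
Qed.

(** Both walks agree on the common part of the tree. Where the shorter one stops at a cell, the
    longer one moves only near that cell, which is small. *)
Lemma walk_cauchy_aux M m m' w t : (m <= m')%N ->
  (forall w', (size w + m <= size w')%N -> (M < size w')%N /\ small M.+1 (cell w')) ->
  E M (walk m w t) (walk m' w t).
Proof.
elim: m m' w t => [|m IH] m' w t mm' h.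
  have [Mw sM] := h w (eq_leq (addn0 _)).
  have [z wz zE] := walk_near m' t Mw sM.
  by apply: Et zE; apply: sM => //; exact: cell_rr.
case: m' mm' => [//|m']; rewrite ltnS => mm' /=.
have [e|[b [s e]]|[b [s e]]] := stepP (rr w) (P^~ w) t; rewrite !e.
- by apply: Er; apply: KS; exact: cell_K (cell_rr w).
- exact: Er.
- by apply: IH => // w' /= ww'; apply: h; rewrite addnS -addSn.
Qed.

Lemma walk_cauchy M : exists N, forall t m m', (N <= m)%N -> (N <= m')%N ->
  E M (walk m [::] t) (walk m' [::] t).
Proof.
have [N NP] := cell_small M.+1; exists (maxn N M.+1).
move=> t m m' Nm Nm'.
wlog mm' : m m' Nm Nm' / (m <= m')%N => [hw|].
  by have [/hw|/ltnW /hw] := leqP m m'; [apply|move=> h; apply: Es; exact: h].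
apply: walk_cauchy_aux => // w'; rewrite add0n => mw'.
move: Nm; rewrite geq_max => /andP[Nm Mm]; split; first exact: leq_trans mw'.
by apply: NP; exact: leq_trans mw'.
Qed.

(** Parameters on an edge keep their value in all longer walks; elsewhere the value is a
    representative, hence in [K]. The limit is thus the value of a constant tail or a cluster point
    in the compact set [K]. *)
Lemma walk_stable m w t : K (walk m w t) \/
  forall m', (m <= m')%N -> walk m' w t = walk m w t.
Proof.
elim: m w t => [|m IH] w t /=; first by left; exact: cell_K (cell_rr w).
have [e|[b [s e]]|[b [s e]]] := stepP (rr w) (P^~ w) t; rewrite e.
- by left; exact: cell_K (cell_rr w).
- by right=> -[//|m'] _ /=; rewrite e.
- have [Kb|h] := IH (b :: w) s; first by left.
  by right=> -[//|m']; rewrite ltnS => mm' /=; rewrite e; exact: h.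
Qed.

Lemma walk_lim t : exists l, [/\ S l,
  forall M, exists N, forall m, (N <= m)%N -> E M l (walk m [::] t) &
  forall m, (forall m', (m <= m')%N -> walk m' [::] t = walk m [::] t) ->
    l = walk m [::] t].
Proof.
have [[m mc]|nc] := pselect (exists m, forall m', (m <= m')%N -> walk m' [::] t = walk m [::] t).
  exists (walk m [::] t); split; first exact: walk_S.
    by move=> M; exists m => m' /mc ->; apply: Er; exact: walk_S.
  by move=> m' mc'; rewrite -(mc _ (leq_maxl m m')) (mc' _ (leq_maxr m m')).
have wK m : K (walk m [::] t).
  by have [//|h] := walk_stable m [::] t; case: nc; exists m.
have [|l [Kl cl]] := cK (F := (fun m => walk m [::] t) @ \oo) _.
  by apply: (@nearW _ \oo).
have Sl := KS Kl.
exists l; split=> // [M|m mc]; last by case: nc; exists m.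
have [N NP] := walk_cauchy M.+1; exists N => m Nm.
have [|_ [[m' Nm' <-] lE]] := cl [set walk m [::] t | m in [set m | (N <= m)%N]] _ _ (nbS M.+1 Sl).
  by exists N => // m' Nm'; exists m'.
apply: Et (NP t m' m Nm' Nm); apply: lE; exact: walk_S.
Qed.

Let F t : T := sval (cid (walk_lim t)).

Let FS t : S (F t).
Proof. by rewrite /F; case: cid => ? []. Qed.

Let F_stable t m : (forall m', (m <= m')%N -> walk m' [::] t = walk m [::] t) ->
  F t = walk m [::] t.
Proof. by have [_ _ h] := svalP (cid (walk_lim t)); exact: h. Qed.

Let F_unif M : exists N, forall t, E M (F t) (walk N [::] t).
Proof.
have [N NP] := walk_cauchy M.+1; exists N => t.
have [N' NP'] : exists N', forall m, (N' <= m)%N -> E M.+1 (F t) (walk m [::] t).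
  by have [_ h _] := svalP (cid (walk_lim t)); exact: h.
exact: Et (NP' _ (leq_maxr N N')) (NP t _ _ (leq_maxl N N') (leqnn N)).
Qed.

Let F_cont : continuous F.
Proof.
move=> t O nO; have [M MO] := nbE (FS t) nO.
have [N NP] := F_unif M.+2.
have nw : nbhs t (walk N [::] @^-1` [set w | S w -> E M.+2 (walk N [::] t) w]).
  by apply: walk_cont; apply: nbS; exact: walk_S.
suff : nbhs t (F @^-1` O) by [].
apply: filterS nw => t' /= h; apply: MO.
apply: Et (Em (Es (NP t'))).
by apply: Et (NP t) (h (walk_S _ _ _)).
Qed.

(** Start and length of the time interval on which the full walk runs through the subtree at [w]. In
    [step], the subwalk [G true] occupies $[3/4,7/8]$ and [G false] occupies $[3/8,7/16]$. *)
Fixpoint off (w : seq bool) : R * R :=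
  if w is b :: w' then
    let ol := off w' in
    (ol.1 + ol.2 * (if b then 3 / 4 else 3 / 8), ol.2 * (if b then 8^-1 else 16^-1))
  else (0, 1).

Lemma off_bound w : [/\ 0 <= (off w).1, 0 < (off w).2 & (off w).1 + (off w).2 <= 1].
Proof.
elim: w => [|b w [h1 h2 h3]] /=; first by rewrite lexx ltr01 add0r lexx.
by case: b; split; nra.
Qed.

Lemma step_child r Q G b u : 0 < u < 1 ->
  step r Q G ((if b then 3 / 4 else 3 / 8) + (if b then 8^-1 else 16^-1) * u) = G b u.
Proof.
move=> /andP[u0 u1]; rewrite /step /Defs.concat /revp; case: b.
  rewrite ifF; last by apply/negbTE; rewrite -ltNge; lra.
  rewrite ifF; last by apply/negbTE; rewrite -ltNge; lra.
  rewrite ifT; last by lra.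
  by congr (G true _); lra.
rewrite ifT; last by lra.
rewrite ifF; last by apply/negbTE; rewrite -ltNge; lra.
rewrite ifF; last by apply/negbTE; rewrite -ltNge; lra.
rewrite ifT; last by lra.
by congr (G false _); lra.
Qed.

Lemma walk_off m w u : 0 < u < 1 ->
  walk (size w + m) [::] ((off w).1 + (off w).2 * u) = walk m w u.
Proof.
elim: w m u => [|b w IH] m u u01; first by rewrite /= add0n mul1r add0r.
rewrite -[RHS](@step_child (rr w) (P^~ w) (fun b => walk m (b :: w)) b u u01).
set c := if b then 3 / 4 else 3 / 8; set l := if b then 8^-1 else 16^-1.
have -> : (size (b :: w) + m = size w + m.+1)%N by rewrite /= addSnnS.
have -> : (off (b :: w)).1 + (off (b :: w)).2 * u =
    (off w).1 + (off w).2 * (c + l * u) by rewrite /= -/c -/l; ring.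
rewrite (IH m.+1) //; case/andP: u01; rewrite /c /l; case: b {c l}; lra.
Qed.

Lemma walk_hold m w u : 0 < u < 4^-1 -> walk m w u = rr w.
Proof.
case: m => [//|m] /andP[u0 u1]; rewrite /= /step /Defs.concat.
rewrite ifT; last by lra.
by rewrite ifT //; lra.
Qed.

Let seg w t := (off w).1 < t < (off w).1 + (off w).2.
Let hold w t := (off w).1 < t < (off w).1 + (off w).2 / 4.

Let hold_seg w t : hold w t -> seg w t.
Proof. by rewrite /hold /seg; have [h1 h2 h3] := off_bound w; lra. Qed.

Let seg_child b w t : seg (b :: w) t -> seg w t /\ ~~ hold w t.
Proof.
rewrite /hold /seg /=; have [h1 h2 h3] := off_bound w.
move=> /andP[t1 t2]; split; first by case: b t1 t2; nra.
by apply/negP => /andP[t3 t4]; case: b t1 t2; nra.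
Qed.

Let seg_inj w w' t : size w = size w' -> seg w t -> seg w' t -> w = w'.
Proof.
elim: w w' => [|b w IH] [|b' w'] //= [ww'] s s'.
have [sw _] := seg_child s; have [sw' _] := seg_child s'.
have e := IH w' ww' sw sw'; subst w'; congr (_ :: _).
move: s s'; rewrite /seg /=; have [h1 h2 h3] := off_bound w.
by case: b; case: b' => //= /andP[s1 s2] /andP[s3 s4]; exfalso; clear ww'; lra.
Qed.

(** The interval of a child avoids the pause of its parent, and intervals of words of equal length
    are disjoint; so pauses at different depths never overlap. *)
Let hold_size w w' t : hold w t -> hold w' t -> (size w < size w')%N -> False.
Proof.
move=> hw /hold_seg; elim: w' => [//|b w' IH] sw'.
have [s' n'] := seg_child sw'.
rewrite /= ltnS leq_eqVlt => /orP[/eqP ww'|]; last exact: IH.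
by move: n'; rewrite -(seg_inj ww' (hold_seg hw) s') hw.
Qed.

(* The walk visits the compact set [K] by running through the binary tree of
   its cells; it pauses at the representative of a cell when it enters the
   cell, and [d k] represents a cell of depth [k + 1]. *)
Lemma compact_walk : exists (G : R -> T) (lo hi : nat -> R),
  [/\ continuous G /\ G 0 = r0, forall t, S (G t),
      forall k, [/\ 0 <= lo k, lo k < hi k & hi k <= 1],
      forall k t, lo k < t < hi k -> G t = d k &
      forall k k' t, lo k < t < hi k -> lo k' < t < hi k' -> k = k'].
Proof.
have /choice [W WP] : forall k, exists w, size w = k.+1 /\ cell w (d k).
  by move=> k; apply: cell_word.
have rW k : rr (W k) = d k.
  have [sW cW] := WP k; case: (W k) sW cW => [//|b w] [sw] cw.
  by rewrite /rr sw; case: pselect => h.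
exists F, (fun k => (off (W k)).1), (fun k => (off (W k)).1 + (off (W k)).2 / 4).
split=> //.
- split; first exact: F_cont.
  by rewrite (@F_stable _ 0) ?(walk01 0 [::]).1 // => m _; rewrite !(walk01 _ [::]).1.
- by move=> k; have [h1 h2 h3] := off_bound (W k); split; lra.
- move=> k t tk; have [h1 h2 h3] := off_bound (W k).
  pose u := (t - (off (W k)).1) / (off (W k)).2.
  have u4 : 0 < u < 4^-1.
    by rewrite /u ltr_pdivlMr // ltr_pdivrMr // mul0r; lra.
  have u1 : 0 < u < 1 by lra.
  have tE : t = (off (W k)).1 + (off (W k)).2 * u.
    by rewrite /u mulrC divfK ?gt_eqF // addrC subrK.
  have wE m : walk (size (W k) + m) [::] t = d k.
    by rewrite tE walk_off // walk_hold.
  rewrite (@F_stable _ (size (W k) + 0)) ?wE // => m'.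
  by rewrite addn0 => /subnKC <-; rewrite wE.
- move=> k k' t; rewrite -/(hold (W k) t) -/(hold (W k') t) => tk tk'.
  have [sW _] := WP k; have [sW' _] := WP k'.
  have [kk'|k'k|//] := ltngtP k k'.
    by case: (hold_size tk tk'); rewrite sW sW'.
  by case: (hold_size tk' tk); rewrite sW sW'.
Qed.

End LoopTree.

(** * The whisker uniformity *)

Section WhiskerUniformity.
Variable R : realType.
Variables (X : pseudoMetricType R) (A : nat -> topologicalType).
Variables (x : nat -> X) (a : forall j, A j) (y0 : X).
Hypothesis hX : hausdorff_space X.
Hypothesis hA : forall j, hausdorff_space (A j).
Hypothesis scA : forall j, seq_connected R 1 (A j) (a j).
Local Notation Y := (Adj X A x a).
Local Notation Yt := (Ytilde R X A x a y0).
Local Notation concat := (@Defs.concat R _).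
Local Notation ptil := (ptil R X A x a y0).
Local Notation Xt := (Xtilde R X A x a y0).
Local Notation rad k := (2^-1 ^+ k : R).
Implicit Types (z w v : Yt).

(** Paths in [X] are used, so that size is measured by balls of [X]. Index 0 imposes no bound and
    relates all points of $\widetilde X$; index [k.+1] imposes the bound $2^{-k}$, halved at each
    step as [near_by_trans] requires. *)
Definition near_by (m : nat) z w := exists e : R -> X,
  [/\ continuous e, ptil z = inX (e 0), w = ext z (inX \o e) &
      forall k, m = k.+1 -> forall s t, 0 <= s <= 1 -> 0 <= t <= 1 ->
        ball (e s) (rad k) (e t)].

Let inXc (e : R -> X) : continuous e -> continuous (inX \o e : R -> Y).
Proof. by move=> ce; apply: (cont_comp ce); exact: inX_cont. Qed.

Let rad0 k : 0 < rad k. Proof. by rewrite exprn_gt0 // invr_gt0. Qed.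

Let radS k : rad k.+1 + rad k.+1 = rad k.
Proof. by rewrite exprS; lra. Qed.

Let rad_ball k (u v : X) : ball u (rad k.+1) v -> ball u (rad k) v.
Proof. by apply: le_ball; have := radS k; have := rad0 k.+1; lra. Qed.

Lemma near_by_Xt m z w : near_by m z w -> Xt z.
Proof. by move=> [e [_ pz _ _]]; exists (e 0). Qed.

Lemma near_by_refl m z : Xt z -> near_by m z z.
Proof.
move=> [u pz]; exists (cst u); split=> //; first exact: cont_cst.
  by rewrite -[LHS]ext_cst pz.
by move=> k _ s t _ _; exact: ballxx.
Qed.

Lemma near_by_sym m z w : near_by m z w -> near_by m w z.
Proof.
move=> [e [ce pz wE be]]; have cie := inXc ce.
have [zE r0] := ext_revp_eq cie (esym pz) wE.
exists (revp e); split=> //.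
- exact: revp_cont.
- by move=> k mk s t /andP[s0 s1] /andP[t0 t1]; rewrite /revp; apply: (be k mk); apply/andP; split; lra.
Qed.

Lemma near_by_trans m z w v : near_by m.+1 z w -> near_by m.+1 w v -> near_by m z v.
Proof.
move=> [e [ce pz wE be]] [e' [ce' pw vE be']].
have cie := inXc ce; have cie' := inXc ce'.
have e1 : e 1 = e' 0 by apply: (@inX_inj X A x a); rewrite -pw wE ptil_ext.
exists (concat e e'); split.
- exact: concat_cont.
- by rewrite concat0.
- by rewrite vE wE ext_ext -?concat_comp //= e1.
- move=> k mk s t s01 t01.
  have b1 p q : 0 <= p <= 1 -> 0 <= q <= 1 -> ball (e p) (rad k.+1) (e q).
    by apply: be; rewrite mk.
  have b2 p q : 0 <= p <= 1 -> 0 <= q <= 1 -> ball (e' p) (rad k.+1) (e' q).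
    by apply: be'; rewrite mk.
  rewrite /Defs.concat; case: leP => s2; case: leP => t2.
  + by apply/rad_ball/b1; lra.
  + rewrite -radS; apply: (@ball_triangle _ _ (e 1)); first by apply: b1; lra.
    by rewrite e1; apply: b2; lra.
  + rewrite -radS; apply: (@ball_triangle _ _ (e 1)); last by apply: b1; lra.
    by rewrite e1; apply: b2; lra.
  + by apply/rad_ball/b2; lra.
Qed.

Let rad_lt (d : R) : 0 < d -> exists k, rad k < d.
Proof.
move=> d0; have [N _ NP] := near_infty_natSinv_expn_lt (PosNum d0).
by exists N; have := NP N (leqnn N); rewrite /= div1r exprVn.
Qed.

Lemma nbhs_near_by z (O : set Yt) : Xt z -> nbhs z O ->
  exists m, forall w, near_by m z w -> O w.
Proof.
move=> [u pz] /nbhs_Yt[U [oU Uz UO]].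
have : nbhs u (inX @^-1` U : set X).
  by apply: inX_cont; rewrite -[inX u]pz; exact: nbhs_open.
move=> /nbhs_ballP[d /= d0 dU]; have [k kd] := rad_lt d0.
exists k.+1 => w [e [ce pe -> be]]; apply: UO; first exact: inXc.
  by rewrite pe.
have ue : e 0 = u by apply: (@inX_inj X A x a); rewrite -pe.
move=> t t01 /=; apply: dU; apply: (le_ball (ltW kd)).
by rewrite -ue; apply: be => //; rewrite lexx ler01.
Qed.

(** A whisker between points over [X] may pass through the spaces [A j]; by [deform] it can be
    replaced with its projection to [X], which stays in the ball. *)
Lemma near_by_nbhs z m : Xt z -> nbhs z [set w | Xt w -> near_by m z w].
Proof.
move=> [u pz]; case: m => [|k].
  apply/nbhs_Yt; exists setT; split=> //; first exact: openT.
  move=> e ce e0 _ [v pv].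
  have e1 : e 1 = inX v by rewrite -(ptil_ext ce e0).
  have e0' : e 0 = inX u by rewrite e0.
  exists (fun t => pX (e t)); split=> //.
  - exact: cont_comp ce (@pX_cont X A x a).
  - by rewrite e0'.
  - by rewrite (ext_deform hX hA scA ce e0) // ?e0' ?e1.
have oB : open ((@pX X A x a) @^-1` (ball u (rad k.+1))^°).
  apply: (iffLR (continuousP _) (@pX_cont X A x a)); exact: open_interior.
apply/nbhs_Yt; exists ((@pX X A x a) @^-1` (ball u (rad k.+1))^°); split=> //.
  by rewrite pz /=; exact: nbhsx_ballx.
move=> e ce e0 eU [v pv].
have e1 : e 1 = inX v by rewrite -(ptil_ext ce e0).
have e0' : e 0 = inX u by rewrite e0.
exists (fun t => pX (e t)); split=> //.
- exact: cont_comp ce (@pX_cont X A x a).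
- by rewrite e0'.
- by rewrite (ext_deform hX hA scA ce e0) // ?e0' ?e1.
- move=> k' [<-] s t s01 t01; rewrite -radS; apply: (@ball_triangle _ _ u).
    by apply: ball_sym; exact: interior_subset (eU s s01).
  exact: interior_subset (eU t t01).
Qed.

(** The path in the cover sends [s] to the class of [e] restricted to $[0,s]$. Two of its points
    differ by a part of [e], which obeys the same bound. *)
Lemma near_by_link m z w : near_by m z w -> exists P : R -> Yt,
  [/\ continuous P, P 0 = z, P 1 = w & forall s t, near_by m (P s) (P t)].
Proof.
move=> [e [ce pz wE be]].
pose P s := ext z (fun u : R => inX (e (clip s * u)) : Y).
have ces (c : R) : continuous (fun u : R => e (c * u)) by apply: cont_comp => //; cont.
have cE (c c' : R) : continuous (fun u : R => e (c + u * (c' - c))) by apply: cont_comp => //; cont.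
have P0E (c : R) : (fun u : R => inX (e (c * u)) : Y) 0 = ptil z by rewrite mulr0.
have pP (s : R) : ptil (P s) = inX (e (clip s)).
  by rewrite /P ptil_ext ?mulr1 //; exact: inXc.
have PE (s t : R) : P t = ext (P s) (inX \o (fun u : R => e (clip s + u * (clip t - clip s)))).
  have c1 := inXc (ces (clip s)); have c2 := inXc (cE (clip s) (clip t)).
  have j1 : (inX \o (fun u : R => e (clip s + u * (clip t - clip s))) : R -> Y) 0 =
      ((fun u : R => inX (e (clip s * u))) : R -> Y) 1 by rewrite /= mul0r addr0 mulr1.
  rewrite [in RHS]/P ext_ext //; apply/esym.
  pose phi := concat (fun u : R => clip s * u) (fun u : R => clip s + u * (clip t - clip s)).
  have cphi : continuous phi by apply: concat_cont; cont; ring.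
  have -> : concat ((fun u : R => inX (e (clip s * u))) : R -> Y)
      (inX \o (fun u : R => e (clip s + u * (clip t - clip s)))) = (inX \o e) \o phi.
    by rewrite /phi concat_comp.
  apply: ext_hom.
  - by apply: (cont_comp cphi); exact: inXc.
  - exact: inXc (ces (clip t)).
  - by rewrite /phi /= concat0 mulr0.
  - apply: (@phom_reparam _ _ (inX \o e) phi (fun u : R => clip t * u)).
    + exact: inXc.
    + exact: cphi.
    + by cont.
    + by rewrite /phi concat0 !mulr0.
    + by rewrite /phi concat1; ring.
have PN (s t : R) k (r : X) : ptil (P s) = inX r ->
    (forall u : R, 0 <= u <= 1 -> ball r (rad k.+1) (e (clip s + u * (clip t - clip s)))) ->
    near_by k.+1 (P s) (P t).
  move=> _ rb; exists (fun u : R => e (clip s + u * (clip t - clip s))); split=> //.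
    by rewrite pP mul0r addr0.
  move=> k' [<-] p q p01 q01; rewrite -radS; apply: (@ball_triangle _ _ r).
    by apply: ball_sym; exact: rb.
  exact: rb.
exists P; split.
- move=> s O nO; have [|m' mO] := nbhs_near_by _ nO; first by exists (e (clip s)); exact: pP.
  have ccl : continuous (fun t : R => clip t) by apply: (@cont_clip _ _ id); exact: cont_id.
  have : nbhs (clip s) (e @^-1` ball (e (clip s)) (rad m'.+1)) by apply: ce; exact: nbhsx_ballx.
  move=> /nbhs_ballP[d /= d0 dP].
  have nd : nbhs s (@clip R @^-1` ball (clip s) d) by apply: ccl; exact: nbhsx_ballx.
  suff : nbhs s (P @^-1` O) by [].
  apply: filterS nd => t /= bt; apply: mO.
  have bu u : 0 <= u <= 1 -> ball (e (clip s)) (rad m'.+1) (e (clip s + u * (clip t - clip s))).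
    move=> /andP[u0 u1]; apply: dP; move: bt; rewrite /ball /=.
    rewrite opprD addNKr normrN normrM ger0_norm // distrC => bt.
    by have := normr_ge0 (clip t - clip s); nra.
  have [e' [ce' h1 h2 h3]] := PN s t m' _ (pP s) bu.
  exists e'; split=> // k mk p q p01 q01; rewrite mk in h3.
  by apply: rad_ball; exact: (h3 k.+1).
- rewrite /P clip0 -[RHS]ext_cst pz; congr (ext z _).
  by apply/funext => u; rewrite mul0r.
- rewrite /P clip1 wE; congr (ext z _).
  by apply/funext => u; rewrite mul1r.
- move=> s t; exists (fun u : R => e (clip s + u * (clip t - clip s))); split=> //.
    by rewrite pP mul0r addr0.
  move=> k mk p q /andP[p0 p1] /andP[q0 q1].
  have /andP[s0 s1] := clip01 s; have /andP[t0 t1] := clip01 t.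
  by apply: be => //; apply/andP; split; nra.
Qed.

Lemma phom_cst_concat (e : R -> Y) : continuous e -> phom (concat (cst (e 0)) e) e.
Proof.
move=> ce; have := @phom_reparam R Y e (fun s : R => Num.max 0 (2 * s - 1)) id ce.
move=> h; apply: phom_trans; last first.
  apply: h.
  - by cont.
  - exact: cont_id.
  - by rewrite max_l //; lra.
  - by rewrite max_r; lra.
apply: phom_eqI; first by apply: concat_cont => //; exact: cont_cst.
move=> s /andP[s0 s1]; rewrite /= /Defs.concat; have [s2|s2] := leP s 2^-1.
  by rewrite max_l //; lra.
by rewrite max_r //; lra.
Qed.

Lemma ext_Yt0_rep z : ext (@Yt0 R X A x a y0) (rep z) = z.
Proof.
have cr := @rep_cont R X A x a y0 z.
have pc : isPath (cst (inX y0) : R -> Y) by apply: isPath_cont; exact: cont_cst.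
have r0 : rep z 0 = ptil (@Yt0 R X A x a y0) by rewrite rep0 ptil_Yt0.
apply: Yt_eq; rewrite (extP cr r0 pc (Yt0E R x a y0)) repE.
apply/phclassP; last by rewrite -(rep0 z); exact: phom_cst_concat.
by apply/isPath_cont/concat_cont; rewrite ?rep0 //; exact: cont_cst.
Qed.

Lemma near_by0 z w : Xt z -> Xt w -> near_by 0 z w.
Proof.
move=> Xz Xw; have cz := @rep_cont R X A x a y0 z; have cw := @rep_cont R X A x a y0 w.
have p0 v : rep v 0 = ptil (@Yt0 R X A x a y0) by rewrite rep0 ptil_Yt0.
have [e0 r0] := ext_revp_eq cz (p0 z) (esym (ext_Yt0_rep z)).
have crz := revp_cont cz.
have r1 : revp (rep z) 1 = rep w 0 by rewrite /revp subrr !rep0.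
pose e := concat (revp (rep z)) (rep w).
have ce : continuous e by exact: concat_cont.
have eE : ext z e = w.
  by rewrite /e -ext_ext // -e0 ext_Yt0_rep.
have e0E : e 0 = ptil z by rewrite /e concat0.
case: Xz => u pz; case: Xw => v pw.
have e0' : e 0 = inX u by rewrite e0E.
have e1' : e 1 = inX v by rewrite -(ptil_ext ce e0E) eE.
exists (fun t => pX (e t)); split=> //.
- exact: cont_comp ce (@pX_cont X A x a).
- by rewrite e0'.
- by rewrite -[LHS]eE (ext_deform hX hA scA ce e0E) // ?e0' ?e1'.
Qed.

Lemma Xt_walk (K : set Yt) (d : nat -> Yt) : compact K -> K `<=` Xt ->
  K (@Yt0 R X A x a y0) -> (forall k, K (d k)) ->
  exists (G : R -> Yt) (lo hi : nat -> R),
  [/\ continuous G /\ G 0 = @Yt0 R X A x a y0, forall t, Xt (G t),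
      forall k, [/\ 0 <= lo k, lo k < hi k & hi k <= 1],
      forall k t, lo k < t < hi k -> G t = d k &
      forall k k' t, lo k < t < hi k -> lo k' < t < hi k' -> k = k'].
Proof.
move=> cK KX K0 Kd.
apply: (compact_walk near_by_Xt near_by_refl near_by_sym near_by_trans nbhs_near_by
  near_by_nbhs near_by_link cK KX K0 Kd).
by move=> z w /KX Xz /KX Xw; exact: near_by0.
Qed.

End WhiskerUniformity.

(** * Collapsing a slab of the sphere *)

Section Collapse.
Variables (R : realType) (k : nat).
Local Notation V := 'rV[R]_k.+2.
Local Notation S := (Sph R k.+1).
Let i1 : 'I_k.+2 := lift ord0 ord0.

Definition rot (c s : R) (v : V) : V := \row_(i < k.+2)
  if i == ord0 then c * v ord0 ord0 - s * v ord0 i1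
  else if i == i1 then s * v ord0 ord0 + c * v ord0 i1 else v ord0 i.

Lemma nrm2_rot (c s : R) (v : V) : c ^+ 2 + s ^+ 2 = 1 -> nrm2 (rot c s v) = nrm2 v.
Proof.
move=> cs; rewrite /nrm2 !big_ord_recl !mxE /=.
rewrite (eq_bigr (fun i => v ord0 (lift ord0 (lift ord0 i)) ^+ 2)).
  rewrite addrA [RHS]addrA; congr (_ + _).
  set p := v ord0 ord0; set q := v ord0 _.
  transitivity ((c ^+ 2 + s ^+ 2) * (p ^+ 2 + q ^+ 2)); first by ring.
  by rewrite cs mul1r.
by move=> i _; rewrite mxE.
Qed.

Lemma rot_id v : rot 1 0 v = v.
Proof.
apply/rowP => i; rewrite mxE; case: eqP => [->|_]; first by rewrite mul1r mul0r subr0.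
by case: eqP => [->|_] //; rewrite mul1r mul0r add0r.
Qed.

Lemma rot_pole (c s : R) (v : V) : (forall i, i != ord0 -> v ord0 i = 0) ->
  c * v ord0 ord0 = 1 -> s = 0 -> rot c s v = ebase R k.+1.
Proof.
move=> v0 cv ->; apply/rowP => i; rewrite !mxE; case: eqP => [_|/eqP i0].
  by rewrite cv mul0r subr0.
by case: eqP => [ii|_]; [rewrite mul0r add0r v0 ?mulr0|exact: v0].
Qed.

(* At time 1 the map [psi] sends the complement of the slab [a < v_0 < b] into
   the axis through the two poles; a rotation in the first two coordinates, by an angle with cosine
   [v_0], then moves the pole opposite to the base point onto it. *)
Lemma slab_collapse (a b : R) : -1 <= a -> a < b -> b <= 1 ->
  exists H : S * R -> S, [/\ continuous H, forall s, H (s, 0) = s,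
    forall t, H (Se, t) = Se &
    forall s : S, ~ (a < set_val s ord0 ord0 < b) -> H (s, 1) = Se].
Proof.
move=> a1 ab b1; pose mid := (a + b) / 2.
have mid1 : -1 < mid < 1 by rewrite /mid; lra.
(* Positive exactly on $(a,b)$: as the factor of all coordinates but the first at time 1, it makes
   them vanish off the slab. *)
pose nu (y : R) := Num.max 0 ((y - a) * (b - y)).
pose psi (p : S * R) : V := \row_(i < k.+2)
  if i == ord0 then set_val p.1 ord0 ord0 - clip p.2 * mid
  else (1 - clip p.2 + clip p.2 * nu (set_val p.1 ord0 ord0)) * set_val p.1 ord0 i.
have csv i : continuous (fun p : S * R => set_val p.1 ord0 i).
  apply: coord_cont; apply: (cont_comp (f := fst)); [exact: cont_fst|exact: set_val_cont].
have ccl : continuous (fun p : S * R => clip p.2) by apply: cont_clip; exact: cont_snd.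
have cpsi : continuous psi.
  apply: rV_cont => i; have [i0|i0] := eqVneq i ord0.
    rewrite (_ : (fun p => _) = fun p : S * R => set_val p.1 ord0 ord0 - clip p.2 * mid).
      by apply: contD => //; apply: contN; apply: contM => //; exact: cont_cst.
    by apply/funext => p; rewrite mxE i0.
  rewrite (_ : (fun p => _) = fun p : S * R =>
    (1 - clip p.2 + clip p.2 * nu (set_val p.1 ord0 ord0)) * set_val p.1 ord0 i).
    apply: contM => //; apply: contD.
      by apply: contD; [exact: cont_cst|exact: contN].
    apply: contM => //; apply: cont_max; first exact: cont_cst.
    apply: contM; first by apply: contD => //; exact: cont_cst.
    by apply: contD; [exact: cont_cst|exact: contN].
  by apply/funext => p; rewrite mxE (negbTE i0).
have tail (s : S) : \sum_(i < k.+1) (set_val s ord0 (lift ord0 i)) ^+ 2 =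
    1 - (set_val s ord0 ord0) ^+ 2.
  by have := SphP s; rewrite big_ord_recl => <-; rewrite addrC addKr.
have npsi p : nrm2 (psi p) = (set_val p.1 ord0 ord0 - clip p.2 * mid) ^+ 2 +
    (1 - clip p.2 + clip p.2 * nu (set_val p.1 ord0 ord0)) ^+ 2 *
    (1 - (set_val p.1 ord0 ord0) ^+ 2).
  rewrite /nrm2 big_ord_recl mxE /= -tail mulr_sumr; congr (_ + _).
  by apply: eq_bigr => i _; rewrite mxE /= exprMn.
have s01 (s : S) : (set_val s ord0 ord0) ^+ 2 <= 1.
  by rewrite -subr_ge0 -tail; apply: sumr_ge0 => i _; exact: sqr_ge0.
(* A zero would have first coordinate [t * mid], strictly between the poles, so the factor of the
   other coordinates would vanish. That forces [t = 1] and [nu mid = 0], but [mid] is inside the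
   slab. *)
have psi0 p : nrm2 (psi p) != 0.
  rewrite npsi; have := s01 p.1; have /andP[] := clip01 p.2; have /andP[] := mid1.
  move: (clip p.2) (set_val p.1 ord0 ord0) => t y m1 m2 t0 t1 y1.
  have nu0 : 0 <= nu y by rewrite /nu le_max lexx.
  apply/eqP => e.
  have g1 : 0 <= (1 - t + t * nu y) ^+ 2 * (1 - y ^+ 2).
    by apply: mulr_ge0; [exact: sqr_ge0|lra].
  have e1 : (y - t * mid) ^+ 2 = 0 by have := sqr_ge0 (y - t * mid); lra.
  have e2 : (1 - t + t * nu y) ^+ 2 * (1 - y ^+ 2) = 0 by lra.
  have yt : y = t * mid by move/eqP : e1; rewrite sqrf_eq0 => /eqP; lra.
  have y2 : 1 - y ^+ 2 != 0.
    have h1 : -1 < y by rewrite yt; nra.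
    have h2 : y < 1 by rewrite yt; nra.
    by apply: lt0r_neq0; nra.
  move/eqP : e2; rewrite mulf_eq0 (negbTE y2) orbF sqrf_eq0 => /eqP e3.
  have tn : 0 <= t * nu y by exact: mulr_ge0.
  have t1' : t = 1 by lra.
  have : nu y = 0 by move: e3; rewrite t1'; lra.
  rewrite yt t1' mul1r => n0; have : (mid - a) * (b - mid) <= nu mid.
    by rewrite /nu le_max lexx orbT.
  by rewrite n0 /mid; nra.
pose N p := toS (psi p).
have cN : continuous N by exact: toS_cont.
pose y0 p := set_val (N p) ord0 ord0.
have cy : continuous y0 by apply: coord_cont; apply: (cont_comp cN); exact: set_val_cont.
(* The cosine is 1 at time 0 and the first coordinate at time 1. Off the slab that coordinate is
   then 1 or -1, so the final rotation is the identity or a half turn. *)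
pose co p := 1 - clip p.2 + clip p.2 * y0 p.
pose si p := Num.sqrt (1 - co p ^+ 2).
have cco : continuous co.
  apply: contD; last exact: contM.
  by apply: contD; [exact: cont_cst|exact: contN].
have csi : continuous si.
  by apply: sqrt_cont; apply: contD; [exact: cont_cst|apply: contN; exact: contX].
have co1 p : co p ^+ 2 <= 1.
  have := s01 (N p); have /andP[] := clip01 p.2; rewrite /co -/(y0 p).
  move: (clip _) (y0 p) => t y t0 t1 y1.
  have h1 : -1 <= y by nra.
  have h2 : y <= 1 by nra.
  have h3 : -1 <= 1 - t + t * y by nra.
  have h4 : 1 - t + t * y <= 1 by nra.
  by nra.
have cs p : co p ^+ 2 + si p ^+ 2 = 1.
  by rewrite /si sqr_sqrtr; have := co1 p; lra.
pose G p := rot (co p) (si p) (set_val (N p)).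
have nG p : nrm2 (G p) = 1 by rewrite /G nrm2_rot // nrm2S.
have cNi i : continuous (fun p => set_val (N p) ord0 i).
  by apply: coord_cont; apply: (cont_comp cN); exact: set_val_cont.
have cG : continuous G.
  apply: rV_cont => i; have [i0|i0] := eqVneq i ord0.
    rewrite (_ : (fun p => _) =
      fun p => co p * set_val (N p) ord0 ord0 - si p * set_val (N p) ord0 i1).
      by apply: contD; [|apply: contN]; exact: contM.
    by apply/funext => p; rewrite mxE i0.
  have [e|e] := eqVneq i i1.
    rewrite (_ : (fun p => _) =
      fun p => si p * set_val (N p) ord0 ord0 + co p * set_val (N p) ord0 i1).
      by apply: contD; exact: contM.
    by apply/funext => p; rewrite mxE (negbTE i0) e eqxx.
  rewrite (_ : (fun p => _) = fun p => set_val (N p) ord0 i) //.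
  by apply/funext => p; rewrite mxE (negbTE i0) (negbTE e).
have toS_e : toS (ebase R k.+1) = Se by rewrite -[ebase R k.+1]/(set_val (Se : S)) toS_val.
have Npole p : (forall i, i != ord0 -> psi p ord0 i = 0) ->
    (forall i, i != ord0 -> set_val (N p) ord0 i = 0) /\ y0 p ^+ 2 = 1.
  move=> h; have h' i : i != ord0 -> set_val (N p) ord0 i = 0.
    by move=> i0; rewrite /N toSE // mxE h // mulr0.
  split=> //; have := SphP (N p); rewrite big_ord_recl big1 ?addr0 // => i _.
  by rewrite h' // expr0n.
exists (fun p => toS (G p)); split.
- by apply: toS_cont => // p; rewrite nG oner_neq0.
- move=> s; rewrite -[RHS]toS_val /G; congr toS.
  have psi00 : psi (s, 0) = set_val s.
    apply/rowP => i; rewrite mxE /= clip0.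
    by case: eqP => [->|_]; [rewrite mul0r subr0|rewrite subr0 mul0r addr0 mul1r].
  have -> : co (s, 0) = 1 by rewrite /co /= clip0 mul0r addr0 subr0.
  rewrite /si (_ : co (s, 0) = 1); last by rewrite /co /= clip0 mul0r addr0 subr0.
  by rewrite expr1n subrr sqrtr0 rot_id /N psi00 toS_val.
- move=> t; rewrite /G.
  have e0 i : i != ord0 -> set_val (Se : S) ord0 i = 0.
    by move=> i0; rewrite /= mxE (negbTE i0).
  have e1 : set_val (Se : S) ord0 ord0 = 1 by rewrite /= mxE eqxx.
  have [|h1 h2] := Npole (Se, t).
    move=> i i0; rewrite mxE (negbTE i0) -[set_val (Se, t).1]/(set_val (Se : S)).
    by rewrite (e0 i i0) mulr0.
  have yp : 0 < y0 (Se, t).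
    rewrite /y0 /N toSE // mxE; apply: mulr_gt0.
      by rewrite invr_gt0 sqrtr_gt0 lt_def psi0 nrm2_ge0.
    rewrite mxE eqxx e1; have /andP[t0 t1] := clip01 t; have /andP[] := mid1; nra.
  have y1 : y0 (Se, t) = 1 by move: h2 => /eqP; rewrite sqrf_eq1 => /orP[] /eqP //; lra.
  have c1 : co (Se, t) = 1 by rewrite /co y1; ring.
  rewrite rot_pole ?toS_e // ?c1 ?mul1r //.
  by rewrite /si c1 expr1n subrr sqrtr0.
- move=> s sab; rewrite /G.
  have nu0 : nu (set_val s ord0 ord0) = 0.
    rewrite /nu max_l //; move: sab; move: (set_val s ord0 ord0) => y /negP.
    by rewrite negb_and -!leNgt => /orP[] h; nra.
  have [|h1 h2] := Npole (s, 1).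
    by move=> i i0; rewrite mxE (negbTE i0) /= clip1 nu0 mulr0 subrr addr0 mul0r.
  have c1 : co (s, 1) = y0 (s, 1) by rewrite /co /= clip1 subrr add0r mul1r.
  have e1 : co (s, 1) * set_val (N (s, 1)) ord0 ord0 = 1 by rewrite c1 -expr2 h2.
  have e2 : si (s, 1) = 0 by rewrite /si c1 h2 subrr sqrtr0.
  by rewrite (rot_pole h1 e1 e2) toS_e.
Qed.

End Collapse.

(** * Based homotopy classes *)

Section HomotopyClass.
Variables (R : realType) (T A0 : topologicalType) (bp : T -> Prop) (a0 : A0).
Implicit Types f g h : T -> A0.

(* Homotopies parametrized by the whole line, with [clip]ped time, so that they
   can be pasted together. *)
Lemma based_htpcP f g : based_htpc R bp a0 f g <->
  exists H : T * R -> A0, [/\ continuous H, forall u, H (u, 0) = f u,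
    forall u, H (u, 1) = g u & forall u t, bp u -> H (u, t) = a0].
Proof.
split=> [[H [cH [H0 [H1 Hb]]]]|[H [cH H0 H1 Hb]]].
  exists (fun p => H (p.1, toI p.2)); split.
  - apply: (cont_comp (f := fun p : T * R => (p.1, toI p.2))) cH.
    by apply: cont_pair; [exact: cont_fst|apply: (cont_comp (f := snd)); [exact: cont_snd|exact: toI_cont]].
  - by move=> u; rewrite H0 // toIE clip0.
  - by move=> u; rewrite H1 // toIE clip1.
  - by move=> u t bu; rewrite Hb.
exists (fun p => H (p.1, set_val p.2)); split; last split; last split.
- apply: (cont_comp (f := fun p : T * Iu R => (p.1, set_val p.2))) cH.
  by apply: cont_pair; [exact: cont_fst|apply: (cont_comp (f := snd)); [exact: cont_snd|exact: set_val_cont]].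
- by move=> u t /= ->.
- by move=> u t /= ->.
- by move=> u t /=; exact: Hb.
Qed.

Lemma htpc_sym f g : based_htpc R bp a0 f g -> based_htpc R bp a0 g f.
Proof.
move=> /based_htpcP[H [cH H0 H1 Hb]]; apply/based_htpcP.
exists (fun p => H (p.1, 1 - p.2)); split.
- by apply: (cont_comp (f := fun p : T * R => (p.1, 1 - p.2))) => //; cont.
- by move=> u /=; rewrite subr0.
- by move=> u /=; rewrite subrr.
- by move=> u t /=; exact: Hb.
Qed.

Lemma htpc_trans f g h : based_htpc R bp a0 f g -> based_htpc R bp a0 g h ->
  based_htpc R bp a0 f h.
Proof.
move=> /based_htpcP[H [cH H0 H1 Hb]] /based_htpcP[K [cK K0 K1 Kb]].
apply/based_htpcP.
exists (fun p => if p.2 <= 2^-1 then H (p.1, 2 * p.2) else K (p.1, 2 * p.2 - 1)).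
split.
- apply: paste; [by cont|by cont| | |].
  + by apply: (cont_comp (f := fun p : T * R => (p.1, 2 * p.2))) => //; cont.
  + by apply: (cont_comp (f := fun p : T * R => (p.1, 2 * p.2 - 1))) => //; cont.
  + by move=> [u t] /= ->; rewrite mulfV ?pnatr_eq0 // subrr H1 K0.
- by move=> u /=; rewrite mulr0 invr_ge0 ler0n.
- move=> u /=; rewrite ifF; last by apply/negbTE; rewrite -ltNge; lra.
  by rewrite (_ : 2 * 1 - 1 = 1) //; lra.
- by move=> u t bu /=; rewrite Hb // Kb // if_same.
Qed.

Lemma hclass_eq f g : based_htpc R bp a0 f g -> hclass R bp a0 f = hclass R bp a0 g.
Proof.
move=> fg; rewrite predeqE => h; split=> -[bh fh]; split=> //.
  exact: htpc_trans (htpc_sym fg) fh.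
exact: htpc_trans fg fh.
Qed.

End HomotopyClass.

(** * Realizing an element *)

Lemma near_seq (T : topologicalType) (I : eqType) (v : T) (ks : seq I) (P : I -> T -> Prop) :
  (forall k, k \in ks -> \forall u \near v, P k u) ->
  \forall u \near v, forall k, k \in ks -> P k u.
Proof.
elim: ks => [|k ks IH] h; first by apply: (@filterS _ (nbhs v) _ setT) => //; exact: filterT.
have h1 := h k (mem_head _ _).
have h2 : \forall u \near v, forall k, k \in ks -> P k u.
  by apply: IH => i iks; apply: h; rewrite inE iks orbT.
move: h1 h2; apply: filterS2 => u Pk Pks i; rewrite inE => /orP[/eqP -> //|]; exact: Pks.
Qed.

Section Construction.
Variable R : realType.
Variables (X : pseudoMetricType R) (A : nat -> topologicalType).
Variables (x : nat -> X) (a : forall j, A j) (y0 : X).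
Hypothesis hX : hausdorff_space X.
Hypothesis hA : forall j, hausdorff_space (A j).
Hypothesis scA : forall j, seq_connected R 1 (A j) (a j).
Local Notation Y := (Adj X A x a).
Local Notation Yt := (Ytilde R X A x a y0).
Local Notation concat := (@Defs.concat R _).
Local Notation ptil := (ptil R X A x a y0).
Local Notation Acal := (Acal R X A x a y0).
Local Notation Xt := (Xtilde R X A x a y0).
Local Notation Yt0 := (@Yt0 R X A x a y0).
Local Notation uA j := (unio X A x a j).
Variable m : nat.
Local Notation S := (Sph R m.+1).
(** The pairs [(J k, d k)] with [valid k] are the indices at which a class is prescribed; [valid]
    singles out the numbers that code such a pair. *)
Variables (valid : nat -> Prop) (J : nat -> nat) (d : nat -> Yt).
Variable psi : forall j, Yt -> S -> A j.
Hypothesis dX : forall k, valid k -> ptil (d k) = inX (x (J k)).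
Hypothesis d_inj : forall k k', valid k -> valid k' -> J k = J k' -> d k = d k' -> k = k'.
Hypothesis psi_cont : forall k, valid k -> continuous (psi (J k) (d k)).
Hypothesis psi_e : forall k, valid k -> psi (J k) (d k) Se = a (J k).
Hypothesis psi_small : forall j (V : set (A j)), open V -> V (a j) ->
  exists ks : seq nat, forall k, valid k -> J k = j -> k \notin ks ->
    forall s, V (psi j (d k) s).
Variables (G : R -> Yt) (lo hi : nat -> R).
Hypothesis cG : continuous G.
Hypothesis G0 : G 0 = Yt0.
Hypothesis GX : forall t, Xt (G t).
Hypothesis lohi : forall k, [/\ 0 <= lo k, lo k < hi k & hi k <= 1].
Hypothesis Gd : forall k t, lo k < t < hi k -> G t = d k.
Hypothesis disj : forall k k' t, lo k < t < hi k -> lo k' < t < hi k' -> k = k'.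

Let theta (v : S) : R := (1 - set_val v ord0 ord0) / 2.
Let slab k v := lo k < theta v < hi k.

Let theta_cont : continuous theta.
Proof.
apply: contM; last exact: cont_cst.
apply: contD; first exact: cont_cst.
by apply: contN; apply: coord_cont; exact: set_val_cont.
Qed.

Let slab_open k : open [set v | slab k v].
Proof.
rewrite (_ : [set v | _] = [set v | 0 < theta v - lo k] `&` [set v | 0 < hi k - theta v]).
  apply: openI; apply: open_pos; apply: contD => //; try exact: cont_cst.
  exact: contN.
rewrite predeqE => v /=; rewrite !subr_gt0; split=> [/andP//|[h1 h2]].
by apply/andP.
Qed.

Let collapse_ex k : exists H : S * R -> S, [/\ continuous H, forall s, H (s, 0) = s,
    forall t, H (Se, t) = Se & forall s : S, ~ slab k s -> H (s, 1) = Se].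
Proof.
have [l0 lh h1] := lohi k.
have [|||H [cH H0 He H1]] := @slab_collapse R m (1 - 2 * hi k) (1 - 2 * lo k); try lra.
exists H; split=> // s ns; apply: H1 => sl; apply: ns.
by rewrite /slab /theta; move: sl; lra.
Qed.

Let col k := sval (cid (collapse_ex k)).
Let q k v := col k (v, 1).

Let q_cont k : continuous (q k).
Proof.
have [cH _ _ _] := svalP (cid (collapse_ex k)).
by apply: (cont_comp (f := fun v : S => (v, 1 : R))) cH; cont.
Qed.

Let q_out k v : ~ slab k v -> q k v = Se.
Proof. by have [_ _ _ h] := svalP (cid (collapse_ex k)); exact: h. Qed.

Let pth (v : S) : R -> S := sval (cid (sph_path v (ltn0Sn m))).

Let pth_cont v : continuous (pth v).
Proof. by have [h _ _] := svalP (cid (sph_path v (ltn0Sn m))). Qed.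
Let pth0 v : pth v 0 = Se.
Proof. by have [_ h _] := svalP (cid (sph_path v (ltn0Sn m))). Qed.
Let pth1 v : pth v 1 = v.
Proof. by have [_ _ h] := svalP (cid (sph_path v (ltn0Sn m))). Qed.

Let phi k (s : S) : Y := inA (J k) (psi (J k) (d k) s).

Let phi_cont k : valid k -> continuous (phi k).
Proof. by move=> vk; apply: (cont_comp (psi_cont vk)); exact: inA_cont. Qed.

Let phi_e k : valid k -> phi k Se = inX (x (J k)).
Proof. by move=> vk; rewrite /phi psi_e // inA_bp. Qed.

Let arc_cont k (p : R -> S) : valid k -> continuous p -> continuous (phi k \o p).
Proof. by move=> vk cp; apply: (cont_comp cp); exact: phi_cont. Qed.

Let arc0 k (p : R -> S) : valid k -> p 0 = Se -> (phi k \o p) 0 = ptil (d k).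
Proof. by move=> vk p0; rewrite /= p0 phi_e // dX. Qed.

Let ext_arc k (p p' : R -> S) : valid k -> continuous p -> continuous p' ->
  p 0 = Se -> p' 0 = Se -> p 1 = p' 1 -> ext (d k) (phi k \o p) = ext (d k) (phi k \o p').
Proof.
move=> vk cp cp' p0 p0' p1.
apply: (ext_inA_eq hX hA scA (c := psi (J k) (d k) \o p) (c' := psi (J k) (d k) \o p')).
- exact: dX.
- by apply: (cont_comp cp); exact: psi_cont.
- by apply: (cont_comp cp'); exact: psi_cont.
- by rewrite /= p0 psi_e.
- by rewrite /= p0' psi_e.
- by rewrite /= p1.
Qed.

(** The lift, through [d k], of the map inserted on slab [k]. By [ext_arc] it does not depend on the
    auxiliary path in the sphere that leads to [q k v]. *)
Let lam k v : Yt := ext (d k) (phi k \o pth (q k v)).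

Let ptil_lam k v : valid k -> ptil (lam k v) = phi k (q k v).
Proof.
move=> vk; rewrite /lam ptil_ext /= ?pth1 //; first exact: arc_cont.
exact: arc0.
Qed.

Let lam_Acal k v : valid k -> Acal (J k) (d k) (lam k v).
Proof.
move=> vk; apply/AcalP; first exact: dX.
exists (psi (J k) (d k) \o pth (q k v)); split=> //.
- by apply: (cont_comp (@pth_cont _)); exact: psi_cont.
- by rewrite /= pth0 psi_e.
Qed.

Let f v : Yt := match pselect (exists k, valid k /\ slab k v) with
  | left h => lam (sval (cid h)) v
  | right _ => G (theta v)
  end.

Let f_in k v : valid k -> slab k v -> f v = lam k v.
Proof.
move=> vk sk; rewrite /f; case: pselect => [h|[]]; last by exists k.
by case: cid => k' [vk' sk'] /=; rewrite (disj sk sk').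
Qed.

Let f_out v : ~ (exists k, valid k /\ slab k v) -> f v = G (theta v).
Proof. by move=> n; rewrite /f; case: pselect. Qed.

Let f_cont_in k v (O : set Yt) : valid k -> slab k v -> nbhs (f v) O ->
  nbhs v (f @^-1` O).
Proof.
move=> vk sk; rewrite (f_in vk sk) => /nbhs_Yt[U [oU Uz UO]].
have oW : open (phi k @^-1` U) by apply: (iffLR (continuousP _) (phi_cont vk)).
have Wq : (phi k @^-1` U) (q k v) by rewrite /= -ptil_lam.
have n1 := q_cont (sph_local oW Wq).
have n2 := nbhs_open (slab_open k) sk.
have n1' : \forall v' \near v, exists p : R -> S,
  [/\ continuous p, p 0 = q k v, p 1 = q k v' & forall t, (phi k @^-1` U) (p t)] by exact: n1.
move: n1' n2; apply: filterS2 => v' [p [cp p0 p1 pU]] sk'.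
rewrite /= (f_in vk sk') /lam.
have cpp : continuous (concat (pth (q k v)) p) by apply: concat_cont; rewrite ?pth1.
rewrite (@ext_arc k _ (concat (pth (q k v)) p)) ?concat0 ?concat1 ?pth0 ?pth1 //.
rewrite concat_comp -ext_ext.
- apply: UO => [||t _]; [exact: arc_cont| |exact: pU].
  by rewrite ptil_lam //= p0.
- exact: arc_cont.
- exact: arc_cont.
- exact: arc0.
- by rewrite /= p0 pth1.
Qed.

(** Slabs may accumulate at [v]. A nearby value in slab [k] is reached by a whisker to [d k]
    followed by an arc of [A (J k)] inside [U]. For large [J k] the whole of [A (J k)] lies in [U];
    for each smaller one, all but finitely many [k] have their whole map in [U]. For the remaining
    [k], [q k] is the base point at [v], so a short path in the sphere supplies the arc. *)
Let f_cont_out v (O : set Yt) : ~ (exists k, valid k /\ slab k v) -> nbhs (f v) O ->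
  nbhs v (f @^-1` O).
Proof.
move=> nv; rewrite (f_out nv) => nO; have [u pz] := GX (theta v).
have [U [oU Uz UO]] := iffLR (nbhs_Yt _ _) nO.
have nU : nbhs (inX u : Y) U by rewrite -[inX u]pz; exact: nbhs_open.
have [_ _ [k0 [V0 [nV0 V0U]]]] := nbhs_inX nU.
pose U' := U `&` ((@pX X A x a) @^-1` V0^°).
have oU' : open U'.
  apply: openI => //; apply: (iffLR (continuousP _) (@pX_cont X A x a)).
  exact: open_interior.
have n1 : \forall v' \near v, exists e : R -> Y, [/\ continuous e,
    e 0 = ptil (G (theta v)), forall t, 0 <= t <= 1 -> U' (e t) &
    G (theta v') = ext (G (theta v)) e].
  have nW : nbhs (G (theta v)) [set w | exists e : R -> Y, [/\ continuous e,
    e 0 = ptil (G (theta v)), forall t, 0 <= t <= 1 -> U' (e t) &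
    w = ext (G (theta v)) e]].
    apply/nbhs_Yt; exists U'; split=> //; last by move=> e *; exists e.
    by split=> //; rewrite pz; exact: nV0.
  exact: (cont_comp theta_cont cG nW).
have ks_ex j : exists ks : seq nat, U (inX (x j)) -> forall k, valid k -> J k = j ->
    k \notin ks -> forall s, U (inA j (psi j (d k) s)).
  have [Ux|Ux] := pselect (U (inX (x j))); last by exists [::].
  have [||ks ksP] := psi_small (V := inA j @^-1` U).
  - by apply: (iffLR (continuousP _) (@inA_cont X A x a j)).
  - by rewrite /= inA_bp.
  - by exists ks.
have /choice [ks ksP] := ks_ex.
have n2 : \forall v' \near v, forall k, k \in flatten [seq ks j | j <- iota 0 k0] ->
    valid k -> U (inX (x (J k))) -> exists p : R -> S, [/\ continuous p, p 0 = Se,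
    p 1 = q k v' & forall t, U (phi k (p t))].
  apply: (near_seq (P := fun k v' => valid k -> U (inX (x (J k))) ->
    exists p : R -> S, [/\ continuous p, p 0 = Se,
    p 1 = q k v' & forall t, U (phi k (p t))])) => k _.
  have [vk|nvk] := pselect (valid k); last by apply: (@nearW _ (nbhs v)).
  have [Ux|Ux] := pselect (U (inX (x (J k)))); last by apply: (@nearW _ (nbhs v)).
  have oW : open (phi k @^-1` U) by apply: (iffLR (continuousP _) (phi_cont vk)).
  have We : (phi k @^-1` U) Se by rewrite /= phi_e.
  have qe : q k v = Se by apply: q_out => sk; apply: nv; exists k.
  have nq : \forall v' \near v, exists p : R -> S,
    [/\ continuous p, p 0 = Se, p 1 = q k v' & forall t, (phi k @^-1` U) (p t)].
    have ns : nbhs (q k v) [set s | exists p : R -> S,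
        [/\ continuous p, p 0 = Se, p 1 = s & forall t, (phi k @^-1` U) (p t)]].
      by rewrite qe; exact: (sph_local oW We).
    exact: (q_cont ns).
  by move: nq; apply: (@filterS _ (nbhs v)) => v' h _ _; exact: h.
move: n1 n2; apply: filterS2 => v' [e [ce e0 eU GE]] h2; rewrite /=.
have [[k [vk sk]]|nv'] := pselect (exists k, valid k /\ slab k v'); last first.
  by rewrite f_out // GE; apply: UO => // t /eU[].
have de : d k = ext (G (theta v)) e by rewrite -GE (Gd sk).
have e1 : e 1 = inX (x (J k)) by rewrite -dX // de ptil_ext.
have [Ux V0x] : U' (inX (x (J k))) by rewrite -e1; apply: eU; rewrite lexx ler01.
have [p [cp p0 p1 pU]] : exists p : R -> S, [/\ continuous p, p 0 = Se,
    p 1 = q k v' & forall t, U (phi k (p t))].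
  have [Jk|kJ] := ltnP (J k) k0; last first.
    exists (pth (q k v')); split=> // t; apply: V0U => //.
    exact: interior_subset V0x.
  have [kks|kks] := boolP (k \in ks (J k)).
    apply: h2 => //; apply/flattenP; exists (ks (J k)) => //.
    by apply/mapP; exists (J k) => //; rewrite mem_iota.
  by exists (pth (q k v')); split=> // t; apply: ksP.
rewrite (f_in vk sk) /lam (@ext_arc k _ p) ?pth1 ?pth0 //.
have cpp := arc_cont vk cp.
have pp0 : (phi k \o p) 0 = e 1 by rewrite arc0 // dX.
rewrite de ext_ext //; apply: UO.
- exact: concat_cont.
- by rewrite concat0.
- move=> t t01; rewrite /Defs.concat; case: leP => t2; last exact: pU.
  by have [] : U' (e (2 * t)) by apply: eU; move: t01; lra.
Qed.

Let f_cont : continuous f.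
Proof.
move=> v O nO; have [[k [vk sk]]|nv] := pselect (exists k, valid k /\ slab k v).
  exact: f_cont_in sk nO.
exact: f_cont_out nO.
Qed.

Let f_bp s : sph_bp R m.+1 s -> f s = Yt0.
Proof.
move=> se; have t0 : theta s = 0 by rewrite /theta se mxE eqxx subrr mul0r.
rewrite f_out ?t0 // => -[k [_ /andP[]]]; rewrite t0; have [l0 _ _] := lohi k.
by move=> ?; lra.
Qed.

(** Were the coordinate nontrivial, [v] would lie in a slab [k] with [J k = j], and [f v] in both
    [Acal j (d k)] and [Acal j z], which forces [d k = z]. *)
Let proj_out j z v : ptil z = inX (x j) ->
  (forall k, valid k -> slab k v -> ~ (J k = j /\ d k = z)) ->
  uA j (ptil (rtil R X A x a y0 j z (f v))) = a j.
Proof.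
move=> pz nk; have az : uA j (ptil z) = a j by rewrite pz uA_inX.
have [Az|nAz] := pselect (Acal j z (f v)); last by rewrite rtil_out.
rewrite rtil_in //; apply: contrapT => nb.
have [[k [vk sk]]|nv] := pselect (exists k, valid k /\ slab k v); last first.
  have [u pu] := GX (theta v).
  by apply: nb; rewrite f_out // pu; exact: uA_inX.
have fE := f_in vk sk; rewrite fE in Az nb.
have Ak := lam_Acal v vk.
have Jj : j = J k.
  apply: (UA_UA nb); rewrite ptil_lam // /phi /UA /= uA_inA => e.
  by apply: nb; rewrite ptil_lam // /phi e inA_bp uA_inX.
subst j; apply: (nk k vk sk); split=> //.
exact: (Acal_eq hX hA scA (dX vk) pz Ak Az).
Qed.

(** The component at [(J k, d k)] is exactly the prescribed map composed with [q k], and [q k] is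
    homotopic to the identity relative to the base point. *)
Lemma sphere_map : exists f : S -> Yt,
  [/\ continuous f, forall s, sph_bp R m.+1 s -> f s = Yt0,
   forall k, valid k -> hclass R (@sph_bp R m.+1) (a (J k)) (psi (J k) (d k)) =
     Phi_comp R X A x a y0 m.+1 f (J k) (d k) &
   forall j z, ptil z = inX (x j) -> (forall k, valid k -> ~ (J k = j /\ d k = z)) ->
     zero_class R A a m.+1 j = Phi_comp R X A x a y0 m.+1 f j z].
Proof.
exists f; split=> //.
- move=> k vk; rewrite /Phi_comp.
  rewrite (_ : _ \o f = psi (J k) (d k) \o q k); last first.
    apply/funext => v /=; have [sk|nsk] := pselect (slab k v).
      rewrite (f_in vk sk) rtil_in; last exact: lam_Acal.
      by rewrite ptil_lam // /phi uA_inA.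
    rewrite proj_out ?q_out ?psi_e //; first exact: dX.
    by move=> k' vk' sk' [eJ ed]; apply: nsk; rewrite (d_inj vk vk' (esym eJ) (esym ed)).
  apply: hclass_eq; apply/based_htpcP.
  have [cH H0 He _] := svalP (cid (collapse_ex k)); rewrite -/(col k) in cH H0 He.
  exists (fun p => psi (J k) (d k) (col k p)); split.
  + by apply: (cont_comp cH); exact: psi_cont.
  + by move=> u; rewrite H0.
  + by [].
  + by move=> u t ue; rewrite (_ : u = Se) ?He ?psi_e //; exact: val_inj.
- move=> j z pz nk; rewrite /Phi_comp /zero_class; congr (hclass R _ _ _).
  apply/funext => v /=; rewrite proj_out // => k vk _; exact: nk.
Qed.

End Construction.

Lemma nbhs_wedge (R : realType) k (O : set (Hw R k)) : nbhs (None : Hw R k) O ->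
  exists N, forall i, (N <= i)%N -> forall s, O (ell R k i s).
Proof.
pose P (O : set (Hw R k)) := exists N, forall i, (N <= i)%N -> forall s, O (ell R k i s).
apply: (@subbase_nbhs_ind _ _ (@openHw R k) _ P).
- by exists 0%N.
- by move=> B [_ BN] /BN.
- move=> B C [N NB] [N' NC]; exists (maxn N N') => i; rewrite geq_max => /andP[Ni N'i] s.
  by split; [exact: NB|exact: NC].
- by move=> B C BC [N NB]; exists N => i Ni s; apply: BC; exact: NB.
Qed.

(** * From the two conditions to a map of the sphere *)

Section Realization.
Variable R : realType.
Variables (X : pseudoMetricType R) (A : nat -> topologicalType).
Variables (x : nat -> X) (a : forall j, A j) (y0 : X).
Hypothesis hX : hausdorff_space X.
Hypothesis hA : forall j, hausdorff_space (A j).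
Hypothesis scA : forall j, seq_connected R 1 (A j) (a j).
Local Notation Yt := (Ytilde R X A x a y0).
Local Notation Xt := (Xtilde R X A x a y0).
Local Notation Yt0 := (@Yt0 R X A x a y0).
Variables (m : nat) (g : forall j, Yt -> set (Sph R m.+1 -> A j)).
Hypothesis gG : in_G R X A x a y0 m.+1 g.
Local Notation suppj := (supp_j R X A x a y0 m.+1 g).

(** The common form of the two alternatives in (2): representatives that are small outside a finite
    part of the support. *)
Definition good_reps j (psi : Yt -> Sph R m.+1 -> A j) :=
  (forall z, suppj j z -> based_map (@sph_bp R m.+1) (a j) (psi z) /\
     @g j z = hclass R (@sph_bp R m.+1) (a j) (psi z)) /\
  forall V, open V -> V (a j) -> exists ls : seq Yt, forall z, suppj j z ->
    z \notin ls -> forall s, V (psi z s).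

Lemma finite_good_reps j : finite_set (suppj j) -> exists psi, @good_reps j psi.
Proof.
move=> /finite_seqP[ls lsE].
have /choice [psi psiP] : forall z, exists psi : Sph R m.+1 -> A j, suppj j z ->
    based_map (@sph_bp R m.+1) (a j) psi /\ @g j z = hclass R (@sph_bp R m.+1) (a j) psi.
  move=> z; have [[pz nz]|n] := pselect (suppj j z); last by exists (cst (a j)).
  by have [f fP] := gG pz; exists f.
exists psi; split; first exact: psiP.
by move=> V _ _; exists ls => z; rewrite lsE /= => ->.
Qed.

Lemma infinite_good_reps j (e : nat -> Yt) (h : Hw R m.+1 -> A j) :
  injective e -> range e = suppj j -> based_map (Hw_bp R m.+1) (a j) h ->
  (forall i, @g j (e i) = hclass R (sph_bp R m.+1) (a j) (h \o ell R m.+1 i)) ->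
  exists psi, @good_reps j psi.
Proof.
move=> ei er [ch bh] gh; pose idx z := xget 0%N [set i | e i = z].
have idxK i : idx (e i) = i.
  by rewrite /idx; case: xgetP => [i' _ /ei //|/(_ i)]; case.
exists (fun z => h \o ell R m.+1 (idx z)); split.
  rewrite -er => _ [i _ <-]; rewrite idxK; split; last exact: gh.
  split; first by apply: (cont_comp (@ell_cont R m.+1 i)).
  by move=> s se; rewrite /= ell_e // bh.
move=> V oV Va; have [|N NP] := @nbhs_wedge R m.+1 (h @^-1` V).
  by apply: ch; rewrite bh //; exact: nbhs_open.
exists [seq e i | i <- iota 0 N]; rewrite -er => _ [i _ <-] ni s; rewrite idxK.
apply: NP; rewrite leqNgt; apply/negP => iN; move/negP : ni; apply.
by apply/mapP; exists i => //; rewrite mem_iota.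
Qed.

Lemma image_bwd : compact (closure (supp R X A x a y0 m.+1 g) `&` Xt) ->
  (forall j, countable (suppj j)) -> (forall j, exists psi, @good_reps j psi) ->
  in_Im_Phi R X A x a y0 m.+1 g.
Proof.
move=> cK cS exr.
pose psi j := sval (cid (exr j)).
have psiP j : good_reps (psi j) by exact: svalP (cid (exr j)).
have cinj j : exists c : Yt -> nat, {in suppj j &, injective c}.
  by apply/countable_injP.
pose c j := sval (cid (cinj j)).
have cP j : {in suppj j &, injective (c j)} by exact: svalP (cid (cinj j)).
pose code (p : nat * Yt) := choice.pickle (p.1, c p.1 p.2).
have code_inj p p' : suppj p.1 p.2 -> suppj p'.1 p'.2 -> code p = code p' -> p = p'.
  case: p p' => [j z] [j' z'] /= sz sz' /(pcan_inj (@choice.pickleK _))[jj' e].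
  by subst j'; rewrite (cP j z z' (mem_set sz) (mem_set sz') e).
pose valid k := exists p, suppj p.1 p.2 /\ code p = k.
pose Jd k := if pselect (valid k) is left h then sval (cid h) else (0%N, Yt0).
have JdP k : valid k -> suppj (Jd k).1 (Jd k).2 /\ code (Jd k) = k.
  by rewrite /Jd; case: pselect => // h _; exact: svalP (cid h).
pose J k := (Jd k).1; pose d k := (Jd k).2.
(* The base point is added as the start of the walk and as the value of [d] at numbers that code no
   pair. *)
pose K := (closure (supp R X A x a y0 m.+1 g) `&` Xt) `|` [set Yt0].
have KX : K `<=` Xt by move=> z [[]//|->]; exists y0; exact: ptil_Yt0.
have Kd k : K (d k).
  have [vk|nvk] := pselect (valid k).
    have [[pz nz] _] := JdP k vk; left; split; last by exists (x (J k)).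
    by apply: subset_closure; exists (J k).
  by right; rewrite /d /Jd; case: pselect.
have [G [lo [hi [[cG G0] GX lohi Gd disj]]]] := Xt_walk hX hA scA
  (compactU cK (compact_set1 (x := Yt0))) KX (or_intror erefl) Kd.
have dX k : valid k -> Defs.ptil R X A x a y0 (d k) = inX (x (J k)).
  by move=> vk; have [[]] := JdP k vk.
have d_inj k k' : valid k -> valid k' -> J k = J k' -> d k = d k' -> k = k'.
  move=> vk vk' eJ ed; have [_ <-] := JdP k vk; have [_ <-] := JdP k' vk'.
  by rewrite /code -/(J k) -/(d k) eJ ed.
have psi_cont k : valid k -> continuous (psi (J k) (d k)).
  by move=> vk; have [sk _] := JdP k vk; have [[]] := (psiP (J k)).1 _ sk.
have psi_e k : valid k -> psi (J k) (d k) Se = a (J k).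
  move=> vk; have [sk _] := JdP k vk; have [[_ h] _] := (psiP (J k)).1 _ sk.
  exact: h.
have psi_small j V : open V -> V (a j) -> exists ks : seq nat,
    forall k, valid k -> J k = j -> k \notin ks -> forall s, V (psi j (d k) s).
  move=> oV Va; have [ls lsP] := (psiP j).2 V oV Va.
  exists [seq code (j, z) | z <- ls] => k vk Jk nk s; apply: lsP.
    by have [sk _] := JdP k vk; rewrite -Jk.
  apply: contra nk => dl; apply/mapP; exists (d k) => //.
  by have [_ {1}<-] := JdP k vk; rewrite -Jk /J /d; case: (Jd k).
have [f [cf f_bp fP fN]] := sphere_map hX hA scA dX d_inj psi_cont psi_e psi_small
  cG G0 GX lohi Gd disj.
exists f; split=> //; first by move=> s /f_bp fs; apply/Yt_bpP.
move=> j z pz; have [sz|nsz] := pselect (suppj j z); last first.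
  rewrite -fN //; first by apply: contrapT => gz; apply: nsz.
  by move=> k vk [eJ ed]; apply: nsz; have [sk _] := JdP k vk; rewrite -eJ -ed.
have vk : valid (code (j, z)) by exists (j, z).
have [sk ck] := JdP _ vk; have e := code_inj _ (j, z) sk sz ck.
have [_ ->] := (psiP j).1 z sz.
(* The type of [psi j] depends on [j]; stating the equation for pairs permits rewriting along
   [e]. *)
pose P (p : nat * Yt) := hclass R (@sph_bp R m.+1) (a p.1) (psi p.1 p.2) =
  Phi_comp R X A x a y0 m.+1 f p.1 p.2.
have : P (Jd (code (j, z))) by exact: fP.
by rewrite e.
Qed.

End Realization.

Theorem theorem6p20 (R : realType) (n : nat) (X : pseudoMetricType R)
  (y0 : X) (x : nat -> X) (A : nat -> topologicalType) (a : forall j, A j) :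
  (2 <= n)%N ->
  peano_continuum R X -> one_dimensional X ->
  (forall j, hausdorff_space (A j)) ->
  (forall j, seq_connected R n.-1 (A j) (a j)) ->
  (forall j, pin_residual R n (A j) (a j)) ->
  forall g : forall j, Ytilde R X A x a y0 -> set (Sph R n -> A j),
  in_G R X A x a y0 n g ->
  (in_Im_Phi R X A x a y0 n g <->
   (compact (closure (supp R X A x a y0 n g) `&` Xtilde R X A x a y0) /\
    forall j,
      finite_set (supp_j R X A x a y0 n g j) \/
      exists e : nat -> Ytilde R X A x a y0,
        [/\ injective e, range e = supp_j R X A x a y0 n g j &
          exists h : Hw R n -> A j,
            based_map (Hw_bp R n) (a j) h /\
            forall i, g j (e i) = hclass R (sph_bp R n) (a j) (h \o ell R n i)])).
Proof.
case: n => [//|[//|m]] _ [hX _ _ _] _ hA sc _ g gG.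
have scA j : seq_connected R 1 (A j) (a j) by move=> k k1; apply: sc; exact: leq_trans k1 _.
split=> [[f [cf f_bp gE]]|[cK h2]].
  apply: (image_fwd hX hA scA _ cf) gE => //.
  by move=> s /f_bp/Yt_bpP.
apply: (image_bwd hX hA scA cK) => j; have [fin|[e [ei er [h [bh gh]]]]] := h2 j.
- exact: finite_set_countable.
- by rewrite -er; apply: sub_countable (card_image_le _ _) _.
- exact: finite_good_reps.
- exact: (infinite_good_reps ei er bh gh).
Qed.
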